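(* For every $q\in\mathbb{C}$ with $|q|=1$, the $C^*$-algebra $\mathcal{A}_2^q$ is not nuclear.
   Context: For $q\in\mathbb{C}$ with $|q|=1$, $\mathcal{A}_2^q$ denotes the universal unital $C^*$-algebra generated by two isometries $s_1,s_2$ (i.e. $s_1^*s_1=s_2^*s_2=1$) satisfying the relation $s_2s_1=q\,s_1s_2$. *)

(* Defs.v *)
From HB Require Import structures.
From mathcomp Require Import all_boot all_order all_algebra.
From mathcomp Require Import complex.
From mathcomp Require Import all_classical all_reals.
From mathcomp Require Import topology normedtype.

Set Implicit Arguments.
Unset Strict Implicit.
Unset Printing Implicit Defensive.

Import Order.TTheory GRing.Theory Num.Theory.
Import numFieldNormedType.Exports.

Local Open Scope classical_set_scope.
Local Open Scope ring_scope.
Local Open Scope complex_scope.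

(* MathComp's rings are unital, and C*-algebras need not be, so the product   *)
(* is part of the mixin rather than inherited from algType. The zero algebra  *)
(* is allowed. Norms take their values in R[i], as in normedModType R[i].     *)
HB.mixin Record CompleteNormedModule_isCStarAlgebra (R : realType) A
    of CompleteNormedModule R[i] A := {
  cmul : A -> A -> A;
  cstar : A -> A;
  cmulA : forall a b c, cmul a (cmul b c) = cmul (cmul a b) c;
  cmulDl : forall a b c, cmul (a + b) c = cmul a c + cmul b c;
  cmulDr : forall a b c, cmul a (b + c) = cmul a b + cmul a c;
  cmulZl : forall (k : R[i]) a b, cmul (k *: a) b = k *: cmul a b;
  cmulZr : forall (k : R[i]) a b, cmul a (k *: b) = k *: cmul a b;
  cstarK : forall a, cstar (cstar a) = a;
  cstarD : forall a b, cstar (a + b) = cstar a + cstar b;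
  cstarZ : forall (k : R[i]) a, cstar (k *: a) = Num.conj k *: cstar a;
  cstarM : forall a b, cstar (cmul a b) = cmul (cstar b) (cstar a);
  cnorm_mul : forall a b, `|cmul a b| <= `|a| * `|b|;
  cnorm_star_mul : forall a, `|cmul (cstar a) a| = `|a| ^+ 2
}.

#[short(type="cstarAlgType")]
HB.structure Definition CStarAlgebra (R : realType) :=
  {A of CompleteNormedModule R[i] A & CompleteNormedModule_isCStarAlgebra R A}.

HB.mixin Record CStarAlgebra_isUnital (R : realType) A of CStarAlgebra R A := {
  cone : A;
  cmul1x : forall a : A, cmul cone a = a;
  cmulx1 : forall a : A, cmul a cone = a
}.

#[short(type="unitalCStarAlgType")]
HB.structure Definition UnitalCStarAlgebra (R : realType) :=
  {A of CStarAlgebra R A & CStarAlgebra_isUnital R A}.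

Notation "a ** b" := (cmul a b) (at level 40, left associativity) : ring_scope.
Notation "a ^#" := (cstar a) (at level 1, format "a ^#") : ring_scope.

Section Universal.
Variable R : realType.

Record unital_star_hom (A B : unitalCStarAlgType R) (f : {linear A -> B}) :
    Prop := UnitalStarHom {
  hom_one : f cone = cone;
  hom_mul : forall a b, f (a ** b) = f a ** f b;
  hom_star : forall a, f a^# = (f a)^#
}.

Record unital_cstar_subalgebra (A : unitalCStarAlgType R) (S : set A) : Prop :=
    UnitalCStarSubalgebra {
  sub_closed : closed S;
  sub_one : S cone;
  sub_add : forall a b, S a -> S b -> S (a + b);
  sub_scale : forall (k : R[i]) a, S a -> S (k *: a);
  sub_mul : forall a b, S a -> S b -> S (a ** b);
  sub_star : forall a, S a -> S a^#
}.

Definition generated_by2 (A : unitalCStarAlgType R) (s1 s2 : A) : Prop :=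
  forall S : set A, unital_cstar_subalgebra S -> S s1 -> S s2 -> S = setT.

Definition isometry_elt (A : unitalCStarAlgType R) (s : A) : Prop :=
  s^# ** s = cone.

Record twisted_isometries (q : R[i]) (A : unitalCStarAlgType R) (s1 s2 : A) :
    Prop := TwistedIsometries {
  twisted_isometry1 : isometry_elt s1;
  twisted_isometry2 : isometry_elt s2;
  twisted_commutation : s2 ** s1 = q *: (s1 ** s2)
}.

(* (A, s1, s2) is the universal unital C*-algebra A_2^q with its canonical    *)
(* generators; this determines it up to a unique isomorphism, since a         *)
(* *-homomorphism is continuous, hence determined by its values on s1 and s2. *)
Record is_A2q (q : R[i]) (A : unitalCStarAlgType R) (s1 s2 : A) : Prop :=
    IsA2q {
  A2q_relations : twisted_isometries q s1 s2;
  A2q_generated : generated_by2 s1 s2;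
  A2q_universal : forall (B : unitalCStarAlgType R) (t1 t2 : B),
    twisted_isometries q t1 t2 ->
    exists f : {linear A -> B}, [/\ unital_star_hom f, f s1 = t1 & f s2 = t2]
}.

End Universal.

Section Nuclear.
Variables (R : realType) (A B : cstarAlgType R).

(* An element of the algebraic tensor product of A and B is represented by a  *)
(* formal sum t : seq (A * B), standing for the sum of the p.1 (x) p.2 for p  *)
(* in t; t and u represent the same tensor iff no bilinear map tells them     *)
(* apart. The vector space sum is concatenation.                              *)
Definition same_tensor (t u : seq (A * B)) : Prop :=
  forall (V : lmodType R[i]) (f : {bilinear A -> B -> V}),
    \sum_(p <- t) f p.1 p.2 = \sum_(p <- u) f p.1 p.2.

Definition tensor_scale (k : R[i]) (t : seq (A * B)) : seq (A * B) :=
  [seq (k *: p.1, p.2) | p <- t].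

Definition tensor_mul (t u : seq (A * B)) : seq (A * B) :=
  [seq (p.1 ** r.1, p.2 ** r.2) | p <- t, r <- u].

Definition tensor_star (t : seq (A * B)) : seq (A * B) :=
  [seq (p.1^#, p.2^#) | p <- t].

Record tensor_cstar_norm (N : seq (A * B) -> R[i]) : Prop := TensorCStarNorm {
  tnorm_compat : forall t u, same_tensor t u -> N t = N u;
  tnorm_ge0 : forall t, 0 <= N t;
  tnorm_eq0 : forall t, N t = 0 -> same_tensor t [::];
  tnorm_add : forall t u, N (t ++ u) <= N t + N u;
  tnorm_scale : forall k t, N (tensor_scale k t) = `|k| * N t;
  tnorm_mul : forall t u, N (tensor_mul t u) <= N t * N u;
  tnorm_star_mul : forall t, N (tensor_mul (tensor_star t) t) = N t ^+ 2
}.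

End Nuclear.

(* Existence of a C*-norm on the algebraic tensor product (e.g. the spatial   *)
(* one) is automatic, so nuclearity is the uniqueness of the C*-norm, for     *)
(* every second factor B, unital or not.                                      *)
Definition nuclear (R : realType) (A : cstarAlgType R) : Prop :=
  forall (B : cstarAlgType R) (N1 N2 : seq (A * B) -> R[i]),
    tensor_cstar_norm N1 -> tensor_cstar_norm N2 -> N1 =1 N2.

(* Main.v *)
From HB Require Import structures.
Require Import Defs.
From mathcomp Require Import all_boot all_order all_algebra.
From mathcomp Require Import complex.
From mathcomp Require Import all_classical all_reals.
From mathcomp Require Import topology normedtype sequences.
From mathcomp Require Import lra ring.

Set Implicit Arguments.
Unset Strict Implicit.
Unset Printing Implicit Defensive.

Import Order.TTheory GRing.Theory Num.Theory.
Import numFieldNormedType.Exports.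

Local Open Scope classical_set_scope.
Local Open Scope ring_scope.
Local Open Scope complex_scope.

(** Nuclearity fails because one tensor has two different C*-norms.

    Let [W] be the free product of five copies of [Z/2], realized as reduced
    words in five letters, and let [lam i] be the left multiplication by the
    letter [i] on [l2 W]. Whatever the contractions [x i] of [A] are, the
    spatial norm of the sum of the [x i (x) lam i] is at most [2 sqrt 5], hence
    less than 5: if [Q i] is the projection onto the words that start with [i],
    then [lam i] sends the range of [Q i] to its orthogonal and conversely, so
    [lam i = Q i lam i + lam i Q i]; as the [Q i] are orthogonal to one another,
    the two halves of the sum are a column and a row of five contractions, of
    norm at most [sqrt 5] each ([paradoxical_bound]).

    On the other hand [A] has a representation [pi] which commutes with the
    [lam i] and in which suitable contractions [x i] send the vector of the
    word [i] to that of the empty word, as right multiplications do. Then the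
    sum of the [pi (x i) (lam i)] multiplies the vector of the empty word by 5.
    With [B] the commutant of the range of [pi], the maximum of the spatial norm
    and of the seminorm given by [a (x) b |-> pi a b] is a C*-norm on the
    algebraic tensor product of [A] and [B] which is not the spatial one
    ([not_nuclear_of_bounds]).

    The representation is a twisted form of the Berger-Coburn-Lebow model of a
    pair of commuting isometries. If [s1 s2] is a pure isometry, then the pair
    is determined by a unitary [U] and a projection [P] on the orthogonal of
    the range of [s1 s2], and [U] and [P] can be prescribed ([twisted_model]).
    On [l2 (nat * W * Z/5)], where [s1 s2] raises the first coordinate, take for
    [U] the rotation of the last coordinate [j], and for the symmetry [2 P - 1]
    the right multiplication of the word by the letter [j]: then
    [U^-i (2 P - 1) U^i] multiplies by [i] on the right where [j = 0]. Formulas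
    in [s1] and [s2] that give [U] and [P] on the first level turn these
    operators into contractions of any algebra which contains such a pair
    ([corner_conj]).

    The spatial norm has to be built for the abstract algebra [A], and this
    needs no states: operators act on formal sums of terms [a (x) h], with [a]
    in [A] and [h] in the Hilbert space, which carry an [A]-valued inner product
    ([gram]), and the norm of [t] is the least [c] such that
    [c^2 <xi, xi> - <t xi, t xi>] is positive for every [xi]. The only facts
    needed about positivity in [A] are that the positive elements form a closed
    proper convex cone which contains every [x^* x] (Fukamiya's theorem,
    [cpos_starM]). They are proved with norms alone, without spectral theory,
    from a square root obtained as a fixed point. *)

(** * Linear identities in a module, by reflection *)

Section LmodExpr.
Variables (K : comPzRingType) (V : lmodType K).

Inductive lexpr :=
| LAtom of nat | LAdd of lexpr & lexpr | LOpp of lexpr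
| LScale of K & lexpr | LMuln of lexpr & nat | LZero.

Fixpoint leval (env : seq V) e : V := match e with
  | LAtom i => nth 0 env i
  | LAdd a b => leval env a + leval env b
  | LOpp a => - leval env a
  | LScale k a => k *: leval env a
  | LMuln a n => leval env a *+ n
  | LZero => 0 end.

Fixpoint lcoef (i : nat) e : K := match e with
  | LAtom j => if j == i then 1 else 0
  | LAdd a b => lcoef i a + lcoef i b
  | LOpp a => - lcoef i a
  | LScale k a => k * lcoef i a
  | LMuln a n => lcoef i a *+ n
  | LZero => 0 end.

Fixpoint lbounded (m : nat) e : bool := match e with
  | LAtom j => (j < m)%N
  | LAdd a b => lbounded m a && lbounded m b
  | LOpp a => lbounded m a
  | LScale _ a => lbounded m a
  | LMuln a _ => lbounded m a
  | LZero => true end.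

Lemma levalE env e : lbounded (size env) e ->
  leval env e = \sum_(i < size env) lcoef i e *: nth 0 env i.
Proof.
elim: e => [j|a iha b ihb|a iha|k a iha|a iha n|] /=.
- move=> jm; rewrite (bigD1 (Ordinal jm)) //= eqxx scale1r big1 ?addr0 // => i.
  by rewrite -val_eqE /= eq_sym => /negbTE ->; rewrite scale0r.
- case/andP=> /iha -> /ihb ->; rewrite -big_split /=.
  by apply: eq_bigr => i _; rewrite scalerDl.
- by move=> /iha ->; rewrite -sumrN; apply: eq_bigr => i _; rewrite scaleNr.
- by move=> /iha ->; rewrite scaler_sumr; apply: eq_bigr => i _; rewrite scalerA.
- by move=> /iha ->; rewrite -sumrMnl; apply: eq_bigr => i _; rewrite scalerMnl.
- by move=> _; rewrite big1 // => i _; rewrite scale0r.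
Qed.

Fixpoint lcoefs_eq (m : nat) e1 e2 : Prop :=
  if m is m'.+1 then lcoefs_eq m' e1 e2 /\ lcoef m' e1 = lcoef m' e2 else True.

Lemma leval_eq env e1 e2 : lbounded (size env) e1 -> lbounded (size env) e2 ->
  lcoefs_eq (size env) e1 e2 -> leval env e1 = leval env e2.
Proof.
move=> b1 b2 h; rewrite !levalE //; apply: eq_bigr => i _; congr (_ *: _).
elim: (size env) {b1 b2} i h => [|m ih] [i im] //= [h he].
by move: im; rewrite ltnS leq_eqVlt => /predU1P[->//|im]; apply: (ih (Ordinal im)).
Qed.

End LmodExpr.

(* Atoms are compared up to conversion, so that differently inferred instances
   of one product are the same atom. *)
Ltac lmod_index x l :=
  match l with
  | ?y :: ?l' =>
    match constr:(Set) with
    | _ => let _ := constr:(erefl : x = y) in constr:(0%N)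
    | _ => let n := lmod_index x l' in constr:(n.+1)
    end
  end.

Ltac lmod_atoms K V t l :=
  lazymatch t with
  | ?a + ?b => let l1 := lmod_atoms K V a l in lmod_atoms K V b l1
  | - ?a => lmod_atoms K V a l
  | _ *: ?a => lmod_atoms K V a l
  | ?a *+ _ => lmod_atoms K V a l
  | 0 => l
  | _ => match constr:(Set) with
         | _ => let _ := lmod_index t l in l
         | _ => constr:(t :: l)
         end
  end.

Ltac lmod_reify K V t l :=
  lazymatch t with
  | ?a + ?b => let x := lmod_reify K V a l in let y := lmod_reify K V b l in
      constr:(@LAdd K x y)
  | - ?a => let x := lmod_reify K V a l in constr:(@LOpp K x)
  | ?k *: ?a => let x := lmod_reify K V a l in constr:(@LScale K k x)
  | ?a *+ ?n => let x := lmod_reify K V a l in constr:(@LMuln K x n)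
  | 0 => constr:(@LZero K)
  | _ => let i := lmod_index t l in constr:(@LAtom K i)
  end.

Ltac lmod_prep K V :=
  lazymatch goal with |- @eq _ ?a ?b =>
    let l0 := constr:(@nil V) in
    let l1 := lmod_atoms K V a l0 in
    let l := lmod_atoms K V b l1 in
    let ea := lmod_reify K V a l in
    let eb := lmod_reify K V b l in
    apply: (@leval_eq K V l ea eb); [by [] | by [] | rewrite /=]
  end.
Ltac lmodule K V := lmod_prep K V; repeat split; ring.

(** * Squared modulus of a complex number *)

Section Complex.
Variable R : realType.
Implicit Types z w : R[i].

Definition csq z : R := complex.Re z ^+ 2 + complex.Im z ^+ 2.

Lemma csq_ge0 z : 0 <= csq z. Proof. by rewrite addr_ge0 ?sqr_ge0. Qed.
Lemma conjM_csq z : Num.conj z * z = (csq z)%:C.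
Proof.
case: z => a b; rewrite /csq /=.
by apply/eqP; rewrite eq_complex /=; apply/andP; split; apply/eqP; ring.
Qed.
Lemma csq_eq0 z : csq z = 0 -> z = 0.
Proof.
move=> h; apply/eqP; have /eqP := conjM_csq z.
by rewrite h mulf_eq0 conjC_eq0 orbb.
Qed.
Lemma csq0 : csq 0 = 0. Proof. by rewrite /csq /= expr0n addr0. Qed.
Lemma csqM z w : csq (z * w) = csq z * csq w.
Proof. by case: z w => a b [c d]; rewrite /csq /=; ring. Qed.
Lemma csq_conj z : csq (Num.conj z) = csq z.
Proof. by case: z => a b; rewrite /csq /= sqrrN. Qed.
Lemma csqR (t : R) : csq t%:C = t ^+ 2.
Proof. by rewrite /csq /= expr0n addr0. Qed.
Lemma csqN z : csq (- z) = csq z.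
Proof. by case: z => a b; rewrite /csq /= !sqrrN. Qed.

Lemma norm_csq z : `|z| = (Num.sqrt (csq z))%:C.
Proof. by rewrite normc_def. Qed.

Lemma complex_ge0E z : 0 <= z -> z = (complex.Re z)%:C.
Proof. by move=> /ger0_real /RRe_real. Qed.
Lemma Re_ge0 z : 0 <= z -> 0 <= complex.Re z.
Proof. by move=> z0; rewrite -ler0c -complex_ge0E. Qed.
Lemma Re_mulR (t : R) z : complex.Re (t%:C * z) = t * complex.Re z.
Proof. by case: z => a b /=; rewrite mul0r subr0. Qed.
Lemma csqV z : csq z^-1 = (csq z)^-1.
Proof.
have [->|z0] := eqVneq z 0; first by rewrite invr0 csq0 invr0.
have c0 : csq z != 0 by apply: contra_neq z0; exact: csq_eq0.
by apply: (mulfI c0); rewrite -csqM !divff // (csqR 1) expr1n.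
Qed.
Lemma Re_le_sqrt_csq z : complex.Re z <= Num.sqrt (csq z).
Proof.
rewrite (le_trans (ler_norm _)) // -sqrtr_sqr ler_sqrt ?csq_ge0 //.
by rewrite lerDl sqr_ge0.
Qed.
Lemma conj_i : Num.conj ('i : R[i]) = - 'i.
Proof. by apply/eqP; rewrite eq_complex /= oppr0 !eqxx. Qed.
Lemma mul_ii : 'i * 'i = -1 :> R[i].
Proof. by rewrite -expr2 sqr_i. Qed.
End Complex.

(** * A unital C*-algebra as a ring, with a real norm *)

Section Ring.
Variables (R : realType) (A : unitalCStarAlgType R).
Let mul1 : left_id (cone : A) cmul. Proof. exact: cmul1x. Qed.
Let mulx1 : right_id (cone : A) cmul. Proof. exact: cmulx1. Qed.
Let mulDl : left_distributive (@cmul R A) +%R.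
Proof. by move=> a b c; exact: cmulDl. Qed.
Let mulDr : right_distributive (@cmul R A) +%R.
Proof. by move=> a b c; exact: cmulDr. Qed.
(** The instance is keyed on the sort of an abstract unital C*-algebra; it gives
    access to the theory of rings, while concrete algebras keep [cmul]. *)
#[non_forgetful_inheritance]
HB.instance Definition _ := GRing.Zmodule_isPzRing.Build
  (UnitalCStarAlgebra.sort A) (@cmulA R A) mul1 mulx1 mulDl mulDr.
End Ring.

Section Basics.
Variables (R : realType) (A : unitalCStarAlgType R).
Implicit Types (a b x y : A) (k : R[i]) (t : R).

Lemma cmulE a b : a ** b = a * b. Proof. by []. Qed.
Lemma mulZl k a b : (k *: a) * b = k *: (a * b). Proof. exact: cmulZl. Qed.
Lemma mulZr k a b : a * (k *: b) = k *: (a * b). Proof. exact: cmulZr. Qed.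
Lemma starD a b : (a + b)^# = a^# + b^#. Proof. exact: cstarD. Qed.
Lemma starM a b : (a * b)^# = b^# * a^#. Proof. exact: cstarM. Qed.
Lemma starK a : a^#^# = a. Proof. exact: cstarK. Qed.
Lemma starZ k a : (k *: a)^# = k^* *: a^#. Proof. exact: cstarZ. Qed.
Lemma star0 : 0^# = 0 :> A.
Proof. by have := starZ 0 0; rewrite rmorph0 !scale0r. Qed.
Lemma starN a : (- a)^# = - a^#.
Proof. by rewrite -scaleN1r starZ rmorphN rmorph1 scaleN1r. Qed.
Lemma starB a b : (a - b)^# = a^# - b^#. Proof. by rewrite starD starN. Qed.
Lemma conj_real t : Num.conj t%:C = t%:C. Proof. exact: conjc_real. Qed.
Lemma starZR t a : (t%:C *: a)^# = t%:C *: a^#.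
Proof. by rewrite starZ conj_real. Qed.
Lemma star1 : (1 : A)^# = 1.
Proof. by rewrite -[LHS]mul1r -{1}(starK 1) -starM mul1r starK. Qed.
Lemma starX a n : (a ^+ n)^# = a^# ^+ n.
Proof. by elim: n => [|n ih]; rewrite ?star1 // exprS starM ih -exprSr. Qed.

Definition nrm a : R := complex.Re `|a|.

Lemma nrmE a : `|a| = (nrm a)%:C.
Proof. by rewrite /nrm RRe_real // normr_real. Qed.
Lemma nrm_ge0 a : 0 <= nrm a.
Proof. by rewrite -ler0c -nrmE normr_ge0. Qed.
Lemma nrmD a b : nrm (a + b) <= nrm a + nrm b.
Proof. by rewrite -lecR rmorphD /= -!nrmE ler_normD. Qed.
Lemma nrmN a : nrm (- a) = nrm a. Proof. by rewrite /nrm normrN. Qed.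
Lemma nrmB a b : nrm (a - b) <= nrm a + nrm b.
Proof. by rewrite -(nrmN b) nrmD. Qed.
Lemma nrm0 : nrm 0 = 0. Proof. by rewrite /nrm normr0. Qed.
Lemma nrm_eq0 a : nrm a = 0 -> a = 0.
Proof. by move=> h; apply/normr0_eq0; rewrite nrmE h. Qed.
Lemma nrmZ k a : nrm (k *: a) = complex.Re `|k| * nrm a.
Proof.
by apply: complexI; rewrite rmorphM /= -!nrmE normrZ; congr (_ * _).
Qed.
Lemma nrmZR t a : nrm (t%:C *: a) = `|t| * nrm a.
Proof. by rewrite nrmZ normc_def /= expr0n addr0 sqrtr_sqr. Qed.
Lemma nrmM a b : nrm (a * b) <= nrm a * nrm b.
Proof. by rewrite -lecR rmorphM /= -!nrmE; exact: cnorm_mul. Qed.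
Lemma nrm_starM a : nrm (a^# * a) = nrm a ^+ 2.
Proof. by apply: complexI; rewrite rmorphXn /= -!nrmE; exact: cnorm_star_mul. Qed.
Lemma nrm_star a : nrm a^# = nrm a.
Proof.
have le b : nrm b <= nrm b^#.
  have [b0|b0] := eqVneq (nrm b) 0; first by rewrite b0 nrm_ge0.
  have {}b0 : 0 < nrm b by rewrite lt_def b0 nrm_ge0.
  by rewrite -(ler_pM2r b0) -expr2 -nrm_starM nrmM.
by apply/eqP; rewrite eq_le le -{2}(starK a) le.
Qed.
Lemma nrm1_le : nrm (1 : A) <= 1.
Proof.
have := nrm_starM 1; rewrite star1 mulr1 => h.
have := nrm_ge0 (1 : A); nra.
Qed.
Lemma nrm_sa_pow2 a n : a^# = a -> nrm (a ^+ (2 ^ n)) = nrm a ^+ (2 ^ n).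
Proof.
move=> sa; elim: n => [|n ih]; first by rewrite !expr1.
by rewrite expnS mulnC !exprM -ih -nrm_starM starX sa -expr2 -!exprM mulnC.
Qed.
End Basics.

(** Proves an identity of noncommutative polynomials with scalar coefficients:
    once everything is expanded, the monomials are atoms of a linear identity. *)
Ltac star_algebra R A :=
  rewrite ?(expr2, mulrDl, mulrDr, mulNr, mulrN, mulZl, mulZr, mulr1, mul1r,
    mulr0, mul0r, mulrA, opprK);
  lmodule (complex R) (UnitalCStarAlgebra.sort A).

(** * Square roots near the unit *)

Section Completeness.
Variables (R : realType) (A : unitalCStarAlgType R).

Lemma nrm_complete (u : nat -> A) :
  (forall e : R, 0 < e ->
    exists N, forall n m, (N <= n)%N -> (N <= m)%N -> nrm (u n - u m) <= e) ->
  exists l, forall e : R, 0 < e ->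
    exists N, forall n, (N <= n)%N -> nrm (l - u n) <= e.
Proof.
move=> cu.
have cF : cauchy (u @ \oo).
  apply/cauchy_ballP => e e0.
  have Re0 : 0 < complex.Re e.
    by move: e0; rewrite ltcE /= => /andP[].
  have [N hN] := cu (complex.Re e / 2) (divr_gt0 Re0 (ltr0Sn R 1)).
  pose U := [set a | exists2 n, (N <= n)%N & a = u n].
  exists (U, U) => /=.
    by split; exists N => // n hn; exists n.
  move=> [_ _] [/= [n hn ->] [m hm ->]]; rewrite -ball_normE /= nrmE.
  rewrite (le_lt_trans (_ : _ <= (complex.Re e / 2)%:C)) ?lecR ?hN //.
  move: e0; rewrite !ltcE /= => /andP[/eqP -> h]; rewrite eqxx /=; lra.
have [l ul] := (cvg_ex _).1 (cauchy_cvg _ cF).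
exists l => e e0.
have e0' : 0 < e%:C by rewrite ltcR.
have /cvgrPdist_le/(_ _ e0')[N _ hN] := ul.
by exists N => n /hN /=; rewrite nrmE lecR.
Qed.
End Completeness.

Section SquareRoot.
Variables (R : realType) (A : unitalCStarAlgType R).
Implicit Types (a b c x y z : A) (r s t : R).

Lemma le_of_leDe s t : (forall e : R, 0 < e -> s <= t + e) -> s <= t.
Proof. by move=> h; apply/ler_addgt0Pr. Qed.

(* A fixed point y of [phi x] satisfies (1 - y)^2 = 1 - x; for |x| <= r < 1 the
   map [phi x] is a contraction of ratio r of the ball of radius r. *)
Let phi x y : A := (2^-1)%:C *: (x + y * y).
Let it x n := iter n (phi x) 0.

Let half_nrm a : nrm ((2^-1)%:C *: a) = 2^-1 * nrm a.
Proof. by rewrite nrmZR ger0_norm // invr_ge0. Qed.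

Let phi_le x y r : 0 <= r <= 1 -> nrm x <= r -> nrm y <= r -> nrm (phi x y) <= r.
Proof.
move=> /andP[r0 r1] hx hy; rewrite half_nrm.
have := nrmD x (y * y); have := nrmM y y.
have : nrm y * nrm y <= r * r by rewrite ler_pM ?nrm_ge0.
nra.
Qed.

Let phi_lip x y z r : nrm y <= r -> nrm z <= r ->
  nrm (phi x y - phi x z) <= r * nrm (y - z).
Proof.
move=> hy hz.
have -> : phi x y - phi x z = (2^-1)%:C *: (y * (y - z) + (y - z) * z).
  by rewrite /phi; star_algebra R A.
rewrite half_nrm; have := nrmD (y * (y - z)) ((y - z) * z).
have := nrmM y (y - z); have := nrmM (y - z) z.
have : nrm y * nrm (y - z) <= r * nrm (y - z) by rewrite ler_wpM2r ?nrm_ge0.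
have : nrm (y - z) * nrm z <= nrm (y - z) * r by rewrite ler_wpM2l ?nrm_ge0.
nra.
Qed.

Let it_le x r n : 0 <= r <= 1 -> nrm x <= r -> nrm (it x n) <= r.
Proof.
move=> r01 hx; elim: n => [|n ih]; first by rewrite nrm0; case/andP: r01.
exact: phi_le.
Qed.

Let it_dist x r n k : 0 <= r <= 1 -> nrm x <= r ->
  nrm (it x (n + k) - it x n) <= r ^+ n.
Proof.
move=> r01 hx; elim: n => [|n ih].
  by rewrite subr0 expr0 (le_trans (it_le _ r01 hx)) //; case/andP: r01.
rewrite addSn (le_trans (phi_lip _ (it_le _ r01 hx) (it_le _ r01 hx))) //.
by rewrite exprS ler_wpM2l //; case/andP: r01.
Qed.

Lemma expr_to0 (r e : R) : 0 <= r < 1 -> 0 < e -> exists N, forall n, (N <= n)%N -> r ^+ n <= e.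
Proof.
move=> /andP[r0 r1] e0.
have := @cvg_expr R r; rewrite ger0_norm // => /(_ r1) /cvgrPdist_le/(_ e e0)[N _ hN].
by exists N => n /hN /=; rewrite sub0r normrN ger0_norm // exprn_ge0.
Qed.

(* What commutes with x commutes with the iterates, hence with the limit. *)
Let fixed_point x r : 0 <= r < 1 -> nrm x <= r -> exists y,
  [/\ nrm y <= r, y = phi x y & forall z, nrm z <= r -> z = phi x z -> z = y] /\
  forall z, x * z = z * x -> y * z = z * y.
Proof.
move=> /andP[r0 r1] hx.
have r01 : 0 <= r <= 1 by rewrite r0 ltW.
have [|y hy] := @nrm_complete _ _ (it x).
  move=> e e0; have [N hN] := expr_to0 (introT andP (conj r0 r1)) e0.
  exists N => n m; wlog nm : n m / (n <= m)%N => [w hn hm|hn _].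
    case/orP: (leq_total n m) => h; first exact: w.
    by rewrite -opprB nrmN w.
  by rewrite -opprB nrmN -(subnKC nm) (le_trans (it_dist _ _ r01 hx)) ?hN.
have yle : nrm y <= r.
  apply: le_of_leDe => e e0; have [N /(_ N (leqnn _)) hN] := hy _ e0.
  have := nrmD (y - it x N) (it x N); rewrite subrK.
  have := it_le N r01 hx; lra.
have fixy : y = phi x y.
  apply/eqP; rewrite -subr_eq0; apply/eqP/nrm_eq0/eqP; rewrite eq_le nrm_ge0 andbT.
  apply: le_of_leDe => e e0; rewrite add0r.
  have [N hN] := hy _ (divr_gt0 e0 (ltr0Sn R 1)).
  have := hN N (leqnn _); have := hN N.+1 (leqnSn _).
  have := phi_lip x (it_le N r01 hx) yle; rewrite -[phi x (it x N)]/(it x N.+1) => h1 h2 h3.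
  have := nrmD (y - it x N.+1) (it x N.+1 - phi x y); rewrite addrA subrK.
  rewrite -(opprB y) nrmN in h1; have := nrm_ge0 (y - it x N).
  nra.
exists y; split; first split=> //.
  move=> z zle fixz; apply/eqP; rewrite -subr_eq0; apply/eqP/nrm_eq0.
  have := phi_lip x zle yle; rewrite -fixz -fixy.
  have := nrm_ge0 (z - y); nra.
move=> z xz; apply/eqP; rewrite -subr_eq0; apply/eqP/nrm_eq0/eqP.
rewrite eq_le nrm_ge0 andbT.
have itz n : it x n * z = z * it x n.
  elim: n => [|n ih]; first by rewrite mul0r mulr0.
  by rewrite /= /phi mulZl mulZr mulrDl mulrDr xz -mulrA ih !mulrA ih.
have z0 : 0 < 2 * nrm z + 1 by have := nrm_ge0 z; lra.
apply: le_of_leDe => e e0; rewrite add0r.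
have [N /(_ N (leqnn _)) hN] := hy _ (divr_gt0 e0 z0).
have -> : y * z - z * y = (y - it x N) * z - z * (y - it x N).
  by rewrite mulrBl mulrBr itz opprB addrA subrK.
have := nrmB ((y - it x N) * z) (z * (y - it x N)).
have := nrmM (y - it x N) z; have := nrmM z (y - it x N).
move: hN; rewrite ler_pdivlMr //; have := nrm_ge0 (y - it x N).
nra.
Qed.

(** The square root is [1 - y] where [y] is the fixed point. It is self-adjoint
    because the adjoint of [y] is a fixed point too, and the commutation with
    everything that commutes with [x] replaces a functional calculus. *)
Lemma sqrt_one_sub x : x^# = x -> nrm x < 1 -> exists c,
  [/\ c^# = c, c * c = 1 - x & forall z, x * z = z * x -> c * z = z * c].
Proof.
move=> xsa x1.
have r01 : 0 <= nrm x < 1 by rewrite nrm_ge0.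
have [y [[yle fixy yu] ycomm]] := fixed_point r01 (lexx _).
have ysa : y^# = y.
  apply: yu; first by rewrite nrm_star.
  by rewrite [in LHS]fixy /phi starZR starD starM xsa.
exists (1 - y); split.
- by rewrite starB star1 ysa.
- have h : y + y = x + y * y.
    rewrite {1 2}fixy /phi -scalerDl -rmorphD /=.
    by rewrite (_ : 2^-1 + 2^-1 = 1) ?scale1r //; lra.
  have -> : x = y + y - y * y by rewrite h addrK.
  by star_algebra R A.
- by move=> z /ycomm yz; rewrite mulrBl mulrBr yz mulr1 mul1r.
Qed.

End SquareRoot.

(** * The positive cone *)

Section Growth.
Variable R : realType.
Implicit Types x d C : R.

Lemma bernoulli x n : 0 <= x -> 1 + n%:R * x <= (1 + x) ^+ n.
Proof.
move=> x0; elim: n => [|n ih]; first by rewrite mul0r addr0 expr0.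
have h : 0 <= n%:R * x by rewrite mulr_ge0.
rewrite exprS -natr1; nra.
Qed.

(** With [x = 1 + d], Bernoulli's inequality for the exponent [2 ^ j], squared,
    makes [x ^+ (2 ^ j.+1)] quadratic in [2 ^ j]. Only exponents that are powers
    of 2 occur, as for those the norm of a power of a self-adjoint element is
    the power of its norm. *)
Lemma le1_of_linear_growth x C : 0 <= x ->
  (forall j, x ^+ (2 ^ j) <= 1 + C * (2 ^ j)%:R) -> x <= 1.
Proof.
move=> x0 hx; rewrite leNgt; apply/negP => x1.
pose d := x - 1; have d0 : 0 < d by rewrite subr_gt0.
have xE : x = 1 + d by rewrite /d; ring.
have key j : (2 ^ j)%:R * d ^+ 2 <= 2 * C.
  have := hx j.+1; rewrite expnS mulnC exprM natrM.
  have := bernoulli (2 ^ j) (ltW d0); rewrite -xE.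
  have M0 : 0 < (2 ^ j)%:R :> R by rewrite ltr0n expn_gt0.
  move: ((2 ^ j)%:R : R) M0 (x ^+ _) => M M0 X h1 h2.
  have h3 : (1 + M * d) ^+ 2 <= X ^+ 2.
    by rewrite lerXn2r // nnegrE; nra.
  rewrite -(ler_pM2l M0); nra.
have dd0 : 0 < d ^+ 2 by rewrite exprn_gt0.
have [n hn] : exists n : nat, 2 * C / d ^+ 2 < n%:R.
  exists (Num.trunc (2 * C / d ^+ 2)).+1; apply: truncnS_gt.
have := key n; rewrite leNgt => /negP; apply.
rewrite -ltr_pdivrMr // (lt_trans hn) // ltr_nat.
exact: ltn_expl.
Qed.
End Growth.

Section Positive.
Variables (R : realType) (A : unitalCStarAlgType R).
Implicit Types (a b c h k x y z : A) (d e r s t : R).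

Local Notation "t %:U" := (t%:C *: (1 : A)) (at level 1, format "t %:U").

(** In terms of the spectrum: it is contained in the interval from 0 to [2 s]
    as soon as [nrm h < 2 * s]. Asking for all [s] beyond half the norm, and not
    only beyond the norm, makes the cone obviously proper. *)
Definition cpos h := h^# = h /\
  forall s, nrm h < 2 * s -> nrm (s%:U - h) <= s.

Let nrm_scalar t : 0 <= t -> nrm (t%:U) <= t.
Proof.
by move=> t0; rewrite nrmZR ger0_norm // -[leRHS]mulr1 ler_wpM2l // nrm1_le.
Qed.

Let scalerK t h : t != 0 -> t%:C *: (t^-1%:C *: h) = h.
Proof. by move=> t0; rewrite scalerA -rmorphM divff // scale1r. Qed.

(** If [j] is self-adjoint with [j^2 <= 1] then [u = j + i sqrt (1 - j^2)] is
    unitary, and the real part [2 j^2 - 1] of its square has norm at most 1. The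
    statement is the case [j = k / sqrt (2 s)]. *)
Lemma nrm_scalar_sub_sqr k s : k^# = k -> nrm (k * k) < 2 * s ->
  nrm (s%:U - k * k) <= s.
Proof.
move=> ksa ks.
have s0 : 0 < 2 * s by apply: le_lt_trans ks; exact: nrm_ge0.
pose t := Num.sqrt (2 * s).
have t0 : 0 < t by rewrite sqrtr_gt0.
have tE : t * t = 2 * s by rewrite -expr2 sqr_sqrtr // ltW.
pose j := t^-1%:C *: k.
have jsa : j^# = j by rewrite /j starZR ksa.
have jj : k * k = (2 * s)%:C *: (j * j).
  rewrite /j mulZl mulZr !scalerA -!rmorphM -tE.
  by rewrite (_ : t * t * _ * _ = 1) ?scale1r //; field; rewrite gt_eqF.
clearbody j.
have [||c [csa cc cj]] := @sqrt_one_sub R A (j * j).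
- by rewrite starM jsa.
- by move: ks; rewrite jj nrmZR ger0_norm ?ltW // -[X in _ < X]mulr1 ltr_pM2l.
have {}cj : c * j = j * c by apply: cj; rewrite mulrA.
pose u := j + 'i *: c.
have usa : u^# = j - 'i *: c by rewrite /u starD starZ csa jsa conj_i scaleNr.
have u1 : nrm u <= 1.
  rewrite -(@ler_pXn2r _ 2) ?nnegrE ?nrm_ge0 ?ler01 // -nrm_starM usa.
  have -> : (j - 'i *: c) * u = 1.
    have -> : 1 = j * j + c * c by rewrite cc addrC subrK.
    rewrite /u !(mulrDl, mulrDr, mulrN, mulNr, mulZl, mulZr) cj ?scalerN !scalerA mul_ii.
    by lmodule (complex R) (UnitalCStarAlgebra.sort A).
  by rewrite expr1n nrm1_le.
have : nrm (u * u + (u * u)^#) <= 2.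
  rewrite (le_trans (nrmD _ _)) // nrm_star.
  have := nrmM u u; have := nrm_ge0 u; nra.
have -> : u * u + (u * u)^# = 2%:C *: (j * j + j * j - 1).
  have -> : 1 = j * j + c * c by rewrite cc addrC subrK.
  rewrite starM usa /u !(mulrDl, mulrDr, mulrN, mulNr, mulZl, mulZr) cj.
  rewrite ?scalerN !scalerA mul_ii.
  by lmodule (complex R) (UnitalCStarAlgebra.sort A).
rewrite nrmZR ger0_norm // => h.
have -> : s%:U - k * k = - (s%:C *: (j * j + j * j - 1)).
  by rewrite jj rmorphM /=; star_algebra R A.
rewrite nrmN nrmZR; have s0' : 0 <= s by lra.
rewrite ger0_norm //; nra.
Qed.

Lemma cpos_sqr k : k^# = k -> cpos (k * k).
Proof.
by move=> ksa; split=> [|s]; [rewrite starM ksa | exact: nrm_scalar_sub_sqr].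
Qed.

(** The hypothesis says that [h] is positive and invertible. *)
Lemma sqrt_near_scalar h t : h^# = h -> nrm (t%:U - h) < t -> exists c,
  [/\ c^# = c, c * c = h & forall z, h * z = z * h -> c * z = z * c].
Proof.
move=> hsa ht.
have t0 : 0 < t by apply: le_lt_trans ht; exact: nrm_ge0.
pose x := t^-1%:C *: (t%:U - h).
have hE : h = t%:C *: (1 - x).
  by rewrite scalerBr /x scalerK ?gt_eqF // opprB addrC subrK.
have [||c [csa cc cz]] := @sqrt_one_sub R A x.
- by rewrite /x starZR starB starZR star1 hsa.
- by rewrite /x nrmZR gtr0_norm ?invr_gt0 // mulrC ltr_pdivrMr // mul1r.
have r0 : 0 <= t by exact: ltW.
exists ((Num.sqrt t)%:C *: c); split.
- by rewrite starZR csa.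
- by rewrite mulZl mulZr scalerA -rmorphM -expr2 sqr_sqrtr // cc -hE.
- move=> z hz; rewrite mulZl mulZr cz //.
  by rewrite /x mulZl mulZr mulrBl mulrBr hz mulZl mulZr mul1r mulr1.
Qed.

(** For [d > 0] the element [h + d] is a square, to which [nrm_scalar_sub_sqr]
    applies; then [d] tends to 0. *)
Lemma cpos_intro h t : h^# = h -> 0 <= t -> nrm (t%:U - h) <= t -> cpos h.
Proof.
move=> hsa t0 ht; split=> // s hs; apply: le_of_leDe => e e0.
pose d := Num.min e (s - nrm h / 2).
have d0 : 0 < d by rewrite lt_min e0 /=; lra.
have de : d <= e by rewrite ge_min lexx.
have ds : d <= s - nrm h / 2 by rewrite ge_min lexx orbT.
have [||c [csa cc _]] := @sqrt_near_scalar (h + d%:U) (t + d).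
- by rewrite starD starZR star1 hsa.
- rewrite (_ : _ - _ = t%:U - h).
    by rewrite (le_lt_trans ht) // ltrDl.
  by rewrite rmorphD /=; star_algebra R A.
have := nrm_scalar ( ltW d0).
have := nrmD h (d%:U).
have := nrm_scalar_sub_sqr (s := s) csa; rewrite cc => h1 h2 h3.
have {}h1 := h1 ltac:(lra).
have -> : s%:U - h = (s%:U - (h + d%:U)) + d%:U.
  by star_algebra R A.
have := nrmD (s%:U - (h + d%:U)) (d%:U); lra.
Qed.

Lemma cpos0 : cpos 0.
Proof. by rewrite -[0](mulr0 0); apply: cpos_sqr; exact: star0. Qed.

Lemma cposD h k : cpos h -> cpos k -> cpos (h + k).
Proof.
move=> [hsa hP] [ksa kP].
have h1 := hP (nrm h + 1) ltac:(have := nrm_ge0 h; lra).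
have k1 := kP (nrm k + 1) ltac:(have := nrm_ge0 k; lra).
apply: (@cpos_intro _ ((nrm h + 1) + (nrm k + 1))).
- by rewrite starD hsa ksa.
- by have := nrm_ge0 h; have := nrm_ge0 k; lra.
rewrite (_ : _ - _ = ((nrm h + 1)%:U - h) + ((nrm k + 1)%:U - k)).
  by rewrite (le_trans (nrmD _ _)) // lerD.
by rewrite [in LHS]rmorphD /=; star_algebra R A.
Qed.

Lemma cposZ t h : 0 <= t -> cpos h -> cpos (t%:C *: h).
Proof.
move=> t0 [hsa hP].
have h1 := hP (nrm h + 1) ltac:(have := nrm_ge0 h; lra).
apply: (@cpos_intro _ (t * (nrm h + 1))).
- by rewrite starZR hsa.
- by rewrite mulr_ge0 // addr_ge0 // nrm_ge0.
by rewrite rmorphM -scalerA -scalerBr nrmZR ger0_norm // ler_wpM2l.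
Qed.

Lemma cpos_closed h :
  (forall e, 0 < e -> exists2 k, cpos k & nrm (h - k) <= e) -> cpos h.
Proof.
move=> hP.
have hsa : h^# = h.
  apply/eqP; rewrite -subr_eq0; apply/eqP/nrm_eq0/eqP.
  rewrite eq_le nrm_ge0 andbT; apply: le_of_leDe => e e0; rewrite add0r.
  have [k [ksa _] hk] := hP (e / 2) ltac:(lra).
  have -> : h^# - h = (h - k)^# - (h - k) by rewrite starB ksa opprB addrA subrK.
  have := nrmB (h - k)^# (h - k); rewrite nrm_star; lra.
apply: (@cpos_intro _ (nrm h)) => //; first exact: nrm_ge0.
apply: le_of_leDe => e e0.
have [k [ksa kP] hk] := hP (e / 3) ltac:(lra).
have nk : nrm k <= nrm h + e / 3.
  have := nrmB h (h - k); rewrite opprB addrC subrK; lra.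
have := kP (nrm h + e / 3) ltac:(have := nrm_ge0 h; lra) => h1.
have -> : (nrm h)%:U - h = ((nrm h + e / 3)%:U - k) - (h - k) -
    (e / 3)%:U by rewrite rmorphD /=; star_algebra R A.
have := nrmB ((nrm h + e / 3)%:U - k - (h - k)) ((e / 3)%:U).
have := nrmB ((nrm h + e / 3)%:U - k) (h - k).
have := @nrm_scalar (e / 3) ltac:(lra); lra.
Qed.

Lemma cpos_archimedean h g : (forall e, 0 < e -> cpos (h + e%:C *: g)) -> cpos h.
Proof.
move=> hP; apply: cpos_closed => e e0.
have g0 : 0 < nrm g + 1 by have := nrm_ge0 g; lra.
exists (h + (e / (nrm g + 1))%:C *: g); first by apply: hP; rewrite divr_gt0.
rewrite opprD addrA subrr sub0r nrmN nrmZR ger0_norm; last by rewrite ltW ?divr_gt0.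
by rewrite mulrAC ler_pdivrMr // ler_wpM2l ?ltW //; lra.
Qed.

Lemma cpos_scalar_sub h t : h^# = h -> nrm h <= t -> cpos (t%:U - h).
Proof.
move=> hsa ht; apply: (@cpos_intro _ t).
- by rewrite starB starZR star1 hsa.
- exact: le_trans (nrm_ge0 h) ht.
- by rewrite opprB addrC subrK.
Qed.

(** With [s] half of [t + nrm h], both [t - h] and [t + h] are within [s] of
    [s]; subtracting, [2 nrm h <= 2 s]. *)
Lemma nrm_le_of_cpos h t : 0 <= t ->
  cpos (t%:U - h) -> cpos (t%:U + h) -> nrm h <= t.
Proof.
move=> t0 [_ h1] [_ h2].
have := nrm_scalar t0; have := nrmB (t%:U) h; have := nrmD (t%:U) h.
move=> n1 n2 n3; apply: le_of_leDe => e e0.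
pose s := (t + nrm h + e) / 2.
have := h1 s ltac:(rewrite /s; lra); have := h2 s ltac:(rewrite /s; lra) => m1 m2.
have : nrm (2%:C *: h) <= s + s.
  have -> : 2%:C *: h = (s%:U - (t%:U - h)) - (s%:U - (t%:U + h)).
    rewrite (_ : 2%:C = 1 + 1 :> R[i]); last by rewrite -rmorphD.
    by star_algebra R A.
  by rewrite (le_trans (nrmB _ _)) // lerD.
rewrite nrmZR ger0_norm // /s; lra.
Qed.

Lemma cpos_anti h : cpos h -> cpos (- h) -> h = 0.
Proof.
move=> h1 h2; apply: nrm_eq0; apply/eqP; rewrite eq_le nrm_ge0 andbT.
by apply: nrm_le_of_cpos; rewrite ?scale0r ?add0r.
Qed.

(** This stands for the equality of the spectra of [y^* y] and [y y^*] outside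
    0. The power [(d - y^* y)^n] is [d^n - y^* g y] with [g] of norm at most
    [n t^(n - 1)], because [g] is a polynomial in [y y^*] only; so its norm is
    at most [t^n] times an affine function of [n], and the norm of [d - y^* y]
    itself is at most [t]. *)
Lemma nrm_scalar_sub_comm y d t : 0 < t -> `|d| <= t ->
  nrm (d%:U - y * y^#) <= t -> nrm (d%:U - y^# * y) <= t.
Proof.
move=> t0 dt hy; set b := _ - y^# * y.
have bsa : b^# = b by rewrite /b starB starM starK starZR star1.
have [g gP] : exists g : nat -> A, forall n,
    b ^+ n = (d ^+ n)%:U - y^# * g n * y /\ t * nrm (g n) <= n%:R * t ^+ n.
  pose g := fix g n := if n is n'.+1 then
    (d ^+ n')%:U + (d%:U - y * y^#) * g n' else 0 : A.
  exists g; elim=> [|n [ih1 ih2]].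
    by rewrite !expr0 mulr0 mul0r subr0 scale1r nrm0 mulr0 mul0r.
  split.
    rewrite exprS ih1 /= exprS rmorphM /= /b.
    star_algebra R A.
  rewrite /= -natr1.
  have := nrmD ((d ^+ n)%:U) ((d%:U - y * y^#) * g n).
  have := nrmM (d%:U - y * y^#) (g n).
  have : nrm ((d ^+ n)%:U) <= t ^+ n.
    rewrite nrmZR normrX -[leRHS]mulr1 ler_pM ?exprn_ge0 ?nrm_ge0 ?nrm1_le //.
    by rewrite lerXn2r ?nnegrE // ltW.
  have : nrm (d%:U - y * y^#) * nrm (g n) <= t * nrm (g n).
    by rewrite ler_wpM2r ?nrm_ge0.
  rewrite exprS => h1 h2 h3 h4.
  have : t * nrm ((d ^+ n)%:U + (d%:U - y * y^#) * g n) <=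
    t * (t ^+ n + t * nrm (g n)) by rewrite ler_pM2l //; lra.
  nra.
rewrite -[leRHS]mulr1 -ler_pdivrMl // mulrC.
apply: (@le1_of_linear_growth _ _ (nrm y ^+ 2 / t)).
  by rewrite divr_ge0 ?nrm_ge0 // ltW.
move=> j; rewrite exprMn exprVn -nrm_sa_pow2 // ler_pdivrMr ?exprn_gt0 //.
set n := (2 ^ j)%N; have [-> h1] := gP n.
have := nrmB ((d ^+ n)%:U) (y^# * g n * y).
have : nrm ((d ^+ n)%:U) <= t ^+ n.
  rewrite nrmZR normrX -[leRHS]mulr1 ler_pM ?exprn_ge0 ?nrm_ge0 ?nrm1_le //.
  by rewrite lerXn2r ?nnegrE // ltW.
have : nrm (y^# * g n * y) <= nrm y ^+ 2 * nrm (g n).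
  rewrite (le_trans (nrmM _ _)) // expr2 mulrAC ler_wpM2r ?nrm_ge0 //.
  by rewrite (le_trans (nrmM _ _)) // nrm_star.
have : nrm y ^+ 2 * nrm (g n) <= nrm y ^+ 2 / t * n%:R * t ^+ n.
  have h2 : nrm (g n) <= t^-1 * (n%:R * t ^+ n) by rewrite ler_pdivlMl.
  by have := ler_wpM2l (exprn_ge0 2 (nrm_ge0 y)) h2; rewrite !mulrA.
rewrite mulrDl mul1r; lra.
Qed.

(** [y y^* + y^* y] is twice the sum of the squares of the real and imaginary
    parts of [y]. So an upper bound on [y^* y] is a lower bound on [y y^*],
    which is one on [y^* y] by [nrm_scalar_sub_comm]. *)
Lemma nrm_starM_le_of_cpos y t : 0 < t -> cpos (t%:U - y^# * y) ->
  nrm (y^# * y) <= t.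
Proof.
move=> t0 hy.
have cartesian : cpos (y * y^# + y^# * y).
  pose a := y + y^#; pose b := 'i *: (y - y^#).
  have asa : a^# = a by rewrite starD starK addrC.
  have bsa : b^# = b by rewrite starZ starB starK conj_i scaleNr -scalerN opprB.
  rewrite -(@scalerK 2^-1 (_ + _)) ?invr_eq0 ?pnatr_eq0 // invrK.
  apply: cposZ; first by rewrite invr_ge0.
  rewrite (_ : 2%:C *: _ = a * a + b * b); first by apply: cposD; exact: cpos_sqr.
  rewrite /a /b mulZl mulZr scalerA mul_ii.
  rewrite (_ : 2%:C = 1 + 1 :> R[i]); last by rewrite -rmorphD.
  by star_algebra R A.
have [_ hp] : cpos (t%:U + y * y^#).
  rewrite (_ : _ + _ = (t%:U - y^# * y) + (y * y^# + y^# * y)); first exact: cposD.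
  by star_algebra R A.
apply: nrm_le_of_cpos => //; first exact: ltW.
pose s := nrm (t%:U + y * y^#) + t.
have s0 := nrm_ge0 (t%:U + y * y^#).
have {}hp := hp s ltac:(rewrite /s; lra).
apply: (@cpos_intro _ s).
- by rewrite starD starM starK starZR star1.
- by rewrite /s; lra.
rewrite opprD addrA -scalerBl -rmorphB; apply: nrm_scalar_sub_comm.
- by rewrite /s; lra.
- by rewrite ger0_norm /s; lra.
- by rewrite rmorphB scalerBl /= -addrA -opprD.
Qed.

(* Put h = x^* x and w = 1 - h; the aim is |w| <= 1. The elements h w^(2 i)
   decrease with i, since the difference of two consecutive ones is the square
   of c w^i h with c^2 = 2 - h; so h w^(2 i) <= h <= 1. As it is y^* y for
   y = x w^i, it has norm at most 1, and the norms of the w^(2 i) grow at most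
   linearly. *)
Let cpos_starM_le1 x : nrm x <= 1 -> cpos (x^# * x).
Proof.
move=> x1; have [h hE] : exists h, h = x^# * x by eexists.
have [w wE] : exists w, w = 1 - h by eexists.
have hsa : h^# = h by rewrite hE starM starK.
have h1 : nrm h <= 1 by rewrite hE nrm_starM; have := nrm_ge0 x; nra.
have wsa : w^# = w by rewrite wE starB star1 hsa.
have hw : h * w = w * h by rewrite wE mulrBl mulrBr mul1r mulr1.
have [||c [csa cc cz]] := @sqrt_near_scalar (2%:U - h) 2.
- by rewrite starB starZR star1 hsa.
- by rewrite opprB addrC subrK (le_lt_trans h1) // ltr1n.
have two : 2%:C = 1 + 1 :> R[i] by rewrite -rmorphD.
have ch : c * h = h * c by apply: cz; star_algebra R A.
have hwk (k : nat) : GRing.comm h (w ^+ k) by apply: commrX.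
have cw : GRing.comm c w by rewrite /GRing.comm wE mulrBl mulrBr ch mul1r mulr1.
have cwk (k : nat) : GRing.comm c (w ^+ k) by apply: commrX.
have decr (k : nat) : cpos (h - h * w ^+ (k + k)).
  elim: k => [|k ih]; first by rewrite expr0 mulr1 subrr; exact: cpos0.
  have sq : cpos ((c * w ^+ k * h) * (c * w ^+ k * h)).
    apply: cpos_sqr; rewrite !starM starX hsa wsa csa.
    by rewrite -cwk mulrA -ch -!mulrA hwk.
  have -> : h - h * w ^+ (k.+1 + k.+1) = (h - h * w ^+ (k + k)) +
     (c * w ^+ k * h) * (c * w ^+ k * h).
    have -> : (c * w ^+ k * h) * (c * w ^+ k * h) =
        c * c * h * (h * w ^+ (k + k)).
      have e1 z : w ^+ k * (c * z) = c * (w ^+ k * z) by rewrite mulrA -cwk mulrA.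
      have e2 z : w ^+ k * (h * z) = h * (w ^+ k * z) by rewrite mulrA -hwk mulrA.
      have e3 z : h * (c * z) = c * (h * z) by rewrite mulrA -ch mulrA.
      by rewrite exprD -!mulrA -(hwk k) !(e1, e2, e3).
    rewrite cc addSn addnS !exprS two.
    move: (w ^+ (k + k)) => W; rewrite wE.
    by star_algebra R A.
  exact: cposD.
have bnd (k : nat) : nrm (h * w ^+ (k + k)) <= 1.
  have yE : (x * w ^+ k)^# * (x * w ^+ k) = h * w ^+ (k + k).
    by rewrite starM starX wsa exprD -mulrA (mulrA _ x) -hE mulrA -hwk mulrA.
  rewrite -yE; apply: nrm_starM_le_of_cpos; rewrite ?ltr01 // yE.
  rewrite (_ : _ - _ = (1%:U - h) + (h - h * w ^+ (k + k))).
    by apply: cposD => //; exact: cpos_scalar_sub.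
  by rewrite addrA subrK.
have w2 : nrm (1 + w) <= 3.
  have := nrmD 1 w; have := nrmB 1 h; have := nrm1_le A; rewrite -wE; lra.
have grow (k : nat) : nrm (w ^+ (k + k)) <= 1 + 3 * k%:R.
  elim: k => [|k ih]; first by rewrite mulr0 addr0 expr0 nrm1_le.
  have -> : w ^+ (k.+1 + k.+1) = w ^+ (k + k) - h * w ^+ (k + k) * (1 + w).
    rewrite addSn addnS !exprS; have := hwk (k + k)%N.
    move: (w ^+ (k + k)) => W hW; rewrite wE mulrDr mulrBr mulr1 -[h * W * h]mulrA -hW.
    by star_algebra R A.
  have := nrmB (w ^+ (k + k)) (h * w ^+ (k + k) * (1 + w)).
  have := nrmM (h * w ^+ (k + k)) (1 + w).
  have : nrm (h * w ^+ (k + k)) * nrm (1 + w) <= 1 * 3.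
    by rewrite ler_pM ?nrm_ge0.
  by rewrite -natr1; lra.
apply: (@cpos_intro _ 1) => //; first by rewrite -hE.
rewrite scale1r -hE -wE.
suff : nrm w ^+ 2 <= 1 by have := nrm_ge0 w; nra.
apply: (@le1_of_linear_growth _ _ 3); first by rewrite exprn_ge0 ?nrm_ge0.
move=> j; rewrite -exprM mulnC -expnSr -nrm_sa_pow2 // expnS mul2n -addnn.
exact: grow.
Qed.

(** Fukamiya's theorem: scale to the unit ball. *)
Theorem cpos_starM x : cpos (x^# * x).
Proof.
pose t := nrm x + 1; have t0 : 0 < t by have := nrm_ge0 x; rewrite /t; lra.
have -> : x^# * x = (t * t)%:C *: ((t^-1%:C *: x)^# * (t^-1%:C *: x)).
  rewrite starZR mulZl mulZr !scalerA -!rmorphM.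
  by rewrite (_ : t * t * _ * _ = 1) ?scale1r //; field; rewrite gt_eqF.
apply: cposZ; first by rewrite mulr_ge0 // ltW.
apply: cpos_starM_le1; rewrite nrmZR gtr0_norm ?invr_gt0 // mulrC.
by rewrite ler_pdivrMr // mul1r /t lerDl.
Qed.

(** With a strict inequality a square root exists, so that no approximation is
    needed here. *)
Lemma cpos_nrm_sub_starM a t : nrm a < t ->
  exists c, (t ^+ 2)%:U - a^# * a = c^# * c.
Proof.
move=> at0.
have a0 := nrm_ge0 a.
have [||c [csa cc _]] := @sqrt_near_scalar ((t ^+ 2)%:U - a^# * a) (t ^+ 2).
- by rewrite starB starZR star1 starM starK.
- by rewrite opprB addrC subrK nrm_starM; nra.
by exists c; rewrite csa cc.
Qed.
End Positive.

(** * Norms defined by the least bound *)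

Section Gauge.
Variables (R : realType) (T : Type) (bnd : T -> R -> Prop).

(** [bnd t c] is meant as: [c] bounds [t]. By [bound_closed] the infimum of the
    bounds is a bound, so that each axiom of a norm can be checked on bounds. *)
Record bound_gauge : Prop := BoundGauge {
  bound_ge0 : forall t c, bnd t c -> 0 <= c;
  bound_ex : forall t, exists c, bnd t c;
  bound_closed : forall t c, (forall e, 0 < e -> bnd t (c + e)) -> bnd t c;
  bound_mono : forall t c d, c <= d -> bnd t c -> bnd t d
}.

Definition gauge (t : T) : R := inf [set c | bnd t c].

Hypothesis G : bound_gauge.

Let has_inf_bnd t : has_inf [set c | bnd t c].
Proof.
split; first exact: (bound_ex G t).
by exists 0 => c /= /(bound_ge0 G).
Qed.

Lemma gauge_le t c : bnd t c -> gauge t <= c.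
Proof. by move=> h; apply: ge_inf => //; case: (has_inf_bnd t). Qed.

Lemma gaugeP t : bnd t (gauge t).
Proof.
apply: (bound_closed G) => e e0.
have [c hc ce] := inf_adherent e0 (has_inf_bnd t).
by apply: (bound_mono G) hc; exact: ltW.
Qed.

Lemma gauge_ge0 t : 0 <= gauge t.
Proof. exact: (bound_ge0 G (gaugeP t)). Qed.

Lemma gauge_scale (scale : R[i] -> T -> T) :
  (forall k t c, bnd t c -> bnd (scale k t) (Num.sqrt (csq k) * c)) ->
  (forall k t, k != 0 -> scale k^-1 (scale k t) = t) ->
  forall k t, gauge (scale k t) = Num.sqrt (csq k) * gauge t.
Proof.
move=> bscale scaleK.
have le k t : gauge (scale k t) <= Num.sqrt (csq k) * gauge t.
  by apply: gauge_le; apply: bscale; exact: gaugeP.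
move=> k t; apply/eqP; rewrite eq_le le /=.
have [->|k0] := eqVneq k 0; first by rewrite csq0 sqrtr0 mul0r gauge_ge0.
have ck : 0 < csq k.
  by rewrite lt_def csq_ge0 andbT; apply: contra_neq k0; exact: csq_eq0.
have := le k^-1 (scale k t); rewrite scaleK // csqV sqrtrV ?csq_ge0 //.
by rewrite -ler_pdivlMl ?sqrtr_gt0.
Qed.

(** The C*-identity follows from the inequality [|t|^2 <= |t^* t|] alone: with
    submultiplicativity it gives [|t| <= |t^*|], hence equality. *)
Lemma gauge_cstar (mul : T -> T -> T) (star : T -> T) :
  (forall t u c d, bnd t c -> bnd u d -> bnd (mul t u) (c * d)) ->
  (forall t, star (star t) = t) ->
  (forall t c, 0 < c -> bnd (mul (star t) t) (c ^+ 2) -> bnd t c) ->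
  forall t, gauge (mul (star t) t) = gauge t ^+ 2.
Proof.
move=> bmul starK bstar.
have gmul t u : gauge (mul t u) <= gauge t * gauge u.
  by apply: gauge_le; apply: bmul; exact: gaugeP.
have ge t : gauge t ^+ 2 <= gauge (mul (star t) t).
  have g0 := gauge_ge0 (mul (star t) t).
  apply: le_of_leDe => e e0.
  pose c := Num.sqrt (gauge (mul (star t) t) + e).
  have c0 : 0 < c by rewrite sqrtr_gt0; lra.
  have cE : c ^+ 2 = gauge (mul (star t) t) + e by rewrite sqr_sqrtr //; lra.
  rewrite -cE lerXn2r ?nnegrE ?gauge_ge0 ?(ltW c0) //.
  apply: gauge_le; apply: bstar => //; rewrite cE.
  by apply: (bound_mono G) (gaugeP _); lra.
have le t : gauge t <= gauge (star t).
  have := ge t; have := gmul (star t) t; have := gauge_ge0 t.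
  by have := gauge_ge0 (star t); nra.
move=> t; apply/eqP; rewrite eq_le ge andbT (le_trans (gmul _ _)) //.
by rewrite expr2 ler_wpM2r ?gauge_ge0 // -{2}(starK t) le.
Qed.
End Gauge.

(** * Positive sesquilinear forms *)

Section Forms.
Variables (R : realType) (H : lmodType R[i]).
Implicit Types (x y z : H) (k : R[i]).

Record psd_form (F : H -> H -> R[i]) : Prop := PsdForm {
  psdDr : forall x y z, F x (y + z) = F x y + F x z;
  psdZr : forall k x y, F x (k *: y) = k * F x y;
  psdC : forall x y, F y x = Num.conj (F x y);
  psd_ge0 : forall x, 0 <= F x x
}.

Variables (F : H -> H -> R[i]) (hF : psd_form F).

Lemma psdDl x y z : F (x + y) z = F x z + F y z.
Proof. by rewrite (psdC hF) (psdDr hF) rmorphD /= -!(psdC hF). Qed.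
Lemma psdZl k x y : F (k *: x) y = Num.conj k * F x y.
Proof. by rewrite (psdC hF) (psdZr hF) rmorphM /= -(psdC hF). Qed.
Lemma psd0r x : F x 0 = 0.
Proof. by rewrite -[X in F x X](scale0r (0 : H)) (psdZr hF) mul0r. Qed.
Lemma psd0l x : F 0 x = 0.
Proof. by rewrite (psdC hF) psd0r rmorph0. Qed.
Lemma psdNr x y : F x (- y) = - F x y.
Proof. by rewrite -scaleN1r (psdZr hF) mulN1r. Qed.
Lemma psdNl x y : F (- x) y = - F x y.
Proof. by rewrite (psdC hF) psdNr rmorphN /= -(psdC hF). Qed.

Definition fsq x : R := complex.Re (F x x).
Lemma fsqE x : F x x = (fsq x)%:C.
Proof. exact/complex_ge0E/psd_ge0. Qed.
Lemma fsq_ge0 x : 0 <= fsq x.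
Proof. exact/Re_ge0/psd_ge0. Qed.
Lemma fsqZ k x : fsq (k *: x) = csq k * fsq x.
Proof. by rewrite /fsq psdZl (psdZr hF) mulrA conjM_csq Re_mulR. Qed.
Lemma fsqZR (t : R) x : fsq (t%:C *: x) = t ^+ 2 * fsq x.
Proof. by rewrite fsqZ csqR. Qed.
Lemma fsqN x : fsq (- x) = fsq x.
Proof. by rewrite /fsq psdNl psdNr opprK. Qed.
Lemma fsqD x y : fsq (x + y) = fsq x + 2 * complex.Re (F x y) + fsq y.
Proof.
rewrite /fsq psdDl !(psdDr hF) (psdC hF x y) !raddfD /=.
by case: (F x y) => a b /=; ring.
Qed.
Lemma fsqB x y : fsq (x - y) = fsq x - 2 * complex.Re (F x y) + fsq y.
Proof. by rewrite fsqD fsqN psdNr raddfN /= mulrN. Qed.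

Lemma cauchy_schwarz x y : csq (F x y) <= fsq x * fsq y.
Proof.
have hk (t : R) : 0 <= fsq y - 2 * t * csq (F x y) + t ^+ 2 * csq (F x y) * fsq x.
  have := fsq_ge0 (y - (t%:C * F x y) *: x); rewrite fsqB fsqZ csqM csqR.
  rewrite (psdZr hF) -mulrA (psdC hF x y) Re_mulR (mulrC (F x y)) conjM_csq /=.
  by rewrite !mulrA.
have x0 := fsq_ge0 x; have y0 := fsq_ge0 y; have c0 := csq_ge0 (F x y).
have [xx|xx] := eqVneq (fsq x) 0.
  rewrite xx mul0r; have := hk ((fsq y + 1) / csq (F x y)).
  rewrite xx mulr0 addr0; have [->//|cc] := eqVneq (csq (F x y)) 0.
  rewrite mulrA divfK // => h; exfalso; lra.
have {}x0 : 0 < fsq x by rewrite lt_def xx.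
have := hk (fsq x)^-1.
have -> : (fsq x)^-1 ^+ 2 * csq (F x y) * fsq x = (fsq x)^-1 * csq (F x y).
  by field.
move=> h; rewrite -ler_pdivrMl //; lra.
Qed.

Definition fnorm x : R := Num.sqrt (fsq x).
Lemma fnorm_ge0 x : 0 <= fnorm x. Proof. exact: sqrtr_ge0. Qed.
Lemma fnorm_sqr x : fnorm x ^+ 2 = fsq x.
Proof. by rewrite sqr_sqrtr // fsq_ge0. Qed.
Lemma fnormN x : fnorm (- x) = fnorm x. Proof. by rewrite /fnorm fsqN. Qed.
Lemma cauchy_schwarz_norm x y : Num.sqrt (csq (F x y)) <= fnorm x * fnorm y.
Proof.
by rewrite /fnorm -sqrtrM ?fsq_ge0 // ler_sqrt ?mulr_ge0 ?fsq_ge0 // cauchy_schwarz.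
Qed.
Lemma fnormD x y : fnorm (x + y) <= fnorm x + fnorm y.
Proof.
rewrite -(@ler_pXn2r _ 2) ?nnegrE ?addr_ge0 ?fnorm_ge0 //.
rewrite fnorm_sqr fsqD sqrrD !fnorm_sqr.
have := cauchy_schwarz_norm x y; have := Re_le_sqrt_csq (F x y); lra.
Qed.
Lemma Re_form_le x y : complex.Re (F x y) <= fnorm x * fnorm y.
Proof. exact: le_trans (Re_le_sqrt_csq _) (cauchy_schwarz_norm x y). Qed.
(** Used with [y = T x] and [z = T^* T x], to bound [T] by its square. *)
Lemma fnorm_le_of_form x y z (c : R) : 0 <= c -> F y y = F x z ->
  fnorm z <= c ^+ 2 * fnorm x -> fnorm y <= c * fnorm x.
Proof.
move=> c0 yy hz; rewrite -(@ler_pXn2r _ 2) ?nnegrE ?mulr_ge0 ?fnorm_ge0 //.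
rewrite fnorm_sqr /fsq yy (le_trans (Re_form_le x z)) //.
by rewrite exprMn mulrC [fnorm x ^+ 2]expr2 mulrA ler_wpM2r ?fnorm_ge0.
Qed.
Lemma fsq_le x (c : R) : 0 <= c -> (fsq x <= c ^+ 2) = (fnorm x <= c).
Proof. by move=> c0; rewrite -fnorm_sqr ler_pXn2r ?nnegrE ?fnorm_ge0. Qed.
End Forms.

(** * Hilbert spaces and commutants *)

HB.mixin Record Lmodule_isHilbert (R : realType) H of GRing.Lmodule R[i] H := {
  dot : H -> H -> R[i];
  dot_psd : psd_form dot;
  dot_eq0 : forall x, fsq dot x = 0 -> x = 0;
  dot_complete : forall u : nat -> H,
    (forall e : R, 0 < e -> exists N, forall n m, (N <= n)%N -> (N <= m)%N ->
      fnorm dot (u n - u m) <= e) ->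
    exists l, forall e : R, 0 < e -> exists N, forall n, (N <= n)%N ->
      fnorm dot (l - u n) <= e
}.

#[short(type="hilbertType")]
HB.structure Definition Hilbert (R : realType) :=
  {H of GRing.Lmodule R[i] H & Lmodule_isHilbert R H}.

Section LinearFunctions.
Variables (K : pzRingType) (U V : lmodType K) (f : U -> V).
Hypothesis f_linear : linear f.

Lemma linear_fun0 : f 0 = 0.
Proof. by have := f_linear (-1) 0 0; rewrite scaler0 addr0 scaleN1r addNr. Qed.
Lemma linear_funD x y : f (x + y) = f x + f y.
Proof. by have := f_linear 1 x y; rewrite !scale1r. Qed.
Lemma linear_funZ k x : f (k *: x) = k *: f x.
Proof. by have := f_linear k x 0; rewrite linear_fun0 !addr0. Qed.
End LinearFunctions.

Section Operators.
Variables (R : realType) (H : hilbertType R).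
Implicit Types (x y z : H) (S T V : H -> H) (c d e : R).

Let hdot : psd_form (dot : H -> H -> R[i]) := dot_psd.

Lemma dot_ext x y : (forall z, dot z x = dot z y) -> x = y.
Proof.
move=> h; apply/eqP; rewrite -subr_eq0; apply/eqP/dot_eq0.
by rewrite /fsq (psdDr hdot) (psdNr hdot) h subrr.
Qed.

Definition adjoint S T := forall x y, dot (S x) y = dot x (T y).

Lemma adjointC S T : adjoint S T -> adjoint T S.
Proof. by move=> h x y; rewrite (psdC hdot) -h -(psdC hdot). Qed.

Lemma adjoint_unique S T T' : adjoint S T -> adjoint S T' -> T = T'.
Proof. by move=> h h'; apply/funext => y; apply: dot_ext => x; rewrite -h -h'. Qed.

Lemma adjoint_linear S T : adjoint S T -> linear S.
Proof.
move=> /adjointC h k x y; apply: dot_ext => z.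
by rewrite -h !(psdDr hdot) !(psdZr hdot) -!h.
Qed.

Definition op_bound T c := 0 <= c /\ forall x, fnorm dot (T x) <= c * fnorm dot x.

Lemma op_bound_closed T c : (forall e, 0 < e -> op_bound T (c + e)) -> op_bound T c.
Proof.
move=> hc; split; first by apply: le_of_leDe => e /hc[].
move=> x; apply: le_of_leDe => e e0.
have x0 : 0 < fnorm dot x + 1 by have := fnorm_ge0 dot x; lra.
have [_ /(_ x)] := hc (e / (fnorm dot x + 1)) (divr_gt0 e0 x0).
rewrite mulrDl => /le_trans; apply; rewrite lerD2l mulrAC ler_pdivrMr //.
by rewrite ler_wpM2l ?ltW //; lra.
Qed.

Lemma op_bound_mono T c d : c <= d -> op_bound T c -> op_bound T d.
Proof.
move=> cd [c0 hc]; split=> [|x]; first exact: le_trans cd.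
by rewrite (le_trans (hc x)) // ler_wpM2r ?fnorm_ge0.
Qed.

(** [|T y|^2 = <S (T y), y> <= c |T y| |y|] *)
Lemma adjoint_bound S T c : adjoint S T -> op_bound S c -> op_bound T c.
Proof.
move=> adj [c0 hc]; split=> // y.
have [h|h] := eqVneq (fnorm dot (T y)) 0; first by rewrite h mulr_ge0 ?fnorm_ge0.
have {}h : 0 < fnorm dot (T y) by rewrite lt_def h fnorm_ge0.
rewrite -(ler_pM2l h) -expr2 (fnorm_sqr hdot) /fsq -adj.
rewrite mulrCA mulrA (le_trans (Re_form_le hdot _ _)) //.
by rewrite ler_wpM2r ?fnorm_ge0.
Qed.

(** A set of operators closed under adjunction, so that its commutant is stable
    under adjunction. Its members need not be linear a priori: having an adjoint
    makes them so. *)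
Record star_set := StarSet {
  starset : set (H -> H);
  starset_adj : forall V, starset V -> exists2 V', starset V' & adjoint V V'
}.

(** The algebra of all bounded operators is the commutant of the empty set, so
    that one construction serves for it and for the algebras it contains. *)
Definition star_operator (SS : star_set) T :=
  [/\ exists S, adjoint T S, exists c, op_bound T c &
      forall V, starset SS V -> forall x, V (T x) = T (V x)].

Definition in_commutant (SS : star_set) : {pred H -> H} :=
  [pred T | `[< star_operator SS T >] ].

Record commutant (SS : star_set) := Commutant {
  opfun :> H -> H;
  opfunP : opfun \in in_commutant SS
}.

End Operators.

Arguments Commutant {R H SS}.

Section CommutantLmod.
Variables (R : realType) (H : hilbertType R) (SS : star_set H).
Let hdot : psd_form (dot : H -> H -> R[i]) := dot_psd.

HB.instance Definition _ := [isSub for @opfun R H SS].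
HB.instance Definition _ := [Choice of commutant SS by <:].

Lemma in_commutant_submod : submod_closed (in_commutant SS).
Proof.
split.
  apply/asboolP; split.
  - by exists (fun _ => 0) => x y; rewrite (psd0l hdot) (psd0r hdot).
  - by exists 0; split=> // x; rewrite /fnorm /fsq (psd0l hdot) sqrtr0 mul0r.
  - by move=> V /starset_adj [V' _ /adjoint_linear Vl] x; exact: linear_fun0.
move=> k S T /asboolP[[S' hS] [c [c0 hc]] Sc] /asboolP[[T' hT] [d [d0 hd]] Tc].
apply/asboolP; split.
- exists (fun y => Num.conj k *: S' y + T' y) => x y.
  rewrite (psdDl hdot) (psdZl hdot) (psdDr hdot) (psdZr hdot).
  by rewrite -hS -hT.
- exists (Num.sqrt (csq k) * c + d); split.
    by rewrite addr_ge0 ?mulr_ge0 ?sqrtr_ge0.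
  move=> x; rewrite (le_trans (fnormD hdot _ _)) // mulrDl lerD //.
  rewrite /fnorm (fsqZ hdot) sqrtrM ?csq_ge0 // -mulrA.
  by rewrite ler_wpM2l ?sqrtr_ge0 ?hc.
- move=> V hV x; have [V' _ /adjoint_linear Vl] := starset_adj hV.
  by rewrite Vl (Sc _ hV) (Tc _ hV).
Qed.
HB.instance Definition _ := GRing.isSubmodClosed.Build R[i] (H -> H)
  (in_commutant SS) in_commutant_submod.
HB.instance Definition _ := [SubChoice_isSubLmodule of commutant SS by <:].
End CommutantLmod.

Section CommutantNorm.
Variables (R : realType) (H : hilbertType R) (SS : star_set H).
Implicit Types (x y z : H) (S T : commutant SS) (c d e : R).
Let hdot : psd_form (dot : H -> H -> R[i]) := dot_psd.

Lemma opP T : star_operator SS T. Proof. exact/asboolP/(opfunP T). Qed.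
Lemma op_linear T : linear T.
Proof. by have [[S hS] _ _] := opP T; exact: adjoint_linear hS. Qed.
Lemma opD T x y : T (x + y) = T x + T y.
Proof. exact: linear_funD (op_linear T) x y. Qed.
Lemma op_commutes T V x : starset SS V -> V (T x) = T (V x).
Proof. by move=> hV; have [_ _ ->] := opP T. Qed.
Lemma op_ext S T : (forall x, S x = T x) -> S = T.
Proof. by move=> h; apply: val_inj; apply/funext. Qed.
Lemma opDE S T x : (S + T) x = S x + T x. Proof. by []. Qed.
Lemma opZE k T x : (k *: T) x = k *: T x. Proof. by []. Qed.
Lemma opNE T x : (- T) x = - T x. Proof. by []. Qed.
Lemma op0E x : (0 : commutant SS) x = 0. Proof. by []. Qed.

Let id_in : (fun x : H => x) \in in_commutant SS.
Proof.
apply/asboolP; split=> //; first by exists (fun x => x).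
by exists 1; split=> // x; rewrite mul1r.
Qed.
Definition op_one : commutant SS := Commutant _ id_in.

Let comp_in S T : (fun x : H => S (T x)) \in in_commutant SS.
Proof.
apply/asboolP; split.
- have [[S' hS] _ _] := opP S; have [[T' hT] _ _] := opP T.
  by exists (fun y => T' (S' y)) => x y; rewrite hS hT.
- have [_ [c [c0 hc]] _] := opP S; have [_ [d [d0 hd]] _] := opP T.
  exists (c * d); split=> [|x]; first exact: mulr_ge0.
  by rewrite (le_trans (hc _)) // -mulrA ler_wpM2l.
- by move=> V hV x; rewrite (op_commutes S) // (op_commutes T).
Qed.
Definition op_comp S T : commutant SS := Commutant _ (comp_in S T).

(* The adjoint is chosen; [adjoint_unique] makes the choice harmless. *)
Definition adj_fun T : H -> H := projT1 (cid (let: And3 h _ _ := opP T in h)).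
Let adj_funP T : adjoint T (adj_fun T).
Proof. by rewrite /adj_fun; case: cid. Qed.

Let star_in T : adj_fun T \in in_commutant SS.
Proof.
apply/asboolP; split.
- by exists T; exact/adjointC/adj_funP.
- have [_ [c hc] _] := opP T; exists c; exact: adjoint_bound (adj_funP T) hc.
- move=> V /starset_adj [V' hV' hV] x; apply: dot_ext => y.
  rewrite -(adjointC hV) -(adj_funP T) -(op_commutes T) //.
  by rewrite (adjointC hV) (adj_funP T).
Qed.
Definition op_star T : commutant SS := Commutant _ (star_in T).
Lemma op_starP T : adjoint T (op_star T). Proof. exact: adj_funP. Qed.
Lemma op_starE T (T' : commutant SS) : adjoint T T' -> op_star T = T'.
Proof. by move=> h; apply: val_inj; exact: adjoint_unique (op_starP T) h. Qed.

Definition opnorm : commutant SS -> R :=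
  gauge (fun T : commutant SS => op_bound T).

Lemma op_bound_gauge : bound_gauge (fun T : commutant SS => op_bound T).
Proof.
split.
- by move=> T c [].
- by move=> T; have [_ h _] := opP T.
- by move=> T c; exact: op_bound_closed.
- by move=> T c d; exact: op_bound_mono.
Qed.

Lemma opnormP T x : fnorm dot (T x) <= opnorm T * fnorm dot x.
Proof. by have [_ h] := gaugeP op_bound_gauge T. Qed.
Lemma opnorm_le T c : op_bound T c -> opnorm T <= c.
Proof. exact: (gauge_le op_bound_gauge). Qed.
Lemma opnorm_ge0 T : 0 <= opnorm T.
Proof. exact: (gauge_ge0 op_bound_gauge). Qed.

Lemma opnormD S T : opnorm (S + T) <= opnorm S + opnorm T.
Proof.
apply: opnorm_le; split=> [|x]; first by rewrite addr_ge0 ?opnorm_ge0.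
by rewrite mulrDl (le_trans (fnormD hdot _ _)) // lerD ?opnormP.
Qed.

Lemma opnormZ k T : opnorm (k *: T) = Num.sqrt (csq k) * opnorm T.
Proof.
apply: (gauge_scale op_bound_gauge (scale := fun k T => k *: T)) => [l S c [c0 hc]|l S l0].
  split=> [|x]; first by rewrite mulr_ge0 ?sqrtr_ge0.
  rewrite opZE /fnorm (fsqZ hdot) sqrtrM ?csq_ge0 // -mulrA.
  by rewrite ler_wpM2l ?sqrtr_ge0 // hc.
by rewrite scalerA mulVf // scale1r.
Qed.

Lemma opnorm_eq0 T : opnorm T = 0 -> T = 0.
Proof.
move=> h; apply: op_ext => x; apply: dot_eq0; rewrite -(fnorm_sqr hdot).
have := opnormP T x; rewrite h mul0r => hx.
by rewrite (_ : fnorm _ _ = 0) ?expr0n //; apply/eqP; rewrite eq_le hx fnorm_ge0.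
Qed.

Lemma opnormM S T : opnorm (op_comp S T) <= opnorm S * opnorm T.
Proof.
apply: opnorm_le; split=> [|x]; first by rewrite mulr_ge0 ?opnorm_ge0.
by rewrite (le_trans (opnormP S (T x))) // -mulrA ler_wpM2l ?opnorm_ge0 ?opnormP.
Qed.

Lemma op_starK T : op_star (op_star T) = T.
Proof. by apply: op_starE; apply: adjointC; exact: op_starP. Qed.

Lemma opnorm_starM T : opnorm (op_comp (op_star T) T) = opnorm T ^+ 2.
Proof.
apply: (gauge_cstar op_bound_gauge (mul := op_comp)) => [S U c d|| S c].
- move=> [c0 hc] [d0 hd]; split=> [|x]; first exact: mulr_ge0.
  by rewrite (le_trans (hc (U x))) // -mulrA ler_wpM2l.
- exact: op_starK.
- move=> c0 [_ hc]; split=> [|x]; first exact: ltW.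
  exact: (fnorm_le_of_form hdot (ltW c0) (op_starP S x (S x)) (hc x)).
Qed.

Lemma opnorm_star T : opnorm (op_star T) = opnorm T.
Proof.
have le S : opnorm (op_star S) <= opnorm S.
  apply: opnorm_le; apply: adjoint_bound (op_starP S) _.
  exact: (gaugeP op_bound_gauge).
by apply/eqP; rewrite eq_le le -{1}(op_starK T) le.
Qed.

Lemma op_starB S T : op_star (S - T) = op_star S - op_star T.
Proof.
apply: op_starE => x y; rewrite !opDE !opNE (psdDl hdot) (psdNl hdot).
by rewrite (psdDr hdot) (psdNr hdot) (op_starP S) (op_starP T).
Qed.

(* The pointwise limit exists by completeness of the Hilbert space, and the
   convergence is uniform on the unit ball. *)
Let op_limit (u : nat -> commutant SS) :
  (forall e, 0 < e -> exists N, forall n m, (N <= n)%N -> (N <= m)%N ->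
     opnorm (u n - u m) <= e) ->
  exists L : H -> H, forall e, 0 < e -> exists N, forall n x, (N <= n)%N ->
    fnorm dot (L x - u n x) <= e * fnorm dot x.
Proof.
move=> cu.
have /choice[L hL] : forall x, exists l, forall e, 0 < e -> exists N, forall n,
    (N <= n)%N -> fnorm dot (l - u n x) <= e.
  move=> x; apply: (@dot_complete _ H) => e e0.
  have x0 : 0 < fnorm dot x + 1 by have := fnorm_ge0 dot x; lra.
  have [N hN] := cu _ (divr_gt0 e0 x0); exists N => n m hn hm.
  have := opnormP (u n - u m) x; rewrite opDE opNE => /le_trans; apply.
  have := hN n m hn hm; rewrite ler_pdivlMr // => h.
  by rewrite (le_trans _ h) // ler_wpM2l ?opnorm_ge0 //; lra.
exists L => e e0; have [N hN] := cu e e0; exists N => n x hn.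
apply: le_of_leDe => d d0; have [M hM] := hL x d d0.
have h1 := hM (maxn M N) (leq_maxl _ _).
have h2 := hN (maxn M N) n (leq_maxr _ _) hn.
have h3 := opnormP (u (maxn M N) - u n) x; rewrite opDE opNE in h3.
have := fnormD hdot (L x - u (maxn M N) x) (u (maxn M N) x - u n x).
rewrite addrA subrK.
have : opnorm (u (maxn M N) - u n) * fnorm dot x <= e * fnorm dot x.
  by rewrite ler_wpM2r ?fnorm_ge0.
lra.
Qed.

Let cab (w : R[i]) : R := Num.sqrt (csq w).
Let cabD v w : cab (v + w) <= cab v + cab w.
Proof. by rewrite -lecR rmorphD /= -!norm_csq ler_normD. Qed.
Let cab_small (w : R[i]) K : 0 <= K -> (forall e, 0 < e -> cab w <= e * K) -> w = 0.
Proof.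
move=> K0 h; apply: normr0_eq0; rewrite norm_csq.
suff -> : Num.sqrt (csq w) = 0 by [].
apply/eqP; rewrite eq_le sqrtr_ge0 andbT; apply: le_of_leDe => e e0; rewrite add0r.
have K1 : 0 < K + 1 by lra.
have := h _ (divr_gt0 e0 K1); rewrite mulrAC => /le_trans; apply.
by rewrite ler_pdivrMr // ler_wpM2l ?ltW //; lra.
Qed.

(** The limit has an adjoint because the adjoints converge as well. It stays in
    the commutant although the elements of [SS] need not be continuous: they
    have adjoints, through which they move to the other side of inner products. *)
Lemma op_complete (u : nat -> commutant SS) :
  (forall e, 0 < e -> exists N, forall n m, (N <= n)%N -> (N <= m)%N ->
     opnorm (u n - u m) <= e) ->
  exists L : commutant SS, forall e, 0 < e -> exists N, forall n, (N <= n)%N ->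
    opnorm (L - u n) <= e.
Proof.
move=> cu; have [L hL] := op_limit cu.
have [|L' hL'] := @op_limit (fun n => op_star (u n)).
  move=> e /cu[N hN]; exists N => n m hn hm.
  by rewrite -op_starB opnorm_star hN.
have Lin : L \in in_commutant SS.
  apply/asboolP; split.
  - exists L' => x y; apply/eqP; rewrite -subr_eq0; apply/eqP.
    apply: (@cab_small _ (fnorm dot x * fnorm dot y + fnorm dot x * fnorm dot y)).
      by rewrite addr_ge0 // mulr_ge0 ?fnorm_ge0.
    move=> e e0; have [N hN] := hL e e0; have [M hM] := hL' e e0.
    have hn := hN (maxn N M) x (leq_maxl _ _); have hm := hM (maxn N M) y (leq_maxr _ _).
    set n := maxn N M in hn hm.
    have -> : dot (L x) y - dot x (L' y) =
        dot (L x - u n x) y + dot x (- (L' y - op_star (u n) y)).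
      rewrite (psdDl hdot) (psdNl hdot) (op_starP (u n)) (psdNr hdot).
      by rewrite (psdDr hdot) (psdNr hdot); ring.
    rewrite (le_trans (cabD _ _)) // mulrDr lerD //.
      rewrite (le_trans (cauchy_schwarz_norm hdot _ _)) //.
      by rewrite mulrA ler_wpM2r ?fnorm_ge0.
    rewrite (le_trans (cauchy_schwarz_norm hdot _ _)) // (fnormN hdot).
    by rewrite mulrCA ler_wpM2l ?fnorm_ge0.
  - have [N hN] := hL 1 ltr01; exists (1 + opnorm (u N)).
    split=> [|x]; first by rewrite addr_ge0 ?opnorm_ge0.
    have := fnormD hdot (L x - u N x) (u N x); rewrite subrK.
    by have := hN N x (leqnn _); have := opnormP (u N) x; lra.
  - move=> V hV x; apply: dot_ext => z.
    have [V' _ /adjointC adjV] := starset_adj hV.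
    rewrite -adjV; apply/eqP; rewrite -subr_eq0; apply/eqP.
    apply: (@cab_small _ (fnorm dot (V' z) * fnorm dot x + fnorm dot z * fnorm dot (V x))).
      by rewrite addr_ge0 // mulr_ge0 ?fnorm_ge0.
    move=> e e0; have [N hN] := hL e e0.
    have h1 := hN N x (leqnn _); have h2 := hN N (V x) (leqnn _).
    have -> : dot (V' z) (L x) - dot z (L (V x)) =
        dot (V' z) (L x - u N x) + dot z (- (L (V x) - u N (V x))).
      rewrite (psdDr hdot) (psdNr hdot) (psdNr hdot) (psdDr hdot) (psdNr hdot).
      by rewrite (adjV z (u N x)) (op_commutes (u N)) //; ring.
    rewrite (le_trans (cabD _ _)) // mulrDr lerD //.
      rewrite (le_trans (cauchy_schwarz_norm hdot _ _)) //.
      by rewrite mulrCA ler_wpM2l ?fnorm_ge0.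
    rewrite (le_trans (cauchy_schwarz_norm hdot _ _)) // (fnormN hdot).
    by rewrite mulrCA ler_wpM2l ?fnorm_ge0.
exists (Commutant L Lin) => e e0; have [N hN] := hL e e0; exists N => n hn.
by apply: opnorm_le; split=> [|x]; [exact: ltW | exact: hN].
Qed.

Lemma opnormC S T : opnorm (S - T) = opnorm (T - S).
Proof. by rewrite -opprB -scaleN1r opnormZ csqN (csqR 1) expr1n sqrtr1 mul1r. Qed.
Let opnorm_dist S T U : opnorm (S - T) <= opnorm (S - U) + opnorm (T - U).
Proof. by rewrite (opnormC T) -[S - T](subrKA U) opnormD. Qed.

(* This reduces completeness for filters to sequences: [u n] is the center of a
   ball of radius 1/(n+1) that belongs to the filter. *)
Let complete_ball (u : nat -> commutant SS) :
  (forall n m, opnorm (u n - u m) <= n.+1%:R^-1 + m.+1%:R^-1) ->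
  exists L : commutant SS, forall r, 0 < r -> exists n, forall T,
    opnorm (u n - T) < n.+1%:R^-1 -> opnorm (L - T) < r.
Proof.
move=> cu.
have small e : 0 < e -> exists N : nat, forall n, (N <= n)%N -> (n.+1%:R : R)^-1 <= e.
  move=> e0; exists (Num.trunc e^-1) => n hn.
  rewrite -[leRHS]invrK lef_pV2 ?posrE ?invr_gt0 ?ltr0Sn // ltW //.
  apply: lt_le_trans (truncnS_gt _) _.
  by rewrite ler_nat ltnS.
have [|L hL] := @op_complete u.
  move=> e e0; have [|N hN] := small (e / 2); first by rewrite divr_gt0.
  exists N => n m hn hm.
  by rewrite (le_trans (cu n m)) // (splitr e) lerD // hN.
exists L => r r0; have r2 : 0 < r / 2 by rewrite divr_gt0.
have [N hN] := hL _ r2; have [M hM] := small _ r2.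
have [n [/hN hNn /hM hMn]] : exists n, (N <= n)%N /\ (M <= n)%N.
  by exists (maxn N M); rewrite leq_maxl leq_maxr.
exists n => T; rewrite opnormC => hT; rewrite (splitr r).
exact: le_lt_trans (opnorm_dist L T (u n)) (ler_ltD hNn (lt_le_trans hT hMn)).
Qed.

Let cnormD S T : (opnorm (S + T))%:C <= (opnorm S)%:C + (opnorm T)%:C.
Proof. by rewrite -rmorphD /= lecR opnormD. Qed.
Let cnormZ (k : R[i]) T : (opnorm (k *: T))%:C = `|k| * (opnorm T)%:C.
Proof. by rewrite norm_csq -rmorphM /= opnormZ. Qed.
Let cnorm_eq0 T : (opnorm T)%:C = 0 -> T = 0.
Proof. by move=> [/opnorm_eq0]. Qed.

HB.instance Definition _ := @Lmodule_isNormed.Build R[i] (commutant SS)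
  (fun T => (opnorm T)%:C) cnormD cnormZ cnorm_eq0.

Lemma op_normE T : `|T| = (opnorm T)%:C. Proof. by []. Qed.

Let op_cauchy_cvg (F : set_system (commutant SS)) :
  ProperFilter F -> cauchy F -> cvg F.
Proof.
move=> PF /cauchyP cF.
have inv_gt0 (n : nat) : 0 < (n.+1%:R : R)^-1 by rewrite invr_gt0.
have /choice[u hu] : forall n : nat, exists T, F (ball T ((n.+1%:R : R)^-1)%:C).
  by move=> n; apply: cF; rewrite ltcR.
have ball_op (S T : commutant SS) (r : R) : ball S r%:C T -> opnorm (S - T) < r.
  by rewrite -ball_normE /= op_normE ltcR.
have cu n m : opnorm (u n - u m) <= n.+1%:R^-1 + m.+1%:R^-1.
  have [T [/ball_op h1 /ball_op h2]] := filter_ex (filterI (hu n) (hu m)).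
  by rewrite (le_trans (opnorm_dist _ _ T)) // lerD // ltW.
have [L hL] := complete_ball cu.
apply/cvg_ex; exists L; apply/cvgrPdist_lt => e e0.
have [r er r0] : exists2 r : R, e = r%:C & 0 < r.
  by exists (complex.Re e); rewrite -?complex_ge0E ?ltW // -ltcR -complex_ge0E // ltW.
have [n hn] := hL r r0.
by apply: filterS (hu n) => T /ball_op /hn; rewrite op_normE er ltcR.
Qed.

HB.instance Definition _ := Uniform_isComplete.Build (commutant SS) op_cauchy_cvg.

Let op_compA S T U : op_comp S (op_comp T U) = op_comp (op_comp S T) U.
Proof. exact: op_ext. Qed.
Let op_compDl S T U : op_comp (S + T) U = op_comp S U + op_comp T U.
Proof. exact: op_ext. Qed.
Let op_compDr S T U : op_comp S (T + U) = op_comp S T + op_comp S U.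
Proof. by apply: op_ext => x; exact: opD. Qed.
Let op_compZl (k : R[i]) S T : op_comp (k *: S) T = k *: op_comp S T.
Proof. exact: op_ext. Qed.
Let op_compZr (k : R[i]) S T : op_comp S (k *: T) = k *: op_comp S T.
Proof. by apply: op_ext => x; exact: linear_funZ (op_linear S) k (T x). Qed.
Let op_starD S T : op_star (S + T) = op_star S + op_star T.
Proof.
by apply: op_starE => x y; rewrite !opDE (psdDl hdot) (psdDr hdot) !op_starP.
Qed.
Let op_starZ (k : R[i]) S : op_star (k *: S) = Num.conj k *: op_star S.
Proof.
by apply: op_starE => x y; rewrite !opZE (psdZl hdot) (psdZr hdot) op_starP.
Qed.
Let op_starM S T : op_star (op_comp S T) = op_comp (op_star T) (op_star S).
Proof.
by apply: op_starE => x y; rewrite /= (op_starP S) (op_starP T).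
Qed.
Let op_norm_mul S T : `|op_comp S T| <= `|S| * `|T|.
Proof. by rewrite !op_normE -rmorphM /= lecR opnormM. Qed.
Let op_norm_star_mul T : `|op_comp (op_star T) T| = `|T| ^+ 2.
Proof. by rewrite !op_normE -rmorphXn /= opnorm_starM. Qed.

HB.instance Definition _ := CompleteNormedModule_isCStarAlgebra.Build R
  (commutant SS) op_compA op_compDl op_compDr op_compZl op_compZr op_starK
  op_starD op_starZ op_starM op_norm_mul op_norm_star_mul.

Let op1x T : op_comp op_one T = T. Proof. exact: op_ext. Qed.
Let opx1 T : op_comp T op_one = T. Proof. exact: op_ext. Qed.
HB.instance Definition _ := CStarAlgebra_isUnital.Build R (commutant SS) op1x opx1.

Lemma op_mulE S T x : (S ** T) x = S (T x). Proof. by []. Qed.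
Lemma op_cstarP T : adjoint T T^#. Proof. exact: op_starP. Qed.
Lemma op_cstarE T (T' : commutant SS) : adjoint T T' -> T^# = T'.
Proof. exact: op_starE. Qed.

End CommutantNorm.

(** * Algebra-valued Gram matrices *)

Section Gram.
Variables (R : realType) (A : unitalCStarAlgType R) (H : lmodType R[i]).
Implicit Types (xi eta : seq (A * H)) (F : H -> H -> R[i]) (c d t : R).

(** A list of pairs [(a, h)] stands for the sum of the [a (x) h], in the tensor
    product of [A] and [H]; [gram] is its [A]-valued inner product. *)
Definition gram F xi eta : A :=
  \sum_(x <- xi) \sum_(y <- eta) F x.2 y.2 *: (x.1^# * y.1).

Lemma gram_catl F xi xi' eta :
  gram F (xi ++ xi') eta = gram F xi eta + gram F xi' eta.
Proof. by rewrite /gram big_cat. Qed.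
Lemma gram_catr F xi eta eta' :
  gram F xi (eta ++ eta') = gram F xi eta + gram F xi eta'.
Proof.
by rewrite /gram -big_split /=; apply: eq_bigr => x _; rewrite big_cat.
Qed.
Lemma gram0l F eta : gram F [::] eta = 0.
Proof. by rewrite /gram big_nil. Qed.

Definition tscale (k : R[i]) xi : seq (A * H) := [seq (k *: x.1, x.2) | x <- xi].

Lemma gram_scalel F k xi eta : gram F (tscale k xi) eta = Num.conj k *: gram F xi eta.
Proof.
rewrite /gram big_map scaler_sumr; apply: eq_bigr => x _ /=.
rewrite scaler_sumr; apply: eq_bigr => y _.
by rewrite starZ mulZl !scalerA mulrC.
Qed.
Lemma gram_scaler F k xi eta : gram F xi (tscale k eta) = k *: gram F xi eta.
Proof.
rewrite /gram scaler_sumr; apply: eq_bigr => x _ /=.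
rewrite big_map scaler_sumr; apply: eq_bigr => y _ /=.
by rewrite mulZr !scalerA mulrC.
Qed.

Lemma star_sum (I : Type) (r : seq I) (f : I -> A) :
  (\sum_(i <- r) f i)^# = \sum_(i <- r) (f i)^#.
Proof.
by elim: r => [|i r ih]; rewrite ?big_nil ?star0 // !big_cons starD ih.
Qed.

Lemma gram_star F (hF : psd_form F) xi eta : (gram F xi eta)^# = gram F eta xi.
Proof.
rewrite /gram star_sum [RHS]exchange_big; apply: eq_bigr => x _ /=.
rewrite star_sum; apply: eq_bigr => y _.
by rewrite starZ starM starK -(psdC hF).
Qed.

Lemma gram_comb F G a b xi eta :
  gram (fun x y => a * F x y + b * G x y) xi eta = a *: gram F xi eta + b *: gram G xi eta.
Proof.
rewrite /gram !scaler_sumr -big_split; apply: eq_bigr => x _ /=.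
rewrite !scaler_sumr -big_split; apply: eq_bigr => y _ /=.
by rewrite scalerDl !scalerA.
Qed.

Lemma gram_rank1 (f : H -> R[i]) xi :
  gram (fun x y => Num.conj (f x) * f y) xi xi =
  (\sum_(x <- xi) f x.2 *: x.1)^# * (\sum_(x <- xi) f x.2 *: x.1).
Proof.
rewrite /gram star_sum mulr_suml; apply: eq_bigr => x _.
rewrite mulr_sumr; apply: eq_bigr => y _.
by rewrite starZ mulZl mulZr scalerA.
Qed.

(** Schur complement of [F] with respect to [h]; it is positive by the
    Cauchy-Schwarz inequality and has [h] in its kernel. *)
Lemma psd_schur F (hF : psd_form F) h : 0 < fsq F h ->
  psd_form (fun x y => F x y - (fsq F h)^-1%:C * (Num.conj (F h x) * F h y)).
Proof.
move=> h0; split=> [x y z|k x y|x y|x].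
- by rewrite !(psdDr hF); ring.
- by rewrite !(psdZr hF); ring.
- rewrite rmorphB !rmorphM /= conj_real conjCK (psdC hF x y).
  by rewrite (mulrC (Num.conj (F h y))).
- rewrite conjM_csq -rmorphM (fsqE hF) -rmorphB ler0c subr_ge0.
  by rewrite ler_pdivrMl // (cauchy_schwarz hF).
Qed.

(** Cholesky's algorithm, by induction on the list: subtracting from [F] a form
    of rank 1, whose Gram matrix is some [z^* z], puts the first vector in the
    kernel of the form. *)
Theorem gram_ge0 F : psd_form F -> forall xi, cpos (gram F xi xi).
Proof.
move=> hF xi; elim: xi F hF => [|[a h] xi ih] F hF; first by rewrite gram0l; exact: cpos0.
have := fsq_ge0 hF h; rewrite le_eqVlt => /predU1P[h0|h0].
  have Fh y : F h y = 0.
    apply: csq_eq0; apply/eqP; rewrite eq_le csq_ge0 andbT.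
    by have := cauchy_schwarz hF h y; rewrite -h0 mul0r.
  have -> : gram F ((a, h) :: xi) ((a, h) :: xi) = gram F xi xi.
    rewrite -cat1s gram_catl !gram_catr.
    have z eta : gram F [:: (a, h)] eta = 0.
      by rewrite /gram big_seq1 big1 // => y _; rewrite /= Fh scale0r.
    by rewrite !z !add0r -(gram_star hF) z star0 add0r.
  exact: ih.
have hF' := psd_schur hF h0.
set F' := (fun _ => _) in hF'.
pose f x := F h x.
have -> : gram F ((a, h) :: xi) ((a, h) :: xi) =
    gram F' ((a, h) :: xi) ((a, h) :: xi) + (fsq F h)^-1%:C *:
      gram (fun x y => Num.conj (f x) * f y) ((a, h) :: xi) ((a, h) :: xi).
  rewrite -[X in X + _]scale1r -gram_comb; congr gram.
  by apply/funext => x; apply/funext => y; rewrite mul1r /F' subrK.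
apply: cposD; last first.
  rewrite gram_rank1; apply: cposZ; first by rewrite invr_ge0 ltW.
  exact: cpos_starM.
have F'h y : F' h y = 0.
  rewrite /F' {1}(fsqE hF h) conj_real mulrA -rmorphM mulVf ?gt_eqF //.
  by rewrite mul1r subrr.
rewrite -cat1s gram_catl !gram_catr.
have z eta : gram F' [:: (a, h)] eta = 0.
  by rewrite /gram big_seq1 big1 // => y _; rewrite /= F'h scale0r.
by rewrite !z !add0r -(gram_star hF') z star0 add0r; exact: ih.
Qed.
End Gram.

(** * C*-norms on the algebraic tensor product *)

Section TensorBound.
Variables (R : realType) (A B : cstarAlgType R).
Implicit Types (t u : seq (A * B)) (c d e : R).

(** What makes [gauge bnd] a C*-seminorm on the tensor product. Stated for bounds
    rather than for seminorms, so that the conjunction of two bounds is the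
    bound for the maximum of the seminorms. *)
Record tensor_bound (bnd : seq (A * B) -> R -> Prop) : Prop := TensorBound {
  tb_gauge : bound_gauge bnd;
  tb_compat : forall t u c, same_tensor t u -> bnd t c -> bnd u c;
  tb_add : forall t u c d, bnd t c -> bnd u d -> bnd (t ++ u) (c + d);
  tb_scale : forall k t c, bnd t c -> bnd (tensor_scale k t) (Num.sqrt (csq k) * c);
  tb_mul : forall t u c d, bnd t c -> bnd u d -> bnd (tensor_mul t u) (c * d);
  tb_star : forall t c, 0 < c -> bnd (tensor_mul (tensor_star t) t) (c ^+ 2) -> bnd t c
}.

Lemma tensor_starK t : tensor_star (tensor_star t) = t.
Proof.
rewrite /tensor_star -map_comp map_id_in // => -[a b] _ /=.
by rewrite !cstarK.
Qed.

Lemma same_tensor_sym t u : same_tensor t u -> same_tensor u t.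
Proof. by move=> h V f; rewrite h. Qed.

Lemma tensor_cstar_norm_of_bound bnd : tensor_bound bnd ->
  (forall t, bnd t 0 -> same_tensor t [::]) ->
  tensor_cstar_norm (fun t => (gauge bnd t)%:C).
Proof.
move=> [G compat add scale mul star] faithful.
split.
- move=> t u tu; congr (_%:C); apply/eqP; rewrite eq_le; apply/andP; split.
    by apply: gauge_le => //; apply: compat (gaugeP G u); exact: same_tensor_sym.
  by apply: gauge_le => //; apply: compat (gaugeP G t).
- by move=> t; rewrite ler0c gauge_ge0.
- by move=> t [t0]; apply: faithful; rewrite -t0; exact: gaugeP.
- move=> t u; rewrite -rmorphD /= lecR; apply: gauge_le => //.
  by apply: add; exact: gaugeP.
- move=> k t; rewrite norm_csq -rmorphM /=; congr (_%:C).
  apply: (gauge_scale G scale) => l v l0.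
  rewrite /tensor_scale -map_comp map_id_in // => -[a b] _ /=.
  by rewrite scalerA mulVf // scale1r.
- move=> t u; rewrite -rmorphM /= lecR; apply: gauge_le => //.
  by apply: mul; exact: gaugeP.
- move=> t; rewrite -rmorphXn /=; congr (_%:C).
  exact: (gauge_cstar G mul tensor_starK star).
Qed.

Lemma tensor_boundI bnd bnd' : tensor_bound bnd -> tensor_bound bnd' ->
  tensor_bound (fun t c => bnd t c /\ bnd' t c).
Proof.
move=> [G compat add scale mul star] [G' compat' add' scale' mul' star'].
split.
- split.
  + by move=> t c [/(bound_ge0 G)].
  + move=> t; have [c hc] := bound_ex G t; have [d hd] := bound_ex G' t.
    exists (Num.max c d); split.
      by apply: (bound_mono G) hc; rewrite le_max lexx.
    by apply: (bound_mono G') hd; rewrite le_max lexx orbT.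
  + move=> t c h; split.
      by apply: (bound_closed G) => e /h[].
    by apply: (bound_closed G') => e /h[].
  + move=> t c d cd [h h']; split; [exact: (bound_mono G) cd h|].
    exact: (bound_mono G') cd h'.
- by move=> t u c tu [h h']; split; [exact: compat h | exact: compat' h'].
- by move=> t u c d [? ?] [? ?]; split; [exact: add | exact: add'].
- by move=> k t c [? ?]; split; [exact: scale | exact: scale'].
- by move=> t u c d [? ?] [? ?]; split; [exact: mul | exact: mul'].
- by move=> t c c0 [? ?]; split; [exact: star | exact: star'].
Qed.
End TensorBound.

Section Spatial.
Variables (R : realType) (A : unitalCStarAlgType R) (H : hilbertType R).
Variable SS : star_set H.
Local Notation B := (commutant SS).
Implicit Types (t u : seq (A * B)) (xi eta : seq (A * H)) (c d e : R) (a : A).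
Let hdot : psd_form (dot : H -> H -> R[i]) := dot_psd.
Local Notation g := (@gram R A H dot).

(** [tact t xi] is the image of [xi] under the operator [t]. *)
Definition tact1 (p : A * B) (x : A * H) : A * H := (p.1 * x.1, p.2 x.2).
Definition tact t xi : seq (A * H) := [seq tact1 p x | p <- t, x <- xi].

Lemma big_tact t xi (phi : A * H -> A) :
  \sum_(z <- tact t xi) phi z =
  \sum_(p <- t) \sum_(x <- xi) phi (tact1 p x).
Proof. exact: big_allpairs_dep. Qed.

Lemma tact_cat t u xi : tact (t ++ u) xi = tact t xi ++ tact u xi.
Proof. exact: allpairs_cat. Qed.

Lemma tact_mul t u xi : tact (tensor_mul t u) xi = tact t (tact u xi).
Proof.
rewrite /tact /tensor_mul; elim: t => [|p t ih] //=.
rewrite allpairs_cat ih; congr (_ ++ _) => {ih}.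
elim: u => [|r u ih] //=.
rewrite ih map_cat; congr (_ ++ _).
rewrite -map_comp; apply: eq_map => x /=.
by rewrite /tact1 /= cmulE mulrA.
Qed.

Lemma gram_tact_star t xi eta : g (tact t xi) eta = g xi (tact (tensor_star t) eta).
Proof.
rewrite /gram big_tact.
rewrite [RHS](eq_bigr (fun x => \sum_(p <- t) \sum_(y <- eta)
    dot (p.2 x.2) y.2 *: ((p.1 * x.1)^# * y.1))); last first.
  move=> x _; rewrite big_tact big_map; apply: eq_bigr => p _.
  by apply: eq_bigr => y _ /=; rewrite (op_cstarP p.2) starM -mulrA.
by rewrite exchange_big.
Qed.

Definition lact a xi : seq (A * H) := [seq (a * x.1, x.2) | x <- xi].
Definition ract (T : H -> H) xi : seq (A * H) := [seq (x.1, T x.2) | x <- xi].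

Lemma gram_lact a xi eta : g (lact a xi) (lact a eta) =
  \sum_(x <- xi) \sum_(y <- eta) dot x.2 y.2 *: (x.1^# * (a^# * a) * y.1).
Proof.
rewrite /gram big_map; apply: eq_bigr => x _; rewrite big_map.
by apply: eq_bigr => y _ /=; rewrite starM !mulrA.
Qed.

(** For [d > 0] the element [(c + d)^2 - a^* a] is some [b^* b], so that the
    difference of the two sides, with [c + d] for [c], is the square of
    [b xi]. *)
Lemma gram_lact_le a c xi : nrm a <= c ->
  cpos ((c ^+ 2)%:C *: g xi xi - g (lact a xi) (lact a xi)).
Proof.
move=> ac; have c0 : 0 <= c := le_trans (nrm_ge0 a) ac.
apply: (@cpos_archimedean _ _ _ ((2 * c + 1)%:C *: g xi xi)) => e e0.
pose d := Num.min e 1.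
have d0 : 0 < d by rewrite lt_min e0 ltr01.
have [de d1] : d <= e /\ d <= 1 by rewrite !ge_min !lexx orbT.
have [|b hb] := @cpos_nrm_sub_starM _ _ a (c + d); first by lra.
rewrite scalerA -rmorphM /=.
have -> : (c ^+ 2)%:C *: g xi xi - g (lact a xi) (lact a xi) +
    (e * (2 * c + 1))%:C *: g xi xi =
    g (lact b xi) (lact b xi) +
    (e * (2 * c + 1) - (2 * c * d + d ^+ 2))%:C *: g xi xi.
  have -> : g (lact b xi) (lact b xi) =
      ((c + d) ^+ 2)%:C *: g xi xi - g (lact a xi) (lact a xi).
    rewrite !gram_lact -hb /gram scaler_sumr -sumrB; apply: eq_bigr => x _.
    rewrite scaler_sumr -sumrB; apply: eq_bigr => y _.
    rewrite mulrBr mulrBl mulZr mulr1 mulZl scalerBr !scalerA.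
    by rewrite (mulrC (dot _ _)).
  rewrite addrAC -scalerDl -rmorphD /= addrAC -scalerDl -rmorphD /=.
  by congr (_%:C *: _ - _); ring.
apply: cposD; first exact: gram_ge0.
apply: cposZ; last exact: gram_ge0.
nra.
Qed.

(** The form [c^2 <x, y> - <T x, T y>] is positive on [H]. *)
Lemma gram_ract_le (T : H -> H) c xi : linear T -> op_bound T c ->
  cpos ((c ^+ 2)%:C *: g xi xi - g (ract T xi) (ract T xi)).
Proof.
move=> Tl [c0 hc].
pose F x y := (c ^+ 2)%:C * dot x y + -1 * dot (T x) (T y).
have hF : psd_form F.
  split=> [x y z|k x y|x y|x]; rewrite /F.
  - by rewrite (linear_funD Tl) !(psdDr hdot); ring.
  - by rewrite (linear_funZ Tl) !(psdZr hdot); ring.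
  - by rewrite rmorphD !rmorphM rmorphN rmorph1 /= conj_real -!(psdC hdot).
  - rewrite !(fsqE hdot) mulN1r -rmorphM -rmorphB ler0c subr_ge0.
    rewrite -!(fnorm_sqr hdot) -exprMn.
    by rewrite lerXn2r ?nnegrE ?mulr_ge0 ?fnorm_ge0.
have -> : (c ^+ 2)%:C *: g xi xi - g (ract T xi) (ract T xi) = gram F xi xi.
  rewrite gram_comb scaleN1r; congr (_ - _).
  rewrite /gram big_map; apply: eq_bigr => x _; rewrite big_map.
  exact: eq_bigr.
exact: gram_ge0.
Qed.

(** The bounds of [t] as an operator on the completion of the tensor product of
    [A] and [H]. *)
Definition spatial_bound t c := 0 <= c /\
  forall xi, cpos ((c ^+ 2)%:C *: g xi xi - g (tact t xi) (tact t xi)).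

Lemma spatial_mono t c d : c <= d -> spatial_bound t c -> spatial_bound t d.
Proof.
move=> cd [c0 hc]; split=> [|xi]; first exact: le_trans cd.
have -> : (d ^+ 2)%:C *: g xi xi - g (tact t xi) (tact t xi) =
   ((c ^+ 2)%:C *: g xi xi - g (tact t xi) (tact t xi)) +
   (d ^+ 2 - c ^+ 2)%:C *: g xi xi.
  by rewrite addrAC -scalerDl -rmorphD /=; congr (_%:C *: _ - _); ring.
apply: cposD => //; apply: cposZ; last exact: gram_ge0.
by rewrite subr_ge0 lerXn2r ?nnegrE // (le_trans c0).
Qed.

(* [(c + d)^2 <= c^2 + e (2 c + 1)] when [d] is at most [e] and 1. *)
Lemma spatial_closed t c : (forall e, 0 < e -> spatial_bound t (c + e)) -> spatial_bound t c.
Proof.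
move=> hc; have c0 : 0 <= c by apply: le_of_leDe => e /hc[].
split=> // xi; apply: (@cpos_archimedean _ _ _ ((2 * c + 1)%:C *: g xi xi)) => e e0.
pose d := Num.min e 1.
have d0 : 0 < d by rewrite lt_min e0 ltr01.
have [de d1] : d <= e /\ d <= 1 by rewrite !ge_min !lexx orbT.
rewrite scalerA -rmorphM /=.
have -> : (c ^+ 2)%:C *: g xi xi - g (tact t xi) (tact t xi) +
    (e * (2 * c + 1))%:C *: g xi xi =
    (((c + d) ^+ 2)%:C *: g xi xi - g (tact t xi) (tact t xi)) +
    (e * (2 * c + 1) - (2 * c * d + d ^+ 2))%:C *: g xi xi.
  rewrite addrAC -scalerDl -rmorphD /= addrAC -scalerDl -rmorphD /=.
  by congr (_%:C *: _ - _); ring.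
apply: cposD; first by have [_] := hc d d0.
apply: cposZ; last exact: gram_ge0.
nra.
Qed.

(** [|x + y|^2 <= (c + d) (|x|^2 / c + |y|^2 / d)]: the difference is the square
    of [sqrt (d / c) x - sqrt (c / d) y]. With [c] and [d] bounds of two
    operators it gives the bound [c + d] for their sum, although square roots of
    elements of [A] do not satisfy a triangle inequality. *)
Lemma gram_cat_le xi eta c d : 0 < c -> 0 < d ->
  cpos ((c + d)%:C *: (c^-1%:C *: g xi xi + d^-1%:C *: g eta eta) -
        g (xi ++ eta) (xi ++ eta)).
Proof.
move=> c0 d0; pose s := Num.sqrt (d / c); pose r := Num.sqrt (c / d).
have s0 : 0 < d / c by rewrite divr_gt0.
have r0 : 0 < c / d by rewrite divr_gt0.
have ss : s ^+ 2 = d / c by rewrite sqr_sqrtr // ltW.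
have rr : r ^+ 2 = c / d by rewrite sqr_sqrtr // ltW.
have sr : s * r = 1.
  rewrite -sqrtrM ?ltW // (_ : _ * _ = 1) ?sqrtr1 //; field.
  by rewrite !gt_eqF.
pose z := tscale s%:C xi ++ tscale (- r%:C) eta.
have -> : (c + d)%:C *: (c^-1%:C *: g xi xi + d^-1%:C *: g eta eta) -
    g (xi ++ eta) (xi ++ eta) = g z z.
  rewrite /z !(gram_catl, gram_catr, gram_scalel, gram_scaler).
  rewrite rmorphN /= !conj_real scalerDr !scalerA.
  rewrite !(mulrN, mulNr) -!rmorphM /= opprK sr -!expr2 ss rr [r * s]mulrC sr.
  have -> : (c + d) * c^-1 = 1 + d / c by field; rewrite gt_eqF.
  have -> : (c + d) * d^-1 = 1 + c / d by field; rewrite gt_eqF.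
  rewrite !rmorphD /= -[real_complex _ 1]/(1 : R[i]).
  by lmodule (complex R) (UnitalCStarAlgebra.sort A).
exact: gram_ge0.
Qed.

Lemma spatial_add t u c d :
  spatial_bound t c -> spatial_bound u d -> spatial_bound (t ++ u) (c + d).
Proof.
move=> ht hu; apply: spatial_closed => e e0.
have [c0 _] := ht; have [d0 _] := hu.
have [c' c'E] : exists c', c' = c + e / 2 by eexists.
have [d' d'E] : exists d', d' = d + e / 2 by eexists.
have c0' : 0 < c' by rewrite c'E; lra.
have d0' : 0 < d' by rewrite d'E; lra.
have [_ ht'] : spatial_bound t c' by apply: spatial_mono ht; rewrite c'E; lra.
have [_ hu'] : spatial_bound u d' by apply: spatial_mono hu; rewrite d'E; lra.
have -> : c + d + e = c' + d' by rewrite c'E d'E; field.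
split=> [|xi]; first by apply: addr_ge0; exact: ltW.
rewrite tact_cat.
have h1 := gram_cat_le (tact t xi) (tact u xi) c0' d0'.
have h2 := cposZ (_ : 0 <= (c' + d') / c') (ht' xi).
have h3 := cposZ (_ : 0 <= (c' + d') / d') (hu' xi).
have p1 : 0 <= (c' + d') / c' := divr_ge0 (addr_ge0 (ltW c0') (ltW d0')) (ltW c0').
have p2 : 0 <= (c' + d') / d' := divr_ge0 (addr_ge0 (ltW c0') (ltW d0')) (ltW d0').
have := cposD (cposD (h2 p1) (h3 p2)) h1.
congr cpos.
move: (g (tact t xi) _) (g (tact u xi) _) (g xi xi) => X Y Z.
move: (g _ _) => W.
rewrite !scalerBr !scalerDr !scalerA -!rmorphM /=.
have -> : (c' + d') / c' * c' ^+ 2 = (c' + d') * c' by field; rewrite gt_eqF.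
have -> : (c' + d') / d' * d' ^+ 2 = (c' + d') * d' by field; rewrite gt_eqF.
rewrite expr2 mulrDr rmorphD /=.
by lmodule (complex R) (UnitalCStarAlgebra.sort A).
Qed.

Lemma spatial_mul t u c d :
  spatial_bound t c -> spatial_bound u d -> spatial_bound (tensor_mul t u) (c * d).
Proof.
move=> [c0 ht] [d0 hu]; split=> [|xi]; first exact: mulr_ge0.
rewrite tact_mul exprMn rmorphM -scalerA.
have -> : (c ^+ 2)%:C *: ((d ^+ 2)%:C *: g xi xi) -
    g (tact t (tact u xi)) (tact t (tact u xi)) =
    (c ^+ 2)%:C *: ((d ^+ 2)%:C *: g xi xi - g (tact u xi) (tact u xi)) +
    ((c ^+ 2)%:C *: g (tact u xi) (tact u xi) -
     g (tact t (tact u xi)) (tact t (tact u xi))).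
  by rewrite scalerBr addrA subrK.
by apply: cposD => //; apply: cposZ => //; rewrite sqr_ge0.
Qed.

Lemma spatial_scale k t c :
  spatial_bound t c -> spatial_bound (tensor_scale k t) (Num.sqrt (csq k) * c).
Proof.
move=> [c0 hc]; split=> [|xi]; first by rewrite mulr_ge0 ?sqrtr_ge0.
have -> : tact (tensor_scale k t) xi = tscale k (tact t xi).
  rewrite /tact /tensor_scale /tscale map_allpairs allpairs_mapl.
  by apply: eq_allpairs => p x; rewrite /tact1 /= mulZl.
rewrite gram_scalel gram_scaler scalerA conjM_csq exprMn sqr_sqrtr ?csq_ge0 //.
by rewrite rmorphM -scalerA -scalerBr; apply: cposZ; rewrite ?csq_ge0.
Qed.

(** Positivity of the square of [c^2 xi - t^* t xi] gives
    [2 c^2 <t xi, t xi> <= c^4 <xi, xi> + <t^* t xi, t^* t xi>], where the right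
    hand side is at most [2 c^4 <xi, xi>]. *)
Lemma spatial_star t c : 0 < c ->
  spatial_bound (tensor_mul (tensor_star t) t) (c ^+ 2) -> spatial_bound t c.
Proof.
move=> c0 [_ hc]; split=> [|xi]; first exact: ltW.
have := hc xi; rewrite tact_mul; set eta := tact _ _ => h1.
have m1 : g eta xi = g (tact t xi) (tact t xi).
  by rewrite /eta gram_tact_star tensor_starK.
have m2 : g xi eta = g (tact t xi) (tact t xi) by rewrite gram_tact_star.
have h2 := gram_ge0 hdot (tscale (c ^+ 2)%:C xi ++ tscale (-1) eta).
have -> : (c ^+ 2)%:C *: g xi xi - g (tact t xi) (tact t xi) =
  (2 * c ^+ 2)^-1%:C *: (((c ^+ 2 ^+ 2)%:C *: g xi xi - g eta eta) +
   g (tscale (c ^+ 2)%:C xi ++ tscale (-1) eta) (tscale (c ^+ 2)%:C xi ++ tscale (-1) eta)).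
  rewrite !(gram_catl, gram_catr, gram_scalel, gram_scaler) m1 m2.
  rewrite rmorphN rmorph1 /= conj_real !(scaleN1r, scalerN, opprK) !scalerA -rmorphM /=.
  rewrite -expr2.
  have -> : (c ^+ 2 ^+ 2)%:C *: g xi xi - g eta eta + ((c ^+ 2 ^+ 2)%:C *: g xi xi -
     (c ^+ 2)%:C *: g (tact t xi) (tact t xi) +
     (- ((c ^+ 2)%:C *: g (tact t xi) (tact t xi)) + g eta eta)) =
     (2 * c ^+ 2)%:C *: ((c ^+ 2)%:C *: g xi xi - g (tact t xi) (tact t xi)).
    rewrite scalerBr !scalerA -!rmorphM /= -mulrA -expr2 !(rmorphM _ 2) /=.
    rewrite (_ : 2%:C = 1 + 1 :> R[i]); last by rewrite -rmorphD.
    by lmodule (complex R) (UnitalCStarAlgebra.sort A).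
  rewrite scalerA -rmorphM mulVf ?scale1r //.
  by rewrite gt_eqF // mulr_gt0 // exprn_gt0.
apply: cposZ; first by rewrite invr_ge0 mulr_ge0 // sqr_ge0.
exact: cposD.
Qed.
End Spatial.

Section MakeBilinear.
Variables (R : realType) (U V W : lmodType R[i]) (f : U -> V -> W).

Lemma bilinear_intro :
  (forall v, linear (f^~ v)) -> (forall u, linear (f u)) ->
  exists f' : {bilinear U -> V -> W}, forall u v, f' u v = f u v.
Proof.
move=> hl hr.
pose m := bilinear_isBilinear.Build R[i] U V W *:%R *:%R f (conj hl hr).
by exists (HB.pack_for {bilinear U -> V -> W} f m).
Qed.
End MakeBilinear.

Section SpatialNorm.
Variables (R : realType) (A : unitalCStarAlgType R) (H : hilbertType R).
Variable SS : star_set H.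
Local Notation B := (commutant SS).
Implicit Types (t u : seq (A * B)) (xi eta : seq (A * H)) (c d e : R) (a : A).
Let hdot : psd_form (dot : H -> H -> R[i]) := dot_psd.
Local Notation g := (@gram R A H dot).

Lemma same_tensor_sum (V : lmodType R[i]) (f : A -> B -> V) t u :
  (forall b, linear (f^~ b)) -> (forall a, linear (f a)) ->
  same_tensor t u -> \sum_(p <- t) f p.1 p.2 = \sum_(p <- u) f p.1 p.2.
Proof.
move=> h1 h2 tu; have [f' hf] := bilinear_intro h1 h2.
have e v : \sum_(p <- v) f p.1 p.2 = \sum_(p <- v) f' p.1 p.2.
  by apply: eq_bigr => p _; rewrite hf.
by rewrite !e; exact: tu.
Qed.

Lemma same_tensor_gram t u xi eta : same_tensor t u ->
  g eta (tact t xi) = g eta (tact u xi).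
Proof.
move=> tu.
pose f (a : A) (b : B) : A := \sum_(y <- eta) \sum_(x <- xi)
  dot y.2 (b x.2) *: (y.1^# * (a * x.1)).
have gE v : g eta (tact v xi) = \sum_(p <- v) f p.1 p.2.
  rewrite /gram /f [RHS]exchange_big; apply: eq_bigr => y _ /=.
  by rewrite big_tact.
rewrite !gE; apply: same_tensor_sum => // [b|a] k x y; rewrite /f /=.
- rewrite scaler_sumr -big_split; apply: eq_bigr => z _ /=.
  rewrite scaler_sumr -big_split; apply: eq_bigr => w _ /=.
  by rewrite mulrDl mulrDr mulZl mulZr scalerDr !scalerA mulrC.
- rewrite scaler_sumr -big_split; apply: eq_bigr => z _ /=.
  rewrite scaler_sumr -big_split; apply: eq_bigr => w _ /=.
  by rewrite (psdDr hdot) (psdZr hdot) scalerDl scalerA.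
Qed.

Lemma spatial_compat t u c : same_tensor t u -> spatial_bound t c -> spatial_bound u c.
Proof.
move=> tu [c0 hc]; split=> // xi.
suff -> : g (tact u xi) (tact u xi) = g (tact t xi) (tact t xi) by [].
rewrite -(same_tensor_gram _ _ tu) -(gram_star hdot) -(same_tensor_gram _ _ tu).
exact: gram_star.
Qed.

Lemma tact_nil xi : tact ([::] : seq (A * B)) xi = [::]. Proof. by []. Qed.

Lemma spatial_bound1 (a : A) (b : B) :
  spatial_bound [:: (a, b)] (nrm a * opnorm b).
Proof.
split=> [|xi]; first by rewrite mulr_ge0 ?nrm_ge0 ?opnorm_ge0.
have -> : tact [:: (a, b)] xi = lact a (ract b xi).
  by rewrite /tact /= cats0 /lact /ract -map_comp.
have hb : op_bound b (opnorm b) by split=> [|x]; [exact: opnorm_ge0 | exact: opnormP].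
have := gram_ract_le xi (@op_linear _ _ _ b) hb.
move=> /(cposZ (sqr_ge0 (nrm a))) h1.
have := cposD h1 (gram_lact_le (ract b xi) (lexx (nrm a))).
by rewrite scalerBr addrA subrK scalerA -rmorphM /= exprMn.
Qed.

Lemma spatial_ex t : exists c, spatial_bound t c.
Proof.
elim: t => [|[a b] t [c hc]].
  exists 0; split=> // xi; rewrite tact_nil gram0l expr0n scale0r subr0.
  exact: cpos0.
exists (nrm a * opnorm b + c); rewrite -cat1s.
exact: spatial_add (spatial_bound1 a b) hc.
Qed.

Theorem spatial_tensor_bound : tensor_bound (@spatial_bound R A H SS).
Proof.
split.
- split.
  + by move=> t c [].
  + exact: spatial_ex.
  + by move=> t c; exact: spatial_closed.
  + by move=> t c d; exact: spatial_mono.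
- by move=> t u c; exact: spatial_compat.
- by move=> t u c d; exact: spatial_add.
- by move=> k t c; exact: spatial_scale.
- by move=> t u c d; exact: spatial_mul.
- by move=> t c; exact: spatial_star.
Qed.

(** Applying the positive form [|k|^2 <x, y> - <x, k> <k, y>] to the image of
    [1 (x) h], whose square vanishes, shows that the square of the coefficient of
    this image along [k] is negative. *)
Lemma spatial_bound0 t : spatial_bound t 0 ->
  forall h k, \sum_(p <- t) dot k (p.2 h) *: p.1 = 0.
Proof.
move=> [_ ht] h k.
have := ht [:: (1, h)]; rewrite expr0n scale0r sub0r.
set eta := tact t _ => h0.
have e0 : g eta eta = 0 by apply: cpos_anti => //; exact: gram_ge0.
pose F x y := (fsq dot k)%:C * dot x y + -1 * (Num.conj (dot k x) * dot k y).
have hF : psd_form F.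
  split=> [x y z|a x y|x y|x]; rewrite /F.
  - by rewrite !(psdDr hdot); ring.
  - by rewrite !(psdZr hdot); ring.
  - rewrite rmorphD !rmorphM rmorphN rmorph1 /= conj_real conjCK (psdC hdot x y).
    by rewrite (mulrC (dot k x)).
  - rewrite (fsqE hdot) conjM_csq mulN1r -rmorphM -rmorphB ler0c subr_ge0.
    exact: cauchy_schwarz.
have := gram_ge0 hF eta; rewrite gram_comb e0 scaler0 add0r scaleN1r gram_rank1.
set z := \sum_(x <- _) _ => hz.
have zE : z = \sum_(p <- t) dot k (p.2 h) *: p.1.
  rewrite /z big_tact; apply: eq_bigr => p _.
  by rewrite big_seq1 /= mulr1.
rewrite -zE; apply: nrm_eq0.
have zz : z^# * z = 0 by apply: cpos_anti => //; exact: cpos_starM.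
have := nrm_starM z; rewrite zz nrm0 => /esym/eqP.
by rewrite expf_eq0 /= => /eqP.
Qed.

(** If [b <> 0] in the first term [a (x) b], some coefficient equation expresses
    [a] through the other terms; substituting, the tensor is written with one
    term less. *)
Lemma same_tensor_of_coefficients t :
  (forall h k, \sum_(p <- t) dot k (p.2 h) *: p.1 = 0) -> same_tensor t [::].
Proof.
move: {2}(size t) (erefl (size t)) => n; elim: n t => [|n ih] [|[a b] t] //= [tn] ht V f.
have [b0|b0] := pselect (b = 0).
  rewrite big_cons /= b0 linear0r add0r; apply: ih => // h k.
  by have := ht h k; rewrite big_cons /= b0 op0E (psd0r hdot) scale0r add0r.
have [h [k hk]] : exists h k, dot k (b h) != 0.
  apply: contrapT => hn; apply: b0; apply: op_ext => h; apply: dot_ext => k.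
  rewrite op0E (psd0r hdot); apply/eqP; apply: contrapT => /negP hk.
  by apply: hn; exists h, k.
pose r (p : A * B) := (dot k (b h))^-1 * dot k (p.2 h).
pose t' := [seq (p.1, p.2 - r p *: b) | p <- t].
have aE : a = - \sum_(p <- t) r p *: p.1.
  have := ht h k; rewrite big_cons /= => /eqP; rewrite addr_eq0 => /eqP.
  move=> /(congr1 ( *:%R (dot k (b h))^-1)); rewrite scalerA mulVf // scale1r => ->.
  by rewrite scalerN scaler_sumr; congr (- _); apply: eq_bigr => p _; rewrite scalerA.
have -> : \sum_(p <- (a, b) :: t) f p.1 p.2 = \sum_(p <- t') f p.1 p.2.
  rewrite big_cons big_map /= aE linearNl linear_sumlz /=.
  rewrite -sumrN -big_split; apply: eq_bigr => p _ /=.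
  by rewrite linearBr linearZl_LR linearZr_LR addrC.
apply: ih; first by rewrite size_map.
move=> x y; rewrite big_map /=.
have := ht x y; rewrite big_cons /= aE scalerN scaler_sumr -sumrN -big_split /= => h0.
rewrite -[RHS]h0; apply: eq_bigr => p _.
rewrite (psdDr hdot) (psdNr hdot) (psdZr hdot) scalerBl addrC scalerA.
by rewrite (mulrC (r p)).
Qed.

Theorem spatial_faithful t : spatial_bound t 0 -> same_tensor t [::].
Proof. by move=> /spatial_bound0 /same_tensor_of_coefficients. Qed.

End SpatialNorm.

(** * The seminorm of a pair of commuting representations *)

Section Representation.
Variables (R : realType) (A : unitalCStarAlgType R) (H : hilbertType R).
Variables (SS SS' : star_set H).
Local Notation B := (commutant SS).
Variable pi : {linear A -> commutant SS'}.
Hypothesis pi_hom : unital_star_hom pi.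
Hypothesis pi_comm : forall a (b : B) x, pi a (b x) = b (pi a x).
Implicit Types (t u : seq (A * B)) (x y : H) (c d e : R).
Let hdot : psd_form (dot : H -> H -> R[i]) := dot_psd.

Definition rep t x : H := \sum_(p <- t) pi p.1 (p.2 x).
Definition rep_bound t c := op_bound (rep t) c.

Let op_sum (SS0 : star_set H) (T : commutant SS0) (I : Type) (r : seq I) (f : I -> H) :
  T (\sum_(i <- r) f i) = \sum_(i <- r) T (f i).
Proof.
exact: (big_morph T (@opD _ _ _ T) (linear_fun0 (op_linear T))).
Qed.

Let dot_sumr (I : Type) (r : seq I) (f : I -> H) x :
  dot x (\sum_(i <- r) f i) = \sum_(i <- r) dot x (f i).
Proof. by apply: (big_morph (dot x)) => [y z|]; rewrite ?(psdDr hdot) ?(psd0r hdot). Qed.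
Let dot_suml (I : Type) (r : seq I) (f : I -> H) x :
  dot (\sum_(i <- r) f i) x = \sum_(i <- r) dot (f i) x.
Proof.
by apply: (big_morph (dot^~ x)) => [y z|]; rewrite ?(psdDl hdot) ?(psd0l hdot).
Qed.

Lemma rep_cat t u x : rep (t ++ u) x = rep t x + rep u x.
Proof. exact: big_cat. Qed.

Lemma rep_mul t u x : rep (tensor_mul t u) x = rep t (rep u x).
Proof.
rewrite /rep [LHS]big_allpairs_dep; apply: eq_bigr => p _.
rewrite !op_sum; apply: eq_bigr => r _ /=.
rewrite (hom_mul pi_hom).
exact: (congr1 (pi p.1) (pi_comm r.1 p.2 (r.2 x))).
Qed.

Lemma rep_star t x y : dot (rep t x) y = dot x (rep (tensor_star t) y).
Proof.
rewrite dot_suml dot_sumr big_map; apply: eq_bigr => p _ /=.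
rewrite (op_cstarP (pi p.1)) (op_cstarP p.2) -(hom_star pi_hom).
by rewrite -(pi_comm p.1^# p.2^# y).
Qed.

Lemma rep_scale k t x : rep (tensor_scale k t) x = k *: rep t x.
Proof.
rewrite /rep big_map scaler_sumr; apply: eq_bigr => p _.
rewrite -opZE; congr (opfun _ _); exact: linearZ_LR.
Qed.

Lemma rep_compat t u x : same_tensor t u -> rep t x = rep u x.
Proof.
apply: (same_tensor_sum (f := fun a (b : B) => pi a (b x))) => [b|a] k y z.
- by rewrite linearP.
- by have := op_linear (pi a) k (y x) (z x).
Qed.

Let rep_ex t : exists c, rep_bound t c.
Proof.
elim: t => [|[a b] t [c [c0 hc]]].
  exists 0; split=> // x; rewrite /rep big_nil mul0r.
  by rewrite /fnorm /fsq (psd0l hdot) sqrtr0.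
exists (opnorm (pi a) * opnorm b + c).
split=> [|x]; first by rewrite addr_ge0 // mulr_ge0 ?opnorm_ge0.
rewrite -cat1s rep_cat (le_trans (fnormD hdot _ _)) // mulrDl lerD //.
rewrite /rep big_seq1 (le_trans (opnormP _ _)) //= -mulrA.
by rewrite ler_wpM2l ?opnorm_ge0 // opnormP.
Qed.

Theorem rep_tensor_bound : tensor_bound rep_bound.
Proof.
split.
- split.
  + by move=> t c [].
  + exact: rep_ex.
  + by move=> t c; exact: op_bound_closed.
  + by move=> t c d; exact: op_bound_mono.
- by move=> t u c tu [c0 hc]; split=> // x; rewrite -(rep_compat x tu).
- move=> t u c d [c0 hc] [d0 hd]; split=> [|x]; first exact: addr_ge0.
  by rewrite rep_cat mulrDl (le_trans (fnormD hdot _ _)) // lerD.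
- move=> k t c [c0 hc]; split=> [|x]; first by rewrite mulr_ge0 ?sqrtr_ge0.
  rewrite rep_scale /fnorm (fsqZ hdot) sqrtrM ?csq_ge0 // -mulrA.
  by rewrite ler_wpM2l ?sqrtr_ge0 // hc.
- move=> t u c d [c0 hc] [d0 hd]; split=> [|x]; first exact: mulr_ge0.
  by rewrite rep_mul (le_trans (hc (rep u x))) // -mulrA ler_wpM2l.
- move=> t c c0 [_ hc]; split=> [|x]; first exact: ltW.
  apply: (fnorm_le_of_form hdot (ltW c0) (rep_star t x (rep t x))).
  by rewrite -rep_mul.
Qed.

(** The two norms are the spatial one and its maximum with the seminorm given by
    [rep]; the latter is not faithful in general, but the maximum is. *)
Theorem not_nuclear_of_bounds t c x :
  spatial_bound t c -> c * fnorm dot x < fnorm dot (rep t x) -> ~ nuclear A.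
Proof.
move=> tc tx nA.
have b1 := spatial_tensor_bound A SS.
have b2 := tensor_boundI b1 rep_tensor_bound.
have n1 := tensor_cstar_norm_of_bound b1 (@spatial_faithful _ _ _ _).
have n2 := tensor_cstar_norm_of_bound b2 (fun t h => spatial_faithful h.1).
have [e12] := nA _ _ _ n1 n2 t.
have h1 := gauge_le (tb_gauge b1) tc.
have [_ [_ h2]] := gaugeP (tb_gauge b2) t.
have := h2 x; rewrite -e12 => h3.
have := ler_wpM2r (fnorm_ge0 dot x) h1; lra.
Qed.
End Representation.

(** * The Hilbert space of square-summable families *)

Section Enumeration.
Variables (R : realType) (Y : countType).
Implicit Types (f g : Y -> R[i]) (s : seq Y) (m n : nat).

(** Sums over [Y] are limits along this exhaustion of [Y] by finite sets. *)
Definition first_elements n : seq Y := pmap (pickle_inv (T := Y)) (iota 0 n).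

Lemma first_elements_uniq n : uniq (first_elements n).
Proof. by apply: (pmap_uniq (@pickle_invK Y)); exact: iota_uniq. Qed.

Lemma mem_first_elements n y : (y \in first_elements n) = (pickle y < n)%N.
Proof.
rewrite mem_pmap; apply/mapP/idP => [[k]|h].
  rewrite mem_iota add0n => /= kn h; have := @pickle_invK Y k.
  by rewrite -h /= => ->.
by exists (pickle y); rewrite ?mem_iota // pickleK_inv.
Qed.

Lemma exists_first_elements s : exists n, {subset s <= first_elements n}.
Proof.
elim: s => [|y s [n hn]]; first by exists 0%N.
exists (maxn n (pickle y).+1) => z; rewrite inE mem_first_elements leq_max.
by case/predU1P=> [->|/hn]; rewrite ?ltnSn ?orbT // mem_first_elements => ->.
Qed.

Lemma ler_sum_uniq (F : Y -> R) s t : uniq s -> uniq t -> {subset s <= t} ->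
  (forall y, 0 <= F y) -> \sum_(y <- s) F y <= \sum_(y <- t) F y.
Proof.
move=> us ut st F0; rewrite [leRHS](bigID (mem s)) /=.
have -> : \sum_(y <- t | y \in s) F y = \sum_(y <- s) F y.
  rewrite -big_filter; apply: perm_big; apply: uniq_perm => //.
    exact: filter_uniq.
  by move=> y; rewrite mem_filter andb_idr // => /st.
by rewrite lerDl sumr_ge0.
Qed.

Definition sqsum f s : R := \sum_(y <- s) csq (f y).

Definition square_summable : {pred Y -> R[i]} :=
  [pred f | `[< exists M, forall s, uniq s -> sqsum f s <= M >]].

Lemma csqD_le (z w : R[i]) : csq (z + w) <= 2 * csq z + 2 * csq w.
Proof.
case: z w => a b [c d]; rewrite /csq /=.
by have := sqr_ge0 (a - c); have := sqr_ge0 (b - d); nra.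
Qed.

Lemma square_summable_submod : submod_closed square_summable.
Proof.
split.
  apply/asboolP; exists 0 => s _; rewrite /sqsum big1 // => y _; exact: csq0.
move=> k f g /asboolP[M hM] /asboolP[M' hM']; apply/asboolP.
exists (2 * csq k * M + 2 * M') => s us.
apply: (@le_trans _ _ (2 * csq k * sqsum f s + 2 * sqsum g s)).
  rewrite /sqsum !mulr_sumr -big_split; apply: ler_sum => y _ /=.
  by rewrite (le_trans (csqD_le _ _)) // csqM mulrA.
by rewrite lerD // ler_wpM2l ?hM ?hM' // mulr_ge0 ?csq_ge0.
Qed.
HB.instance Definition _ := GRing.isSubmodClosed.Build R[i] (Y -> R[i])
  square_summable square_summable_submod.

Record l2 := L2 { l2_fun :> Y -> R[i]; l2_funP : l2_fun \in square_summable }.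
HB.instance Definition _ := [isSub for l2_fun].
HB.instance Definition _ := [Choice of l2 by <:].
HB.instance Definition _ := [SubChoice_isSubLmodule of l2 by <:].

Lemma l2_ext (x y : l2) : (forall i, x i = y i) -> x = y.
Proof. by move=> h; apply: val_inj; apply/funext. Qed.

End Enumeration.
Arguments l2 : clear implicits.
Arguments L2 {R Y}.

Section L2Dot.
Variables (R : realType) (Y : countType).
Local Notation H := (l2 R Y).
Implicit Types (x y z : H) (n : nat) (k : R[i]).

Definition dotn x y n : R[i] := \sum_(i <- first_elements Y n) Num.conj (x i) * y i.

Let ccvg (u : nat -> R[i]) (l : R[i]) :=
  ((fun n => complex.Re (u n)) @ \oo --> complex.Re l) /\
  ((fun n => complex.Im (u n)) @ \oo --> complex.Im l).

Let ccvg_unique u l l' : ccvg u l -> ccvg u l' -> l = l'.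
Proof.
move=> [h1 h2] [h3 h4]; apply/eqP; rewrite eq_complex.
by rewrite (cvg_unique (@Rhausdorff R) h1 h3) (cvg_unique (@Rhausdorff R) h2 h4) !eqxx.
Qed.

Let ccvgD u v l l' : ccvg u l -> ccvg v l' -> ccvg (fun n => u n + v n) (l + l').
Proof.
move=> [h1 h2] [h3 h4]; split; rewrite raddfD /=.
  under eq_fun do rewrite raddfD /=.
  exact: cvgD h1 h3.
under eq_fun do rewrite raddfD /=.
exact: cvgD h2 h4.
Qed.

Let ccvgZ u l k : ccvg u l -> ccvg (fun n => k * u n) (k * l).
Proof.
move=> [h1 h2]; split.
  have -> : complex.Re (k * l) = complex.Re k * complex.Re l - complex.Im k * complex.Im l.
    by case: (k) (l) => a b [c d].
  under eq_fun => n. 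
    have -> : complex.Re (k * u n) =
      complex.Re k * complex.Re (u n) - complex.Im k * complex.Im (u n).
      by case: (k) (u n) => a b [c d].
    over.
  apply: cvgB; apply: cvgM => //; exact: cvg_cst.
have -> : complex.Im (k * l) = complex.Re k * complex.Im l + complex.Im k * complex.Re l.
  by case: (k) (l) => a b [c d].
under eq_fun => n. 
  have -> : complex.Im (k * u n) =
    complex.Re k * complex.Im (u n) + complex.Im k * complex.Re (u n).
    by case: (k) (u n) => a b [c d].
  over.
apply: cvgD; apply: cvgM => //; exact: cvg_cst.
Qed.

Let ccvg_conj u l : ccvg u l -> ccvg (fun n => Num.conj (u n)) (Num.conj l).
Proof.
move=> [h1 h2]; split.
  have -> : complex.Re (Num.conj l) = complex.Re l by case: (l).
  rewrite (_ : (fun n => complex.Re (Num.conj (u n))) = (fun n => complex.Re (u n))) //.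
  by apply/funext => n; case: (u n).
have -> : complex.Im (Num.conj l) = - complex.Im l by case: (l).
rewrite (_ : (fun n => complex.Im (Num.conj (u n))) = (fun n => - complex.Im (u n))).
  exact: cvgN.
by apply/funext => n; case: (u n).
Qed.

Let qn x n := sqsum x (first_elements Y n).

Let qn_nd x : nondecreasing_seq (qn x).
Proof.
apply/nondecreasing_seqP => n; apply: ler_sum_uniq; rewrite ?first_elements_uniq //.
  by move=> y; rewrite !mem_first_elements => /ltnW.
by move=> y; exact: csq_ge0.
Qed.

Let qn_cvg x : cvgn (qn x).
Proof.
apply: nondecreasing_is_cvgn => //.
have /asboolP[M hM] := l2_funP x.
by exists M => _ [n _ <-]; apply: hM; exact: first_elements_uniq.
Qed.

(* By polarization the partial sums of an inner product are combinations of
   bounded nondecreasing sequences, hence converge. *)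
Let Re_dotn x y n :
  complex.Re (dotn x y n) = 2^-1 * (qn (x + y) n - qn x n - qn y n).
Proof.
rewrite /dotn /qn /sqsum raddf_sum /= -!sumrB mulr_sumr; apply: eq_bigr => i _.
rewrite [X in 2^-1 * (csq X - _ - _)](_ : _ = x i + y i) //.
by case: (x i) (y i) => a b [c d]; rewrite /csq /=; field.
Qed.

Let Im_dotn x y n : complex.Im (dotn x y n) = complex.Re (dotn x (- 'i *: y) n).
Proof.
rewrite /dotn !raddf_sum /=; apply: eq_bigr => i _.
rewrite [X in _ = complex.Re (_ * X)](_ : _ = - 'i * y i) //.
by case: (x i) (y i) => a b [c d] /=; ring.
Qed.

Let Re_cvg x y : cvgn (fun n => complex.Re (dotn x y n)).
Proof.
under eq_fun do rewrite Re_dotn.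
apply: is_cvgM; first exact: is_cvg_cst.
by apply: is_cvgB; [apply: is_cvgB|]; exact: qn_cvg.
Qed.

Definition l2_dot x y : R[i] :=
  Complex (limn (fun n => complex.Re (dotn x y n))) (limn (fun n => complex.Im (dotn x y n))).

Let dotn_cvg x y : ccvg (dotn x y) (l2_dot x y).
Proof.
split; first exact: Re_cvg.
by rewrite /=; under eq_fun do rewrite Im_dotn; exact: Re_cvg.
Qed.

Let dotn_self x n : dotn x x n = (qn x n)%:C.
Proof.
rewrite /dotn /qn /sqsum rmorph_sum /=; apply: eq_bigr => i _; exact: conjM_csq.
Qed.

Let l2_dot_self x : l2_dot x x = (limn (qn x))%:C.
Proof.
apply: ccvg_unique (dotn_cvg x x) _; split => /=.
  by under eq_fun do rewrite dotn_self /=; exact: qn_cvg.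
by under eq_fun do rewrite dotn_self /=; exact: cvg_cst.
Qed.

Lemma l2_dot_psd : psd_form l2_dot.
Proof.
split=> [x y z|k x y|x y|x].
- apply: ccvg_unique (dotn_cvg _ _) _.
  rewrite (_ : dotn x (y + z) = (fun n => dotn x y n + dotn x z n)).
    exact: ccvgD.
  apply/funext => n; rewrite /dotn -big_split; apply: eq_bigr => i _.
  exact: mulrDr.
- apply: ccvg_unique (dotn_cvg _ _) _.
  rewrite (_ : dotn x (k *: y) = (fun n => k * dotn x y n)); first exact: ccvgZ.
  apply/funext => n; rewrite /dotn mulr_sumr; apply: eq_bigr => i _.
  exact: mulrCA.
- apply: ccvg_unique (dotn_cvg _ _) _.
  rewrite (_ : dotn y x = (fun n => Num.conj (dotn x y n))); first exact: ccvg_conj.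
  apply/funext => n; rewrite /dotn rmorph_sum /=; apply: eq_bigr => i _.
  by rewrite rmorphM /= conjCK mulrC.
- rewrite l2_dot_self ler0c; apply: limr_ge; first exact: qn_cvg.
  by apply: nearW => n; apply: sumr_ge0 => i _; exact: csq_ge0.
Qed.

Lemma l2_fsqE x : fsq l2_dot x = limn (qn x).
Proof. by rewrite /fsq l2_dot_self. Qed.

Lemma sqsum_le_fsq x s : uniq s -> sqsum x s <= fsq l2_dot x.
Proof.
move=> us; have [n hn] := exists_first_elements s.
rewrite l2_fsqE (@le_trans _ _ (qn x n)) //.
  by apply: ler_sum_uniq => // [|y]; [exact: first_elements_uniq|exact: csq_ge0].
by apply: nondecreasing_cvgn_le; [exact: qn_nd|exact: qn_cvg].
Qed.

Lemma fsq_le_of_sqsum x (M : R) : (forall s, uniq s -> sqsum x s <= M) ->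
  fsq l2_dot x <= M.
Proof.
move=> h; rewrite l2_fsqE; apply: limr_le; first exact: qn_cvg.
by apply: nearW => n; apply: h; exact: first_elements_uniq.
Qed.

Lemma l2_dot_eq0 x : fsq l2_dot x = 0 -> x = 0.
Proof.
move=> h; apply: l2_ext => i; apply: csq_eq0; apply/eqP.
have := @sqsum_le_fsq x [:: i] isT; rewrite h /sqsum big_seq1 => hi.
by rewrite eq_le hi csq_ge0.
Qed.

Lemma l2_dot_ext x y x' y' :
  (forall i, Num.conj (x i) * y i = Num.conj (x' i) * y' i) ->
  l2_dot x y = l2_dot x' y'.
Proof.
move=> h; rewrite /l2_dot (_ : dotn x y = dotn x' y') //.
by apply/funext => n; apply: eq_bigr => i _; exact: h.
Qed.

Lemma real_complete (u : nat -> R) :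
  (forall e : R, 0 < e ->
    exists N, forall n m, (N <= n)%N -> (N <= m)%N -> `|u n - u m| <= e) ->
  cvgn u.
Proof.
move=> cu; apply: cauchy_cvg; apply/cauchy_ballP => e e0.
have e2 : 0 < e / 2 by rewrite divr_gt0.
have [N hN] := cu _ e2.
pose U := [set a | exists2 n, (N <= n)%N & a = u n].
exists (U, U) => /=.
  by split; exists N => // n hn; exists n.
move=> [_ _] [/= [n hn ->] [m hm ->]]; rewrite -ball_normE /=.
by rewrite (le_lt_trans (hN _ _ hn hm)) // ltr_pdivrMr // ltr_pMr // ltr1n.
Qed.

Let csq_norm (w : R[i]) (e : R) : 0 <= e -> csq w <= e ^+ 2 ->
  `|complex.Re w| <= e /\ `|complex.Im w| <= e.
Proof.
move=> e0; rewrite /csq => h.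
have := sqr_ge0 (complex.Re w); have := sqr_ge0 (complex.Im w) => h1 h2.
by split; rewrite -ler_sqr ?nnegrE // real_normK ?num_real //; lra.
Qed.

Lemma l2_complete (u : nat -> H) :
  (forall e : R, 0 < e -> exists N, forall n m, (N <= n)%N -> (N <= m)%N ->
      fnorm l2_dot (u n - u m) <= e) ->
  exists l, forall e : R, 0 < e -> exists N, forall n, (N <= n)%N ->
      fnorm l2_dot (l - u n) <= e.
Proof.
move=> cu.
have cu2 (e : R) : 0 < e -> exists N, forall n m s, (N <= n)%N -> (N <= m)%N ->
    uniq s -> sqsum (l2_fun (u n - u m)) s <= e ^+ 2.
  move=> e0; have [N hN] := cu e e0; exists N => n m s hn hm us.
  rewrite (le_trans (sqsum_le_fsq _ us)) //.
  by rewrite (fsq_le l2_dot_psd _ (ltW e0)) hN.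
have cpt i : cvgn (fun n => complex.Re (u n i)) /\ cvgn (fun n => complex.Im (u n i)).
  split; apply: real_complete => e e0; have [N hN] := cu2 e e0;
    exists N => n m hn hm; have := hN n m [:: i] hn hm isT; rewrite /sqsum big_seq1;
    move=> /(csq_norm (ltW e0))[]; rewrite -[(u n - u m) i]/(u n i - u m i) !raddfB //.
pose l i : R[i] :=
  Complex (limn (fun n => complex.Re (u n i))) (limn (fun n => complex.Im (u n i))).
have lim_le n s (e : R) N : (forall m, (N <= m)%N -> sqsum (l2_fun (u m - u n)) s <= e) ->
    sqsum (fun i => l i - u n i) s <= e.
  move=> h.
  have cv : (fun m => sqsum (l2_fun (u m - u n)) s) @ \oo --> sqsum (fun i => l i - u n i) s.
    rewrite /sqsum; elim: (s) => [|i r ih].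
      by rewrite big_nil; under eq_fun do rewrite big_nil; exact: cvg_cst.
    rewrite big_cons; under eq_fun do rewrite big_cons.
    apply: cvgD ih; rewrite /csq !raddfB /= !expr2.
    have [h1 h2] := cpt i.
    have -> : (fun m => complex.Re (l2_fun (u m - u n) i) ^+ 2 +
                        complex.Im (l2_fun (u m - u n) i) ^+ 2) =
      (fun m => (complex.Re (u m i) - complex.Re (u n i)) *
                (complex.Re (u m i) - complex.Re (u n i)) +
                (complex.Im (u m i) - complex.Im (u n i)) *
                (complex.Im (u m i) - complex.Im (u n i))).
      apply/funext => m; rewrite (_ : l2_fun (u m - u n) i = u m i - u n i) //.
      by rewrite !raddfB /= !expr2.
    by apply: cvgD; apply: cvgM; apply: cvgB => //; exact: cvg_cst.
  rewrite -(cvg_lim (@Rhausdorff R) cv); apply: limr_le; first by apply/cvg_ex; eexists; exact: cv.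
  by exists N.
have l_le (e : R) : 0 < e -> exists N, forall n s, (N <= n)%N -> uniq s ->
    sqsum (fun i => l i - u n i) s <= e ^+ 2.
  move=> e0; have [N hN] := cu2 e e0; exists N => n s hn us.
  by apply: (lim_le n s _ N) => m hm; exact: hN.
have lin : l \in @square_summable R Y.
  have [N hN] := l_le 1 ltr01.
  have -> : l = (fun i => l i - u N i) + (u N : Y -> R[i]).
    by apply/funext => i; rewrite -[RHS]/(l i - u N i + u N i) subrK.
  apply: rpredD; last exact: l2_funP.
  by apply/asboolP; exists (1 ^+ 2) => s us; exact: hN.
exists (L2 l lin) => e e0; have [N hN] := l_le e e0; exists N => n hn.
rewrite -(fsq_le l2_dot_psd _ (ltW e0)); apply: fsq_le_of_sqsum => s us.
exact: hN.
Qed.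

HB.instance Definition _ := Lmodule_isHilbert.Build R (l2 R Y)
  l2_dot_psd l2_dot_eq0 l2_complete.
End L2Dot.

(** * Weighted partial permutations *)

Section PartialShift.
Variables (R : realType) (Y : countType).
Local Notation H := (l2 R Y).
Implicit Types (x y z : H) (i j : Y).
Let hdot : psd_form (dot : H -> H -> R[i]) := dot_psd.

(** The operator [f |-> th (f o s)] is a partial isometry if [th] is unimodular on
    its support and [s] injective there; [th'] and [s'] describe its adjoint. *)
Definition shift_rel (th : Y -> R[i]) (s : Y -> Y) (th' : Y -> R[i]) (s' : Y -> Y) :=
  forall i, th i != 0 ->
    [/\ csq (th i) = 1, th' (s i) = Num.conj (th i) & s' (s i) = i].

Record pshift := PShift {
  psw : Y -> R[i]; pss : Y -> Y; psw' : Y -> R[i]; pss' : Y -> Y;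
  pshiftP : shift_rel psw pss psw' pss';
  pshiftP' : shift_rel psw' pss' psw pss
}.
Definition psinv (s : pshift) : pshift := PShift (@pshiftP' s) (@pshiftP s).
Implicit Types s : pshift.

Let wfun s (f : Y -> R[i]) i : R[i] := psw s i * f (pss s i).

Let sqsum_wfun s f (r : seq Y) : uniq r -> exists2 r', uniq r' &
  sqsum (wfun s f) r = sqsum f r'.
Proof.
move=> ur; exists [seq pss s i | i <- r & psw s i != 0].
  rewrite map_inj_in_uniq ?filter_uniq // => i j; rewrite !mem_filter.
  case/andP=> hi _ /andP[hj _] ij.
  by have [_ _ <-] := pshiftP hi; have [_ _ <-] := pshiftP hj; rewrite ij.
rewrite /sqsum big_map big_filter [LHS](bigID (fun i => psw s i != 0)) /=.
rewrite [X in _ + X]big1 ?addr0 => [|i]; last first.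
  by rewrite negbK /wfun => /eqP ->; rewrite mul0r csq0.
by apply: eq_bigr => i /pshiftP[h _ _]; rewrite /wfun csqM h mul1r.
Qed.

Let wfun_in s x : wfun s x \in @square_summable R Y.
Proof.
have /asboolP[M hM] := l2_funP x; apply/asboolP; exists M => r ur.
by have [r' ur' ->] := sqsum_wfun s x ur; exact: hM.
Qed.
Definition wop s x : H := L2 (wfun s x) (wfun_in s x).

Lemma wopE s x i : wop s x i = psw s i * x (pss s i). Proof. by []. Qed.

Lemma wop_fsq_le s x : fsq dot (wop s x) <= fsq dot x.
Proof.
apply: fsq_le_of_sqsum => r ur; have [r' ur' ->] := sqsum_wfun s x ur.
exact: sqsum_le_fsq.
Qed.

Lemma wop_bound s : op_bound (wop s) 1.
Proof.
split=> // x; rewrite mul1r /fnorm ler_sqrt ?(fsq_ge0 hdot) //.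
exact: wop_fsq_le.
Qed.

Lemma wop_linear s : linear (wop s).
Proof.
move=> k x y; apply: l2_ext => i; rewrite wopE.
rewrite -[RHS]/(k * (psw s i * x (pss s i)) + psw s i * y (pss s i)).
by rewrite -[(k *: x + y) _]/(k * x (pss s i) + y (pss s i)); ring.
Qed.

Let polarization (S T : H -> H) : linear S -> linear T ->
  (forall x, fsq dot (S x) = fsq dot (T x)) ->
  forall x y, dot (S x) (S y) = dot (T x) (T y).
Proof.
move=> Sl Tl h x y.
have hRe z : complex.Re (dot (S x) (S z)) = complex.Re (dot (T x) (T z)).
  have := h (1 *: x + z); rewrite Sl Tl !scale1r !(fsqD hdot) !h.
  by move=> /addIr/addrI/(mulfI _); apply; rewrite pnatr_eq0.
apply/eqP; rewrite eq_complex hRe eqxx andTb; apply/eqP.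
have := hRe (- 'i *: y); rewrite (linear_funZ Sl) (linear_funZ Tl) !(psdZr hdot).
case: (dot (S x) (S y)) => a b; case: (dot (T x) (T y)) => c d /=; lra.
Qed.

Let wopK s x i : psw s i != 0 -> wop s (wop (psinv s) x) i = x i.
Proof.
move=> hi; have [h1 h2 h3] := pshiftP hi.
by rewrite !wopE /= h2 h3 mulrA (mulrC (psw s i)) conjM_csq h1 mul1r.
Qed.

Let wopKw s x : wop s (wop (psinv s) (wop s x)) = wop s x.
Proof.
apply: l2_ext => i; have [h|h] := eqVneq (psw s i) 0; last exact: wopK.
by rewrite !wopE h !mul0r.
Qed.

Let wopK' s x i : psw' s i != 0 -> wop (psinv s) (wop s x) i = x i.
Proof.
move=> hi; have [h1 h2 h3] := pshiftP' hi.
by rewrite !wopE /= h2 h3 mulrA (mulrC (psw' s i)) conjM_csq h1 mul1r.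
Qed.

Let wopKw' s x : wop (psinv s) (wop s (wop (psinv s) x)) = wop (psinv s) x.
Proof.
apply: l2_ext => i; have [h|h] := eqVneq (psw' s i) 0; last exact: wopK'.
by rewrite !wopE /= h !mul0r.
Qed.

(** Both [wop s] and its partner have norm at most 1, so [wop s] is isometric on
    the range of the partner and, by polarization, preserves the inner product
    there. The general case follows because [x] and [y] may be projected onto
    the supports of the two weights. *)
Lemma wop_adjoint s : adjoint (wop s) (wop (psinv s)).
Proof.
move=> x y.
have iso z : fsq dot (wop s (wop (psinv s) z)) = fsq dot (wop (psinv s) z).
  apply/eqP; rewrite eq_le wop_fsq_le /=.
  by have := wop_fsq_le (psinv s) (wop s (wop (psinv s) z)); rewrite wopKw'.
have lin : linear (fun z => wop s (wop (psinv s) z)).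
  by move=> k a b; rewrite !wop_linear.
have -> : dot (wop s x) y = dot (wop s x) (wop s (wop (psinv s) y)).
  apply: l2_dot_ext => i; have [h|h] := eqVneq (psw s i) 0; last by rewrite wopK.
  by rewrite !wopE h !mul0r rmorph0 !mul0r.
rewrite -{1}wopKw (polarization lin (@wop_linear (psinv s)) iso).
apply: l2_dot_ext => i; have [h|h] := eqVneq (psw' s i) 0.
  by rewrite [wop (psinv s) y i]wopE /= h !mul0r !mulr0.
by rewrite wopK'.
Qed.

Let sqsum_delta i (r : seq Y) : uniq r ->
  sqsum (fun j => (j == i)%:R : R[i]) r <= 1.
Proof.
move=> ur; rewrite /sqsum (bigID (pred1 i)) /= [X in _ + X]big1 ?addr0; last first.
  by move=> j /negbTE ->; rewrite csq0.
have [ir|ir] := boolP (i \in r); last first.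
  by rewrite big1_seq ?ler01 // => j /andP[/eqP ->]; rewrite (negbTE ir).
rewrite (big_rem _ ir) /= eqxx big1_seq ?addr0.
  by rewrite (csqR 1) expr1n.
by move=> j /andP[/eqP ->]; rewrite mem_rem_uniqF.
Qed.

Let delta_in i : (fun j => (j == i)%:R) \in @square_summable R Y.
Proof. by apply/asboolP; exists 1; exact: sqsum_delta. Qed.
Definition delta i : H := L2 _ (delta_in i).

Lemma deltaE i j : delta i j = (j == i)%:R. Proof. by []. Qed.

Lemma wop_delta s i : psw' s i != 0 ->
  wop s (delta i) = psw s (pss' s i) *: delta (pss' s i).
Proof.
move=> hi; apply: l2_ext => j; rewrite wopE -[RHS]/(psw s (pss' s i) * delta (pss' s i) j).
rewrite !deltaE; have [h1 h2 h3] := pshiftP' hi.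
have [->|ji] := eqVneq j (pss' s i); first by rewrite h3 eqxx.
rewrite mulr0; have [->|hj] := eqVneq (psw s j) 0; first by rewrite mul0r.
have [_ _ h4] := pshiftP hj.
by rewrite (_ : _ == i = false) ?mulr0 //; apply: contra_neqF ji => /eqP <-.
Qed.

Lemma fnorm_delta i : fnorm dot (delta i) = 1.
Proof.
rewrite /fnorm (_ : fsq _ _ = 1) ?sqrtr1 //; apply/eqP; rewrite eq_le.
apply/andP; split.
  by apply: fsq_le_of_sqsum => r; exact: sqsum_delta.
have := @sqsum_le_fsq R Y (delta i) [:: i] isT.
by rewrite /sqsum big_seq1 deltaE eqxx (csqR 1) expr1n.
Qed.
End PartialShift.

(** * Twisted pairs of isometries with prescribed unitary and projection *)

Section Words.
Variables (R : realType) (A B : unitalCStarAlgType R).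
Implicit Types (s a b : A).

(** Let [e] be the projection onto the orthogonal of the range of [s1 s2]. Then
    [corner_unitary] is [e s2 e + e s1^* e], a unitary of the corner of [e], and
    [corner_projection] is the projection onto the range of [e s2 e]. *)
Definition corner_unitary (A : unitalCStarAlgType R) (s1 s2 : A) : A :=
  s2 * (1 - s1 * s1^#) + (1 - s2 * s2^#) * s1^#.
Definition corner_projection (A : unitalCStarAlgType R) (s1 s2 : A) : A :=
  s2 * (1 - s1 * s1^#) * s2^#.
Definition corner_symmetry (A : unitalCStarAlgType R) (s1 s2 : A) : A :=
  corner_projection s1 s2 + corner_projection s1 s2 - 1.
(** On the corner, [u^-n (2 p - 1) u^n]. *)
Fixpoint corner_conj (A : unitalCStarAlgType R) (s1 s2 : A) (n : nat) : A :=
  if n is n'.+1 then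
    (corner_unitary s1 s2)^# * corner_conj s1 s2 n' * corner_unitary s1 s2
  else corner_symmetry s1 s2.

Lemma corner_conj_hom (f : {linear A -> B}) (s1 s2 : A) n : unital_star_hom f ->
  f (corner_conj s1 s2 n) = corner_conj (f s1) (f s2) n.
Proof.
move=> [f1 fM fS].
have fM' x y : f (x * y) = f x * f y by exact: fM.
have f1' : f 1 = 1 by exact: f1.
have fD x y : f (x + y) = f x + f y by exact: raddfD.
have fB x y : f (x - y) = f x - f y by exact: raddfB.
have fu : f (corner_unitary s1 s2) = corner_unitary (f s1) (f s2).
  by rewrite /corner_unitary !(fB, fD, fM', f1', fS).
elim: n => [|n ih] /=.
  by rewrite /corner_symmetry /corner_projection !(fB, fD, fM', f1', fS).
by rewrite !fM' fS fu ih.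
Qed.

Lemma corner_unitary_star (s1 s2 : A) : (corner_unitary s1 s2)^# =
  (1 - s1 * s1^#) * s2^# + s1 * (1 - s2 * s2^#).
Proof. by rewrite /corner_unitary starD !starM starK !starB star1 !starM !starK. Qed.

Lemma nrm_projection_le1 a : a^# = a -> a * a = a -> nrm a <= 1.
Proof.
move=> asa aa; have := nrm_starM a; rewrite asa aa.
have := nrm_ge0 a; nra.
Qed.

Lemma nrm_le1_of_starM a : nrm (a^# * a) <= 1 -> nrm a <= 1.
Proof. by rewrite nrm_starM; have := nrm_ge0 a; nra. Qed.

Section Isometries.
Variables s1 s2 : A.
Hypotheses (i1 : s1^# * s1 = 1) (i2 : s2^# * s2 = 1).

Lemma range_projectionP s : s^# * s = 1 -> exists f : A,
  [/\ f = 1 - s * s^#, f^# = f, f * f = f, f * s = 0 & s^# * f = 0].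
Proof.
move=> i; exists (1 - s * s^#).
have fs : (1 - s * s^#) * s = 0 by rewrite mulrBl mul1r -mulrA i mulr1 subrr.
have fsa : (1 - s * s^#)^# = 1 - s * s^# by rewrite starB star1 starM starK.
split=> //; last by rewrite -fsa -starM fs star0.
by rewrite mulrBr mulr1 mulrA fs mul0r subr0.
Qed.

Lemma nrm_corner_conj n : nrm (corner_conj s1 s2 n) <= 1.
Proof.
have [f1 [f1E f1sa f1f1 f1s1 s1f1]] := range_projectionP i1.
have [f2 [f2E f2sa f2f2 f2s2 s2f2]] := range_projectionP i2.
elim: n => [|n ih] /=.
  apply: nrm_le1_of_starM.
  have [p pE] : exists p, p = corner_projection s1 s2 by eexists.
  have psa : p^# = p by rewrite pE /corner_projection -f1E !starM starK f1sa mulrA.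
  have pp : p * p = p.
    rewrite pE /corner_projection -f1E -!mulrA (mulrA s2^# s2) i2 mul1r.
    by rewrite (mulrA f1) f1f1.
  rewrite /corner_symmetry -pE starB starD psa star1.
  rewrite (_ : _ * _ = 1); first exact: nrm1_le.
  by rewrite !(mulrDl, mulrDr, mulrN, mulNr, mulr1, mul1r) pp; star_algebra R A.
have u1 : nrm (corner_unitary s1 s2) <= 1.
  apply: nrm_le1_of_starM.
  have uu : (corner_unitary s1 s2)^# * corner_unitary s1 s2 = f1 + s1 * f2 * s1^#.
    rewrite /corner_unitary -f1E -f2E starD !starM f1sa f2sa starK.
    rewrite mulrDl !mulrDr -!mulrA (mulrA s2^# s2) i2 mul1r f1f1.
    rewrite (mulrA s2^# f2) s2f2 !mul0r mulr0 addr0.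
    by rewrite (mulrA f2 s2) f2s2 mul0r mulr0 add0r (mulrA f2 f2) f2f2.
  rewrite uu; apply: nrm_projection_le1.
    by rewrite starD !starM starK f1sa f2sa mulrA.
  rewrite mulrDl !mulrDr f1f1 !mulrA f1s1 !mul0r addr0.
  rewrite -(mulrA _ s1^# f1) s1f1 mulr0 add0r -(mulrA _ s1^# s1) i1 mulr1.
  by rewrite -(mulrA s1 f2) f2f2.
rewrite (le_trans (nrmM _ _)) // -[leRHS]mulr1 ler_pM ?nrm_ge0 //.
rewrite (le_trans (nrmM _ _)) // -[leRHS]mulr1 ler_pM ?nrm_ge0 //.
by rewrite nrm_star.
Qed.
End Isometries.
End Words.

Section Model.
Variables (R : realType) (C : unitalCStarAlgType R) (q : R[i]).
Hypothesis hq : `|q| = 1.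
Variables S D U P Q : C.
Hypotheses (SS : S^# * S = 1) (DD : D^# * D = 1) (DD' : D * D^# = 1).
Hypotheses (UU : U^# * U = 1) (UU' : U * U^# = 1).
Hypotheses (PP : P * P = P) (Psa : P^# = P) (QE : Q = 1 - P).
Hypotheses (DS : D * S = q *: (S * D)).
Hypotheses (US : U * S = S * U) (UD : U * D = D * U).
Hypotheses (PS : P * S = S * P) (PD : P * D = D * P).

(** The powers of [S] move the corner, where [S^*] vanishes and [D = 1], through the
    levels of the space. On level 0 the isometries are [U^* Q + U^* P S] and
    [P U + q Q U S]; the rest is dictated by the relations of the pair, which imply
    that [s1 S = q^-1 S s1] and [s2 S = q S s2] for [S = s1 s2]. As [D] is [q^k]
    on level [k], it carries these powers of [q]. *)
Definition model1 : C := U^# * (Q + P * S) * D^#.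
Definition model2 : C := (P + q *: (Q * S)) * U * D.

Let qq : Num.conj q * q = 1.
Proof. by rewrite mulrC -normCK hq expr1n. Qed.
Let PQ : P * Q = 0. Proof. by rewrite QE mulrBr mulr1 PP subrr. Qed.
Let QP : Q * P = 0. Proof. by rewrite QE mulrBl mul1r PP subrr. Qed.
Let QQ : Q * Q = Q. Proof. by rewrite {2}QE mulrBr mulr1 QP subr0. Qed.
Let PQ1 : P + Q = 1. Proof. by rewrite QE addrC subrK. Qed.
Let Qsa : Q^# = Q. Proof. by rewrite QE starB star1 Psa. Qed.
Let QS : Q * S = S * Q.
Proof. by rewrite QE mulrBl mulrBr PS mul1r mulr1. Qed.
Let QD : Q * D = D * Q.
Proof. by rewrite QE mulrBl mulrBr PD mul1r mulr1. Qed.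
Let starcomm (a b : C) : a * b = b * a -> b^# * a^# = a^# * b^#.
Proof. by move=> ab; rewrite -starM ab starM. Qed.
Let unitary_comm (a w : C) :
  w^# * w = 1 -> w * w^# = 1 -> a * w = w * a -> a * w^# = w^# * a.
Proof.
by move=> h1 h2 aw; rewrite -[LHS]mul1r -h1 -mulrA (mulrA w a) -aw -!mulrA h2 mulr1.
Qed.
Let SD' : D^# * S = Num.conj q *: (S * D^#).
Proof.
have -> : S * D^# = D^# * (D * S) * D^# by rewrite mulrA DD mul1r.
by rewrite DS mulZr mulZl scalerA qq scale1r -!mulrA DD' mulr1.
Qed.
Let PD' : P * D^# = D^# * P. Proof. exact: unitary_comm. Qed.
Let QD' : Q * D^# = D^# * Q. Proof. exact: unitary_comm. Qed.
Let SU' : S * U^# = U^# * S. Proof. by apply: unitary_comm. Qed.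

Lemma model_mul12 : model1 * model2 = S.
Proof.
rewrite /model1 /model2.
have e1 : D^# * (P + q *: (Q * S)) * D = P + Q * S.
  have a : D^# * (Q * S) = Num.conj q *: (Q * S * D^#).
    by rewrite mulrA -QD' -(mulrA Q) SD' mulZr mulrA.
  by rewrite mulrDr mulZr a scalerA (mulrC q) qq scale1r -PD' -mulrDl -mulrA DD mulr1.
have e2 : (Q + P * S) * (P + Q * S) = S.
  rewrite mulrDl !mulrDr QP (mulrA Q Q) QQ add0r -(mulrA P S) -PS (mulrA P P) PP.
  rewrite -(mulrA P S) (mulrA S Q) -QS -(mulrA Q) (mulrA P Q) PQ mul0r addr0.
  by rewrite -mulrDl addrC PQ1 mul1r.
have -> : U^# * (Q + P * S) * D^# * ((P + q *: (Q * S)) * U * D) =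
    U^# * (Q + P * S) * (D^# * (P + q *: (Q * S)) * D) * U.
  by rewrite -!mulrA UD.
by rewrite e1 -(mulrA U^#) e2 -SU' -mulrA UU mulr1.
Qed.

Lemma model_mul21 : model2 * model1 = q *: S.
Proof.
rewrite /model1 /model2.
have e1 : D * (Q + P * S) * D^# = Q + q *: (P * S).
  rewrite mulrDr mulrDl -QD -(mulrA Q) DD' mulr1 (mulrA D) -PD -(mulrA P) DS.
  by rewrite mulZr mulZl -!mulrA DD' mulr1.
have e2 : (P + q *: (Q * S)) * (Q + q *: (P * S)) = q *: S.
  rewrite mulrDl !mulrDr PQ add0r mulZr (mulrA P P) PP !mulZl mulZr.
  rewrite -(mulrA Q S Q) -QS (mulrA Q Q) QQ.
  rewrite -(mulrA Q S) (mulrA S P) -PS -(mulrA P) (mulrA Q P) QP mul0r !scaler0 addr0.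
  by rewrite -scalerDr -mulrDl PQ1 mul1r.
have -> : (P + q *: (Q * S)) * U * D * (U^# * (Q + P * S) * D^#) =
    (P + q *: (Q * S)) * (D * (Q + P * S) * D^#).
  by rewrite -!mulrA (mulrA U D) UD -!mulrA (mulrA U) UU' mul1r.
by rewrite e1 e2.
Qed.

Lemma model_twisted : twisted_isometries q model1 model2.
Proof.
have SP : S^# * P = P * S^# by rewrite -{1}Psa starcomm // Psa.
have SQ : S^# * Q = Q * S^# by rewrite -{1}Qsa starcomm // Qsa.
have MM : (Q + P * S)^# * (Q + P * S) = 1.
  rewrite starD starM Qsa Psa mulrDl !mulrDr QQ (mulrA Q) QP mul0r addr0.
  rewrite -!mulrA PQ mulr0 add0r (mulrA P P) PP PS mulrA SS mul1r.
  by rewrite addrC.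
have NN : (P + q *: (Q * S))^# * (P + q *: (Q * S)) = 1.
  rewrite starD starZ starM Qsa Psa mulrDl !mulrDr PP mulZr (mulrA P) PQ mul0r.
  rewrite scaler0 addr0 mulZl -mulrA QP mulr0 scaler0 add0r mulZl mulZr scalerA qq.
  by rewrite scale1r -mulrA (mulrA Q Q) QQ QS mulrA SS mul1r.
split.
- rewrite /isometry_elt cmulE /model1 !starM !starK -!mulrA.
  by rewrite (mulrA U) UU' mul1r (mulrA _ _ D^#) MM mul1r DD'.
- rewrite /isometry_elt cmulE /model2 !starM -!mulrA.
  by rewrite (mulrA _ _ (U * D)) NN mul1r (mulrA U^#) UU mul1r DD.
- by rewrite !cmulE model_mul12 model_mul21.
Qed.

Definition level0 (y : C) := S^# * y = 0 /\ D * y = y.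

Let S'U : S^# * U = U * S^#.
Proof. by rewrite -[U in RHS]starK -starM SU' starM starK. Qed.
Let S'U' : S^# * U^# = U^# * S^#. Proof. by rewrite -!starM US. Qed.
Let S'P : S^# * P = P * S^#. Proof. by rewrite -{1}Psa starcomm // Psa. Qed.
Let DU' : D * U^# = U^# * D. Proof. by apply: unitary_comm. Qed.

Lemma level0U y : level0 y -> level0 (U * y).
Proof.
by move=> [h1 h2]; split; rewrite mulrA ?S'U -?UD -mulrA ?h1 ?h2 ?mulr0.
Qed.
Lemma level0U' y : level0 y -> level0 (U^# * y).
Proof.
by move=> [h1 h2]; split; rewrite mulrA ?S'U' ?DU' -mulrA ?h1 ?h2 ?mulr0.
Qed.
Lemma level0P y : level0 y -> level0 (P * y).
Proof.
by move=> [h1 h2]; split; rewrite mulrA ?S'P -?PD -mulrA ?h1 ?h2 ?mulr0.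
Qed.
Lemma level0B x y : level0 x -> level0 y -> level0 (x - y).
Proof.
by move=> [h1 h2] [h3 h4]; split; rewrite mulrBr ?h1 ?h2 ?h3 ?h4 ?subrr.
Qed.
Lemma level0D x y : level0 x -> level0 y -> level0 (x + y).
Proof.
by move=> [h1 h2] [h3 h4]; split; rewrite mulrDr ?h1 ?h2 ?h3 ?h4 ?addr0.
Qed.
Lemma level0X n y : level0 y -> level0 (U ^+ n * y).
Proof. by elim: n => [|n ih] hy; rewrite ?mul1r // exprS -mulrA; exact/level0U/ih. Qed.
Lemma level0X' n y : level0 y -> level0 (U^# ^+ n * y).
Proof. by elim: n => [|n ih] hy; rewrite ?mul1r // exprS -mulrA; exact/level0U'/ih. Qed.
Lemma level0Q y : level0 y -> level0 (Q * y).
Proof. by move=> hy; rewrite QE mulrBl mul1r; apply: level0B => //; exact: level0P. Qed.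

Let model_star1 y : level0 y -> model1^# * y = Q * (U * y).
Proof.
move=> hy; have [_ d] := level0Q (level0U hy); have [s _] := level0P (level0U hy).
rewrite /model1 !starM !starK starD starM Qsa Psa -!mulrA mulrDl mulrDr d.
by rewrite -(mulrA S^#) s mulr0 addr0.
Qed.
Let model_star2 y : level0 y -> model2^# * y = U^# * (P * y).
Proof.
move=> hy; have [s _] := level0Q hy; have [_ d] := level0U' (level0P hy).
rewrite /model2 !starM starD starZ starM Qsa Psa -!mulrA mulrDl mulZl -(mulrA S^#) s.
by rewrite scaler0 addr0 -[X in D^# * X]d !mulrA DD mul1r.
Qed.
Let model_act1 y : level0 y -> model1 * y = U^# * (Q * y) + U^# * (P * (S * y)).
Proof.
move=> [_ d].
have -> : model1 * y = U^# * ((Q + P * S) * (D^# * (D * y))).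
  by rewrite d /model1 !mulrA.
rewrite (mulrA D^#) DD mul1r.
by rewrite mulrDl mulrDr -mulrA.
Qed.
Let model_act2 y : level0 y -> model2 * y = P * (U * y) + q *: (Q * (S * (U * y))).
Proof.
by move=> [_ d]; rewrite /model2 -!mulrA d mulrDl mulZl -mulrA.
Qed.
(* The computations on level 0 use the isometries only through their action
   there, and are made for any pair with this action: unlike [model1] and
   [model2], such variables are not unfolded by rewriting. *)
Section Corner.
Variables V1 V2 : C.
Hypothesis V1star : forall y, level0 y -> V1^# * y = Q * (U * y).
Hypothesis V2star : forall y, level0 y -> V2^# * y = U^# * (P * y).
Hypothesis V1act : forall y, level0 y -> V1 * y = U^# * (Q * y) + U^# * (P * (S * y)).
Hypothesis V2act : forall y, level0 y -> V2 * y = P * (U * y) + q *: (Q * (S * (U * y))).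

Let range1 y : level0 y -> (1 - V1 * V1^#) * y = U^# * (P * (U * y)).
Proof.
move=> hy; rewrite mulrBl mul1r -mulrA V1star // V1act; last exact/level0Q/level0U.
rewrite (mulrA Q Q) QQ (mulrA S Q) -QS -(mulrA Q S) (mulrA P Q) PQ mul0r mulr0 addr0.
by rewrite QE mulrBl mul1r mulrBr (mulrA U^# U) UU mul1r opprB addrC subrK.
Qed.
Let range2 y : level0 y -> (1 - V2 * V2^#) * y = Q * y.
Proof.
move=> hy; rewrite mulrBl mul1r -mulrA V2star // V2act; last exact/level0U'/level0P.
rewrite !(mulrA U U^#) UU' !mul1r (mulrA P P) PP (mulrA S P) -PS -(mulrA P S).
by rewrite (mulrA Q P) QP mul0r scaler0 addr0 QE mulrBl mul1r.
Qed.

Let unitaryE y : level0 y -> corner_unitary V1 V2 * y = U * y.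
Proof.
move=> hy; rewrite /corner_unitary mulrDl -!mulrA range1 // V1star //.
rewrite range2; last exact/level0Q/level0U.
rewrite V2act; last exact/level0U'/level0P/level0U.
rewrite !(mulrA U U^#) UU' !mul1r (mulrA P P) PP (mulrA S P) -PS -(mulrA P S).
rewrite (mulrA Q P) QP mul0r scaler0 addr0 (mulrA Q Q) QQ -mulrDl PQ1 mul1r //.
Qed.
Let unitary'E y : level0 y -> (corner_unitary V1 V2)^# * y = U^# * y.
Proof.
move=> hy; rewrite corner_unitary_star mulrDl -!mulrA V2star // range2 //.
rewrite range1; last exact/level0U'/level0P.
rewrite V1act; last exact: level0Q.
rewrite !(mulrA U U^#) UU' !mul1r (mulrA P P) PP (mulrA Q Q) QQ (mulrA S Q) -QS.
by rewrite -(mulrA Q S) (mulrA P Q) PQ mul0r mulr0 addr0 -mulrDr -mulrDl PQ1 mul1r.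
Qed.
Let projectionE y : level0 y -> corner_projection V1 V2 * y = P * y.
Proof.
move=> hy; rewrite /corner_projection -!mulrA V2star // range1; last exact/level0U'/level0P.
rewrite !(mulrA U U^#) UU' !mul1r (mulrA P P) PP V2act; last exact/level0U'/level0P.
rewrite !(mulrA U U^#) UU' !mul1r (mulrA P P) PP (mulrA S P) -PS -(mulrA P S).
by rewrite (mulrA Q P) QP mul0r scaler0 addr0.
Qed.

Lemma corner_conj_level0 n y : level0 y ->
  corner_conj V1 V2 n * y = U^# ^+ n * ((P + P - 1) * (U ^+ n * y)).
Proof.
elim: n y => [|n ih] y hy /=.
  by rewrite !expr0 !mul1r /corner_symmetry !mulrBl !mulrDl projectionE.
rewrite -!mulrA unitaryE // ih; last exact: level0U.
rewrite (mulrA (U ^+ n)) -exprSr unitary'E ?[RHS]mulrA ?exprS ?mulrA //.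
rewrite -!mulrA; apply: level0X'; rewrite mulrBl mul1r mulrDl mulrA -exprS.
have hz := level0X n.+1 hy.
by apply: level0B => //; apply: level0D; exact: level0P.
Qed.
End Corner.

Theorem twisted_model : exists V1 V2 : C, twisted_isometries q V1 V2 /\
  forall n y, level0 y -> corner_conj V1 V2 n ** y =
    iter n (cmul U^#) ((P + P - cone) ** iter n (cmul U) y).
Proof.
exists model1, model2; split; first exact: model_twisted.
move=> n y hy; have powE (a z : C) : iter n (cmul a) z = a ^+ n * z.
  by elim: n => [|m ih]; rewrite ?mul1r //= ih cmulE exprS mulrA.
by rewrite !powE; apply: corner_conj_level0.
Qed.
End Model.

(** * The spatial norm of a paradoxical sum *)

Section Absorbing.
Variables (R : realType) (A : unitalCStarAlgType R) (a : A).
Lemma cmul0x : 0 ** a = 0. Proof. exact: mul0r. Qed.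
Lemma cmulx0 : a ** 0 = 0. Proof. exact: mulr0. Qed.
End Absorbing.

Section Column.
Variables (R : realType) (A : unitalCStarAlgType R) (H : hilbertType R).
Implicit Types (a : A) (c d : R).
Let hdot : psd_form (dot : H -> H -> R[i]) := dot_psd.

Definition no_operators : star_set H :=
  StarSet (fun V (h : set0 V) => False_ind _ h).
Local Notation D := (commutant no_operators).

Definition family_tensor (SS : star_set H) (n : nat) (x : 'I_n -> A)
  (y : 'I_n -> commutant SS) : seq (A * commutant SS) :=
  [seq (x i, y i) | i <- enum 'I_n].

Lemma spatial_le1 n (x : 'I_n -> A) (y : 'I_n -> D) :
  (forall i, nrm (x i) <= 1) -> (forall i, opnorm (y i) <= 1) ->
  spatial_bound (family_tensor x y) n%:R.
Proof.
move=> hx hy; rewrite /family_tensor.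
suff h (s : seq 'I_n) : spatial_bound [seq (x i, y i) | i <- s] (size s)%:R.
  by have := h (enum 'I_n); rewrite size_enum_ord.
elim: s => [|i s ih].
  split=> //= xi; rewrite tact_nil gram0l expr0n scale0r subr0.
  exact: cpos0.
rewrite /= -cat1s -addn1 addnC natrD; apply: spatial_add => //.
apply: spatial_mono (spatial_bound1 (x i) (y i)).
by rewrite -[leRHS]mulr1 ler_pM ?nrm_ge0 ?opnorm_ge0.
Qed.

(** If [t] is this tensor, [t^* t] is the sum of the [x_i^* x_i (x) y_i^* y_i],
    which has norm at most [n]. *)
Lemma column_bound n (x : 'I_n -> A) (y : 'I_n -> D) : (0 < n)%N ->
  (forall i, nrm (x i) <= 1) -> (forall i, opnorm (y i) <= 1) ->
  (forall i j, i != j -> (y i)^# ** y j = 0) ->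
  spatial_bound (family_tensor x y) (Num.sqrt n%:R).
Proof.
move=> n0 hx hy ho; apply: spatial_star; first by rewrite sqrtr_gt0 ltr0n.
rewrite sqr_sqrtr ?ler0n //.
pose x' i : A := (x i)^# ** x i; pose y' i : D := (y i)^# ** y i.
have h : spatial_bound (family_tensor x' y') n%:R.
  apply: spatial_le1 => i.
    rewrite /x' cmulE nrm_starM; have := hx i; have := nrm_ge0 (x i); nra.
  rewrite /y' (opnorm_starM (y i)); have := hy i; have := opnorm_ge0 (y i); nra.
apply: spatial_compat h => V f; rewrite /family_tensor /tensor_mul /tensor_star.
rewrite [RHS]big_allpairs_dep !big_map; apply: eq_bigr => i _ /=.
rewrite big_map (bigD1_seq i) ?mem_enum ?enum_uniq //= big1 ?addr0 // => j ji.
by rewrite ho 1?eq_sym // linear0r.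
Qed.

Lemma spatial_bound_star (t : seq (A * D)) c :
  spatial_bound (tensor_star t) c -> spatial_bound t c.
Proof.
move=> hc.
have B := spatial_tensor_bound A no_operators.
have G := tb_gauge B.
apply: (bound_mono G) (gaugeP G t).
apply: le_trans (gauge_le G hc).
have sq := gauge_cstar G (tb_mul B) (@tensor_starK _ _ _) (tb_star B) t.
have := gauge_le G (tb_mul B (gaugeP G (tensor_star t)) (gaugeP G t)).
have := gauge_ge0 G t; have := gauge_ge0 G (tensor_star t); rewrite sq; nra.
Qed.

(** The first half of [b i = Q i ** b i + b i ** Q i] gives a column and the second
    one a row, that is, the adjoint of a column. *)
Theorem paradoxical_bound n (x : 'I_n -> A) (b Q : 'I_n -> D) : (0 < n)%N ->
  (forall i, nrm (x i) <= 1) -> (forall i, opnorm (b i) <= 1) ->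
  (forall i, opnorm (Q i) <= 1) -> (forall i, (Q i)^# = Q i) ->
  (forall i j, i != j -> Q i ** Q j = 0) ->
  (forall i, b i = Q i ** b i + b i ** Q i) ->
  spatial_bound (family_tensor x b) (Num.sqrt n%:R + Num.sqrt n%:R).
Proof.
move=> n0 hx hb hQ Qsa QQ bE.
have le1 (S T : D) : opnorm S <= 1 -> opnorm T <= 1 -> opnorm (S ** T) <= 1.
  move=> h1 h2; apply: le_trans (opnormM S T) _.
  by rewrite -[leRHS]mulr1 ler_pM ?opnorm_ge0.
have h1 : spatial_bound (family_tensor x (fun i => Q i ** b i)) (Num.sqrt n%:R).
  apply: column_bound => // [i|i j ij]; first exact: le1.
  by rewrite cstarM Qsa -cmulA (cmulA (Q i)) QQ // cmul0x cmulx0.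
have h2 : spatial_bound (family_tensor x (fun i => b i ** Q i)) (Num.sqrt n%:R).
  apply: spatial_bound_star.
  have -> : tensor_star (family_tensor x (fun i => b i ** Q i)) =
      family_tensor (fun i => (x i)^#) (fun i => Q i ** (b i)^#).
    rewrite /tensor_star /family_tensor -map_comp; apply: eq_map => i /=.
    by rewrite cstarM Qsa.
  apply: column_bound => // [i|i|i j ij]; first by rewrite nrm_star.
    by apply: le1 => //; rewrite (opnorm_star (b i)).
  by rewrite cstarM Qsa -cmulA (cmulA (Q i)) QQ // cmul0x cmulx0.
apply: spatial_compat (spatial_add h1 h2) => V f.
rewrite big_cat /= /family_tensor !big_map -big_split; apply: eq_bigr => i _ /=.
by rewrite [in RHS](bE i) linearDr.
Qed.

(** The bound depends only on the action on [H]. It is proved among all bounded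
    operators, as the projections [Q i] are not in the commutant of interest. *)
Lemma spatial_bound_forget (SS : star_set H) n (x : 'I_n -> A)
    (y : 'I_n -> commutant SS) (z : 'I_n -> D) c :
  (forall i u, y i u = z i u) ->
  spatial_bound (family_tensor x z) c -> spatial_bound (family_tensor x y) c.
Proof.
move=> yz [c0 hc]; split=> // xi.
suff -> : tact (family_tensor x y) xi = tact (family_tensor x z) xi by [].
rewrite /tact /family_tensor !allpairs_mapl; apply: eq_allpairs => i u.
by rewrite /tact1 /= yz.
Qed.
End Column.

(** * Reduced words and the operators on them *)

Section ReducedWords.
Local Notation letter := 'I_5.
Implicit Types (i j : letter).

Definition reduced (w : seq letter) := sorted (fun a b : letter => a != b) w.

Definition lmul i (w : seq letter) :=
  if w is a :: w' then if a == i then w' else i :: w else [:: i].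
Definition rmul j (w : seq letter) := rev (lmul j (rev w)).

Lemma reduced_rev (w : seq letter) : reduced (rev w) = reduced w.
Proof. by rewrite /reduced rev_sorted; apply: eq_sorted => a b; rewrite eq_sym. Qed.

Lemma lmul_reduced i (w : seq letter) : reduced w -> reduced (lmul i w).
Proof.
case: w => [|a w] //= hw; case: eqVneq => [_|ai]; first exact: path_sorted hw.
by rewrite /= eq_sym ai.
Qed.

Lemma rmul_reduced j (w : seq letter) : reduced w -> reduced (rmul j w).
Proof. by move=> hw; rewrite reduced_rev lmul_reduced // reduced_rev. Qed.

Lemma lmulK i (w : seq letter) : reduced w -> lmul i (lmul i w) = w.
Proof.
case: w => [|a w] /=; first by rewrite eqxx.
case: eqVneq => [->|ai _] /=; last by rewrite eqxx.
by case: w => [|b w] //= /andP[ib _]; rewrite eq_sym (negbTE ib).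
Qed.

Lemma rmulK j (w : seq letter) : reduced w -> rmul j (rmul j w) = w.
Proof. by move=> hw; rewrite /rmul revK lmulK ?reduced_rev // revK. Qed.

Lemma rmul_rcons j (w : seq letter) b :
  rmul j (rcons w b) = if b == j then w else rcons (rcons w b) j.
Proof.
by rewrite /rmul rev_rcons /=; case: eqP => _; rewrite ?rev_cons ?revK.
Qed.

(** The two multiplications act at different ends of the word, except when it has
    at most one letter. *)
Lemma lmul_rmul i j (w : seq letter) : lmul i (rmul j w) = rmul j (lmul i w).
Proof.
case: w => [|a w].
  by rewrite [lmul i [::]]/= [RHS](rmul_rcons j [::] i) (_ : rmul j [::] = [:: j]) //= eq_sym.
case/lastP: w => [|w b].
  rewrite [rmul j [:: a]](rmul_rcons j [::] a) /=; case: (eqVneq a j) => [->|aj] /=.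
    case: (eqVneq j i) => [->|ji] //=.
    by rewrite [RHS](rmul_rcons j [:: i] j) eqxx.
  case: (eqVneq a i) => [_|ai] //=.
  by rewrite [RHS](rmul_rcons j [:: i] a) (negbTE aj).
rewrite -rcons_cons rmul_rcons /=.
case: (eqVneq b j) => bj /=; case: (eqVneq a i) => ai;
  by rewrite -?rcons_cons rmul_rcons ?bj ?eqxx ?(negbTE bj).
Qed.

Definition word := {w | reduced w}.
Definition lmulw i (w : word) : word := exist _ (lmul i (val w)) (lmul_reduced i (valP w)).
Definition rmulw j (w : word) : word := exist _ (rmul j (val w)) (rmul_reduced j (valP w)).
Definition nilw : word := exist _ [::] isT.

Lemma lmulwK i : involutive (lmulw i).
Proof. by move=> w; apply: val_inj; rewrite /= lmulK // (valP w). Qed.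
Lemma rmulwK j : involutive (rmulw j).
Proof. by move=> w; apply: val_inj; rewrite /= rmulK // (valP w). Qed.
Lemma lmulw_rmulw i j w : lmulw i (rmulw j w) = rmulw j (lmulw i w).
Proof. by apply: val_inj; rewrite /= lmul_rmul. Qed.

Definition starts i (w : word) : bool := ohead (val w) == Some i.
Lemma starts_lmulw i (w : word) : starts i (lmulw i w) = ~~ starts i w.
Proof.
rewrite /starts; case: w => [[|a w] hw] /=; first by rewrite eqxx.
rewrite -[Some a == _]/(a == i); case: (eqVneq a i) hw => [->|ai] /= hw; last by rewrite eqxx.
by case: w hw => [|b w] //= /andP[ib _]; rewrite -[_ == _]/(b == i) eq_sym (negbTE ib).
Qed.
Lemma starts_inj i j (w : word) : starts i w -> starts j w -> i = j.
Proof. by move=> /eqP h /eqP; rewrite h => -[]. Qed.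
End ReducedWords.

Section Concrete.
Variables (R : realType) (q : R[i]).
Hypothesis hq : `|q| = 1.

(** A site is a level, a word, and the letter that [v_op] multiplies by. *)
Definition site : countType := (nat * word * 'I_5)%type.
Local Notation H := (l2 R site).
Implicit Types (x y : H) (u : site) (i j : 'I_5).

Section Perm.
Variables s s' : site -> site.
Hypotheses (K : cancel s s') (K' : cancel s' s).
Let one_rel (t t' : site -> site) : cancel t t' ->
  shift_rel (fun _ => 1 : R[i]) t (fun _ => 1) t'.
Proof. by move=> tK u _; rewrite (csqR 1) expr1n conjC1 tK. Qed.
Definition perm_shift : pshift R site := PShift (one_rel K) (one_rel K').
End Perm.

Section Diag.
Variables d : site -> R[i].
Hypothesis hd : forall u, d u != 0 -> csq (d u) = 1.
Let diag_rel : shift_rel d id (fun u => Num.conj (d u)) id.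
Proof. by move=> u /hd h; rewrite h. Qed.
Let diag_rel' : shift_rel (fun u => Num.conj (d u)) id d id.
Proof. by move=> u; rewrite conjC_eq0 csq_conj conjCK => /hd h; rewrite h. Qed.
Definition diag_shift : pshift R site := PShift diag_rel diag_rel'.
End Diag.

Definition lam_fun i u : site := (u.1.1, lmulw i u.1.2, u.2).
Lemma lam_funK i : involutive (lam_fun i).
Proof. by move=> [[k w] j]; rewrite /lam_fun /= lmulwK. Qed.
Definition lam i := perm_shift (lam_funK i) (lam_funK i).

Definition v_fun u : site := (u.1.1, rmulw u.2 u.1.2, u.2).
Lemma v_funK : involutive v_fun.
Proof. by move=> [[k w] j]; rewrite /v_fun /= rmulwK. Qed.
Definition v_shift := perm_shift v_funK v_funK.

Definition up_fun u : site := (u.1, ordS u.2).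
Definition down_fun u : site := (u.1, ord_pred u.2).
Lemma up_funK : cancel up_fun down_fun.
Proof. by move=> [u j]; rewrite /up_fun /down_fun /= ordSK. Qed.
Lemma down_funK : cancel down_fun up_fun.
Proof. by move=> [u j]; rewrite /up_fun /down_fun /= ord_predK. Qed.
Definition U_shift := perm_shift down_funK up_funK.

Definition raise_fun u : site := (u.1.1.+1, u.1.2, u.2).
Definition lower_fun u : site := (u.1.1.-1, u.1.2, u.2).
Let S_rel : shift_rel (fun u => (0 < u.1.1)%N%:R : R[i]) lower_fun (fun _ => 1) raise_fun.
Proof.
move=> [[k w] j] /=; case: k => [|k]; first by rewrite eqxx.
by rewrite (csqR 1) expr1n conjC1.
Qed.
Let S_rel' : shift_rel (fun _ => 1) raise_fun (fun u => (0 < u.1.1)%N%:R : R[i]) lower_fun.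
Proof. by move=> [[k w] j] /= _; rewrite (csqR 1) expr1n conjC1. Qed.
Definition S_shift := PShift S_rel S_rel'.

Let csq_q : csq q = 1.
Proof.
have := normr_ge0 q; have := hq; rewrite norm_csq => -[h] _.
by have := sqr_sqrtr (csq_ge0 q); rewrite h expr1n.
Qed.
Let D_unimodular u : q ^+ u.1.1 != 0 -> csq (q ^+ u.1.1) = 1.
Proof.
move=> _; elim: (u.1.1) => [|k ih]; first by rewrite expr0 (csqR 1) expr1n.
by rewrite exprS csqM csq_q ih mulr1.
Qed.
Definition D_shift := diag_shift D_unimodular.

Let Q_unimodular i u : (starts i u.1.2)%:R != 0 :> R[i] -> csq (starts i u.1.2)%:R = 1 :> R.
Proof. by case: starts; rewrite ?eqxx // (csqR 1) expr1n. Qed.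
Definition Q_shift i := diag_shift (@Q_unimodular i).

Let lam_adjoint i : adjoint (wop (lam i)) (wop (lam i)).
Proof.
have -> : adjoint (wop (lam i)) (wop (lam i)) =
  adjoint (wop (lam i)) (wop (psinv (lam i))).
  by congr adjoint; apply/funext => x; apply: l2_ext.
exact: wop_adjoint.
Qed.

Definition left_set : star_set H.
Proof.
apply: (@StarSet _ H [set T | exists i, T = wop (lam i)]) => _ [i ->].
by exists (wop (lam i)); [exists i | exact: lam_adjoint].
Defined.

Lemma wop_star_operator (s : pshift R site) (SS : star_set H) :
  (forall V, starset SS V -> forall x, V (wop s x) = wop s (V x)) ->
  wop s \in in_commutant SS.
Proof.
move=> h; apply/asboolP; split=> //; first by exists (wop (psinv s)); exact: wop_adjoint.
by exists 1; exact: wop_bound.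
Qed.

Lemma left_commute (s : pshift R site) :
  (forall i u, psw s (lam_fun i u) = psw s u) ->
  (forall i u, pss s (lam_fun i u) = lam_fun i (pss s u)) ->
  wop s \in in_commutant left_set.
Proof.
move=> h1 h2; apply: wop_star_operator => _ [i ->] x; apply: l2_ext => u.
by rewrite !wopE /= !mul1r h1 h2.
Qed.

Local Notation C := (commutant left_set).
Definition v_op : C.
Proof.
refine (Commutant (wop v_shift) (left_commute _ _)) => // i [[k w] j].
by rewrite /v_shift /= /v_fun /lam_fun /= lmulw_rmulw.
Defined.
Definition U_op : C.
Proof. by refine (Commutant (wop U_shift) (left_commute _ _)). Defined.
Definition U'_op : C.
Proof. by refine (Commutant (wop (psinv U_shift)) (left_commute _ _)). Defined.
Definition S_op : C.
Proof. by refine (Commutant (wop S_shift) (left_commute _ _)). Defined.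
Definition S'_op : C.
Proof. by refine (Commutant (wop (psinv S_shift)) (left_commute _ _)). Defined.
Definition D_op : C.
Proof. by refine (Commutant (wop D_shift) (left_commute _ _)). Defined.
Definition D'_op : C.
Proof. by refine (Commutant (wop (psinv D_shift)) (left_commute _ _)). Defined.

Let op_eq (S T : C) : (forall x u, S x u = T x u) -> S = T.
Proof. by move=> h; apply: op_ext => x; exact: l2_ext. Qed.

Let U_star : U_op^# = U'_op. Proof. by apply: op_cstarE; exact: wop_adjoint. Qed.
Let S_star : S_op^# = S'_op. Proof. by apply: op_cstarE; exact: wop_adjoint. Qed.
Let D_star : D_op^# = D'_op. Proof. by apply: op_cstarE; exact: wop_adjoint. Qed.
Let v_star : v_op^# = v_op.
Proof.
apply: op_cstarE; have -> : (v_op : H -> H) = wop v_shift by [].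
have {2}-> : wop v_shift = wop (psinv v_shift) by apply/funext => x; exact: l2_ext.
exact: wop_adjoint.
Qed.

Let qcq k : Num.conj (q ^+ k) * q ^+ k = 1.
Proof.
rewrite conjM_csq; have := @D_unimodular (k, nilw, ord0); rewrite /= => ->//.
by rewrite expf_neq0 //; apply: contra_eq_neq csq_q => ->; rewrite csq0 eq_sym oner_eq0.
Qed.

Let vv : v_op ** v_op = cone.
Proof. by apply: op_eq => x u; rewrite /= /wop /= !mul1r v_funK. Qed.
Let UU : U_op^# ** U_op = cone.
Proof. by rewrite U_star; apply: op_eq => x u; rewrite /= !mul1r up_funK. Qed.
Let UU' : U_op ** U_op^# = cone.
Proof. by rewrite U_star; apply: op_eq => x u; rewrite /= !mul1r down_funK. Qed.
Let SS : S_op^# ** S_op = cone.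
Proof. by rewrite S_star; apply: op_eq => x [[k w] j]; rewrite /= !mul1r. Qed.
Let DD : D_op^# ** D_op = cone.
Proof. by rewrite D_star; apply: op_eq => x [[k w] j]; rewrite /= mulrA qcq mul1r. Qed.
Let DD' : D_op ** D_op^# = cone.
Proof.
by rewrite D_star; apply: op_eq => x [[k w] j]; rewrite /= mulrA
  (mulrC (q ^+ k)) qcq mul1r.
Qed.
Let DS : D_op ** S_op = q *: (S_op ** D_op).
Proof.
apply: op_eq => x [[k w] j] /=.
rewrite -[RHS]/(q * ((0 < k)%N%:R * (q ^+ k.-1 * x (k.-1, w, j)))).
rewrite -[LHS]/(q ^+ k * ((0 < k)%N%:R * x (k.-1, w, j))).
by case: k => [|k] /=; rewrite ?mul0r ?mulr0 // !mul1r exprS mulrA.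
Qed.
Let US : U_op ** S_op = S_op ** U_op.
Proof. by apply: op_eq => x [[k w] j] /=; rewrite !mul1r. Qed.
Let UD : U_op ** D_op = D_op ** U_op.
Proof. by apply: op_eq => x [[k w] j] /=; rewrite !mul1r. Qed.
Let vS : v_op ** S_op = S_op ** v_op.
Proof. by apply: op_eq => x [[k w] j] /=; rewrite !mul1r. Qed.
Let vD : v_op ** D_op = D_op ** v_op.
Proof. by apply: op_eq => x [[k w] j] /=; rewrite !mul1r. Qed.

Let P_op : C := (2^-1)%:C *: (cone + v_op).

Definition base_site : site := (0%N, nilw, ord0).
Local Notation base := (delta R base_site).

Let twisted_pair : exists V1 V2 : C, twisted_isometries q V1 V2 /\
  forall n (y : C), level0 S_op D_op y -> corner_conj V1 V2 n ** y =
    iter n (cmul U_op^#) (v_op ** iter n (cmul U_op) y).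
Proof.
have half : (2^-1)%:C + (2^-1)%:C = 1 :> R[i].
  by rewrite -rmorphD /= (_ : 2^-1 + 2^-1 = 1) //; field.
have P1 (w : C) : P_op ** w = (2^-1)%:C *: (w + v_op ** w).
  by rewrite /P_op cmulZl cmulDl cmul1x.
have P2 (w : C) : w ** P_op = (2^-1)%:C *: (w + w ** v_op).
  by rewrite /P_op cmulZr cmulDr cmulx1.
have -> : v_op = P_op + P_op - cone.
  by rewrite /P_op -scalerDl half scale1r addrC addKr.
apply: (@twisted_model R C q hq S_op D_op U_op P_op (cone - P_op)) => //.
- by rewrite -cmulE P1 P2 vv (addrC v_op) -/P_op scalerDr -scalerDl half scale1r.
- rewrite /P_op cstarZ cstarD v_star; congr (_ *: (_ + _)); first exact: conj_real.
  exact: star1.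
- by rewrite -!cmulE P1 P2 vS.
- by rewrite -!cmulE P1 P2 vD.
Qed.

Let perm_delta (s s' : site -> site) (K : cancel s s') (K' : cancel s' s) u :
  wop (perm_shift K K') (delta R u) = delta R (s' u).
Proof. by rewrite wop_delta /= ?oner_eq0 // scale1r. Qed.

Let E_op : C := cone - S_op ** S_op^#.

Let E_level0 : level0 S_op D_op E_op.
Proof.
split; rewrite -cmulE /E_op.
  rewrite (cmulDr S_op^#) cmulx1 -scaleN1r cmulZr scaleN1r cmulA SS cmul1x.
  exact: subrr.
rewrite S_star; apply: op_eq => x [[k w] j].
rewrite -[LHS]/(q ^+ k * (x (k, w, j) - (0 < k)%N%:R * (1 * x (k.-1.+1, w, j)))).
rewrite -[RHS]/(x (k, w, j) - (0 < k)%N%:R * (1 * x (k.-1.+1, w, j))).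
by case: k => [|k]; rewrite ?expr0 ?mul1r // subrr mulr0.
Qed.

Let E_base : E_op base = base.
Proof.
rewrite /E_op S_star; apply: l2_ext => -[[k w] j].
rewrite -[LHS]/(base (k, w, j) - (0 < k)%N%:R * (1 * base (k.-1.+1, w, j))).
by rewrite [X in _ - _ * (1 * X)]deltaE /= !mulr0 subr0.
Qed.

Let iter_opE (T x : C) n z : (iter n (cmul T) x) z = iter n T (x z).
Proof. by elim: n => [//|n ih]; rewrite /= -ih. Qed.

Let iter_U n (w : word) (j : 'I_5) :
  iter n U_op (delta R (0%N, w, j)) = delta R (0%N, w, iter n (@ordS 5) j).
Proof. by elim: n => [//|n ih]; rewrite !iterS ih [LHS]perm_delta. Qed.

Let iter_U' n (w : word) (j : 'I_5) :
  iter n U_op^# (delta R (0%N, w, iter n (@ordS 5) j)) = delta R (0%N, w, j).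
Proof.
elim: n => [//|n ih]; rewrite iterSr -[in RHS]ih; congr iter.
rewrite U_star [LHS](@wop_delta R site (psinv U_shift)) /= ?oner_eq0 // scale1r.
by rewrite /down_fun /= ordSK.
Qed.

Let iter_ordS (i : 'I_5) : iter i (@ordS 5) ord0 = i.
Proof. by apply: val_inj; case: i => [[|[|[|[|[|i]]]]] hi]. Qed.

(** The rotation [U_op] moves the last coordinate from 0 to [i], where [v_op]
    multiplies the word by [i] on the right, and moves it back. So
    [corner_conj V1 V2 i] maps the empty word to the word [i], and [lam i], with
    which it commutes, maps this word back. *)
Theorem nonspatial_pair : exists V1 V2 : C, twisted_isometries q V1 V2 /\
  forall i : 'I_5, corner_conj V1 V2 i (wop (lam i) base) = base.
Proof.
have [V1 [V2 [tw hV]]] := twisted_pair; exists V1, V2; split=> // i.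
rewrite -(op_commutes (corner_conj V1 V2 i)); last by exists i.
rewrite -{1}E_base -op_mulE (hV i E_op E_level0) iter_opE op_mulE iter_opE E_base.
rewrite iter_U iter_ordS [v_op _]perm_delta /v_fun /=.
have := iter_U' i (rmulw i nilw) ord0; rewrite iter_ordS => ->.
rewrite perm_delta /lam_fun /=.
congr (delta R (_, _, _)); apply: val_inj => /=.
by rewrite /rmul /= eqxx.
Qed.
End Concrete.

Theorem corollary1 (R : realType) (q : R[i]) (hq : `|q| = 1)
  (A : unitalCStarAlgType R) (s1 s2 : A) (hA : is_A2q q s1 s2) :
  ~ nuclear A.
Proof.
have [V1 [V2 [tw hV]]] := nonspatial_pair hq.
have [f [fhom f1 f2]] := A2q_universal hA tw.
pose H : hilbertType R := l2 R site.
have f_adj (V : H -> H) : (exists a, V = f a) ->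
    exists2 V' : H -> H, (exists a, V' = f a) & adjoint V V'.
  move=> [a ->]; exists (f a^#); first by exists a^#.
  by rewrite (hom_star fhom); exact: op_cstarP.
pose SS := StarSet f_adj.
have lamP i : wop (lam R i) \in in_commutant SS.
  apply: wop_star_operator => _ [a ->] x.
  by rewrite -(op_commutes (f a)) //; exists i.
pose b i : commutant SS := Commutant _ (lamP i).
have DP (s : pshift R site) : wop s \in in_commutant (no_operators H).
  by apply: wop_star_operator.
pose bD i : commutant (no_operators H) := Commutant _ (DP (lam R i)).
pose QD i : commutant (no_operators H) := Commutant _ (DP (Q_shift R i)).
pose x (i : 'I_5) : A := corner_conj s1 s2 i.
pose base := delta R base_site.
have repE : rep f (family_tensor x b) base = 5%:R *: base.
  rewrite /rep /family_tensor big_map (eq_bigr (fun _ => base)) => [|i _].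
    rewrite big_const_seq count_predT size_enum_ord.
    by rewrite scaler_nat /= !addr0.
  by rewrite /= (corner_conj_hom s1 s2 i fhom) f1 f2; exact: hV.
have bound : spatial_bound (family_tensor x b) (Num.sqrt 5%:R + Num.sqrt 5%:R).
  apply: (@spatial_bound_forget _ _ _ _ _ _ _ bD) => //.
  have opnorm1 (s : pshift R site) (h : wop s \in in_commutant (no_operators H)) :
      opnorm (Commutant _ h) <= 1 by apply: opnorm_le; exact: wop_bound.
  have ext (S T : commutant (no_operators H)) : (forall z u, S z u = T z u) -> S = T.
    by move=> h; apply: op_ext => z; exact: l2_ext.
  apply: (paradoxical_bound (Q := QD)) => //.
  - move=> i; apply: nrm_corner_conj.
      exact: twisted_isometry1 (A2q_relations hA).
    exact: twisted_isometry2 (A2q_relations hA).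
  - by move=> i; exact: opnorm1.
  - by move=> i; exact: opnorm1.
  - move=> i; apply: op_cstarE.
    have {2}-> : (QD i : H -> H) = wop (psinv (Q_shift R i)).
      apply/funext => z; apply: l2_ext => u; rewrite !wopE /=.
      by rewrite conjC_nat.
    exact: wop_adjoint.
  - move=> i j ij; apply: ext => z u; rewrite /= mulrA -natrM mulnb.
    have [/andP[hi hj]|] := boolP (_ && _); last by rewrite mul0r.
    by rewrite (starts_inj hi hj) eqxx in ij.
  - move=> i; apply: ext => z [[k w] j] /=.
    rewrite -[RHS]/((starts i w)%:R * (1 * z (lam_fun i (k, w, j))) +
      1 * ((starts i (lmulw i w))%:R * z (lam_fun i (k, w, j)))).
    by rewrite starts_lmulw; case: starts; rewrite !(mul1r, mul0r) ?addr0 ?add0r.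
have pi_comm a (c : commutant SS) z : f a (c z) = c (f a z).
  by apply: (op_commutes c); exists a.
apply: (not_nuclear_of_bounds fhom pi_comm bound (x := base)).
rewrite repE.
have n5 : fnorm dot (5%:R *: base) = 5.
  rewrite /fnorm (_ : 5%:R = 5%:C :> R[i]); last by rewrite rmorph_nat.
  rewrite (fsqZR dot_psd) -(fnorm_sqr dot_psd) fnorm_delta expr1n mulr1.
  by rewrite sqrtr_sqr ger0_norm.
rewrite n5 fnorm_delta mulr1.
have s0 : 0 <= Num.sqrt 5%:R :> R by exact: sqrtr_ge0.
have s5 : Num.sqrt 5%:R ^+ 2 = 5 :> R by rewrite sqr_sqrtr.
nra.
Qed.
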